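(* Let $\mathbb B$ be the open quaternionic unit ball and let $f:\mathbb B\to\mathbb B$ be slice regular with $f(0)=0$. Suppose $q_0\in\mathbb B$, $q_0\neq0$, and set $\alpha_f(q_0):=\frac{1-|f(q_0)|^2}{1-|q_0|^2}$. Then $$\left|\alpha_f(q_0)f^h(q_0)-q_0^{-1}f(q_0)\right|\le\frac{|q_0|^2-|f(q_0)|^2}{|q_0|(1-|q_0|^2)},$$ where $f^h(q_0)$ is the hyperbolic derivative of $f$ at $q_0$.
   Context: $\mathbb H$ is the skew-field of quaternions, $\mathbb B=\{q\in\mathbb H:|q|<1\}$, $\mathbb S=\{I\in\mathbb H:I^2=-1\}$, $\mathbb C_I=\mathbb R+\mathbb RI$. A function $f:\mathbb B\to\mathbb H$ is slice regular if it has continuous partial derivatives and $\frac12(\partial_x+I\partial_y)f(x+yI)=0$ on $\mathbb B\cap\mathbb C_I$ for every $I\in\mathbb S$; equivalently $f(q)=\sum_{m\ge0}q^ma_m$ with $a_m\in\mathbb H$, converging on $\mathbb B$. For $f=\sum q^ma_m$, $g=\sum q^mb_m$: $f\ast g=\sum_m q^m\sum_{\ell=0}^m a_{m-\ell}b_\ell$ (constants are regarded as constant functions), $f^c=\sum q^m\overline{a_m}$, $f^s=f\ast f^c$, $f^{-\ast}(q)=f^s(q)^{-1}f^c(q)$, slice regular off the zero set of $f^s$. Hyperbolic difference quotient: for slice regular $f:\mathbb B\to\mathbb B$ and $p\in\mathbb B$, let $\mathcal R_{f,p}$ be the unique slice regular function on $\mathbb B$ with $f(q)=f(p)+(q-p)\ast\mathcal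 R_{f,p}(q)$. Then $f^\star_p(q):=(1-q\overline p)\ast\mathcal R_{f,p}(q)\ast(1-\overline{f(p)}\ast f(q))^{-\ast}$. The hyperbolic derivative of $f$ at $p$ is $f^h(p):=f^\star_p(p)$. *)

(* Defs.v *)
From Stdlib Require Import Reals ClassicalEpsilon.
From Coquelicot Require Import Coquelicot.

Open Scope R_scope.

(* The quaternion a + b i + c j + d k is ((a, b), (c, d)).  All the additive,
   topological and normed structure is that of the iterated Coquelicot product;
   its product norm is the Euclidean one (see [norm_quatE]). *)
Definition quat : Type := ((R * R) * (R * R))%type.

Definition Quat (a b c d : R) : quat := ((a, b), (c, d)).
Definition qre (q : quat) : R := fst (fst q).
Definition qim_i (q : quat) : R := snd (fst q).
Definition qim_j (q : quat) : R := fst (snd q).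
Definition qim_k (q : quat) : R := snd (snd q).

Definition RR_NormedModule := prod_NormedModule R_AbsRing R_NormedModule R_NormedModule.
Definition quat_prod := prod_NormedModule R_AbsRing RR_NormedModule RR_NormedModule.

Canonical quat_AbelianMonoid :=
  AbelianMonoid.Pack quat (AbelianMonoid.class quat_prod) quat.
Canonical quat_AbelianGroup :=
  AbelianGroup.Pack quat (AbelianGroup.class quat_prod) quat.
Canonical quat_UniformSpace :=
  UniformSpace.Pack quat (UniformSpace.class quat_prod) quat.
Canonical quat_ModuleSpace :=
  ModuleSpace.Pack R_Ring quat (ModuleSpace.class R_Ring quat_prod) quat.
Canonical quat_NormedModuleAux :=
  NormedModuleAux.Pack R_AbsRing quat (NormedModuleAux.class R_AbsRing quat_prod) quat.
Canonical quat_NormedModule :=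
  NormedModule.Pack R_AbsRing quat (NormedModule.class R_AbsRing quat_prod) quat.

Lemma norm_quatE (q : quat) :
  norm q = sqrt (qre q ^ 2 + qim_i q ^ 2 + qim_j q ^ 2 + qim_k q ^ 2).
Proof.
destruct q as [[a b] [c d]].
change (sqrt (sqrt (Rabs a ^ 2 + Rabs b ^ 2) ^ 2 +
              sqrt (Rabs c ^ 2 + Rabs d ^ 2) ^ 2)
        = sqrt (a ^ 2 + b ^ 2 + c ^ 2 + d ^ 2)).
rewrite !pow2_sqrt by (apply Rplus_le_le_0_compat; apply pow2_ge_0).
rewrite !pow2_abs; f_equal; ring.
Qed.

Definition qmul (p q : quat) : quat :=
  let '((a, b), (c, d)) := p in
  let '((a', b'), (c', d')) := q in
  Quat (a * a' - b * b' - c * c' - d * d')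
       (a * b' + b * a' + c * d' - d * c')
       (a * c' - b * d' + c * a' + d * b')
       (a * d' + b * c' - c * b' + d * a').

Definition qreal (x : R) : quat := Quat x 0 0 0.

Lemma quat_eq (a b c d a' b' c' d' : R) :
  a = a' -> b = b' -> c = c' -> d = d' -> Quat a b c d = Quat a' b' c' d'.
Proof. now intros -> -> -> ->. Qed.

Lemma qmulA (p q r : quat) : qmul p (qmul q r) = qmul (qmul p q) r.
Proof.
destruct p as [[? ?] [? ?]], q as [[? ?] [? ?]], r as [[? ?] [? ?]].
apply quat_eq; simpl; ring.
Qed.

Lemma qmul1r (p : quat) : qmul p (qreal 1) = p.
Proof. destruct p as [[? ?] [? ?]]; apply quat_eq; simpl; ring. Qed.

Lemma qmul1l (p : quat) : qmul (qreal 1) p = p.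
Proof. destruct p as [[? ?] [? ?]]; apply quat_eq; simpl; ring. Qed.

Lemma qmulDl (p q r : quat) : qmul (plus p q) r = plus (qmul p r) (qmul q r).
Proof.
destruct p as [[? ?] [? ?]], q as [[? ?] [? ?]], r as [[? ?] [? ?]].
apply quat_eq; simpl; unfold plus; simpl; ring.
Qed.

Lemma qmulDr (p q r : quat) : qmul p (plus q r) = plus (qmul p q) (qmul p r).
Proof.
destruct p as [[? ?] [? ?]], q as [[? ?] [? ?]], r as [[? ?] [? ?]].
apply quat_eq; simpl; unfold plus; simpl; ring.
Qed.

Definition quat_Ring_mixin :=
  Ring.Mixin quat_AbelianGroup qmul (qreal 1) qmulA qmul1r qmul1l qmulDl qmulDr.
Canonical quat_Ring :=
  Ring.Pack quat
    (Ring.Class quat (AbelianGroup.class quat_AbelianGroup) quat_Ring_mixin) quat.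

Declare Scope quat_scope.
Delimit Scope quat_scope with quat.
Bind Scope quat_scope with quat.
Notation "0" := (@zero quat_AbelianMonoid) : quat_scope.
Notation "1" := (@one quat_Ring) : quat_scope.
Notation "p + q" := (@plus quat_AbelianMonoid p q) : quat_scope.
Notation "- p" := (@opp quat_AbelianGroup p) : quat_scope.
Notation "p - q" := (@minus quat_AbelianGroup p q) : quat_scope.
Notation "p * q" := (@mult quat_Ring p q) : quat_scope.
Notation "q ^ m" := (@pow_n quat_Ring q m) : quat_scope.

Definition qconj (q : quat) : quat :=
  Quat (qre q) (- qim_i q) (- qim_j q) (- qim_k q).

Definition qinv (q : quat) : quat := scal (/ norm q ^ 2) (qconj q).

Definition unit_ball (q : quat) : Prop := norm q < 1.

Definition imaginary_unit (I : quat) : Prop := (I * I = - (1))%quat.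

Definition slice_pt (I : quat) (x y : R) : quat := (qreal x + scal y I)%quat.

(* Functions on the ball are total functions on [quat] whose values outside the
   ball are irrelevant.  The partial derivatives and their (joint) continuity
   are those of (x, y) |-> f (x + y I) on the disc of each slice. *)
Definition slice_regular (f : quat -> quat) : Prop :=
  forall I : quat, imaginary_unit I ->
  exists dx dy : R -> R -> quat,
  forall x y : R, unit_ball (slice_pt I x y) ->
    is_derive (fun t : R => f (slice_pt I t y)) x (dx x y) /\
    is_derive (fun t : R => f (slice_pt I x t)) y (dy x y) /\
    continuous (fun z : R * R => dx (fst z) (snd z)) (x, y) /\
    continuous (fun z : R * R => dy (fst z) (snd z)) (x, y) /\
    scal (/ 2) (dx x y + I * dy x y)%quat = 0%quat.

Definition is_expansion (f : quat -> quat) (a : nat -> quat) : Prop :=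
  forall q : quat, unit_ball q -> is_series (fun m => q ^ m * a m)%quat (f q).

(* The power series coefficients of f at 0; they are determined by f as soon as
   f has an expansion on the ball, and arbitrary otherwise. *)
Definition coeffs (f : quat -> quat) : nat -> quat :=
  epsilon (inhabits (fun _ : nat => 0%quat)) (is_expansion f).

Definition qSeries (u : nat -> quat) : quat :=
  Quat (Series (fun m => qre (u m))) (Series (fun m => qim_i (u m)))
       (Series (fun m => qim_j (u m))) (Series (fun m => qim_k (u m))).

Definition qPSeries (a : nat -> quat) (q : quat) : quat :=
  qSeries (fun m => q ^ m * a m)%quat.

Definition star (f g : quat -> quat) : quat -> quat :=
  qPSeries (fun m => sum_n (fun l => coeffs f (m - l)%nat * coeffs g l)%quat m).

Definition regular_conj (f : quat -> quat) : quat -> quat :=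
  qPSeries (fun m => qconj (coeffs f m)).

Definition symmetrization (f : quat -> quat) : quat -> quat :=
  star f (regular_conj f).

Definition star_inv (f : quat -> quat) (q : quat) : quat :=
  (qinv (symmetrization f q) * regular_conj f q)%quat.

Definition is_difference_quotient (f : quat -> quat) (p : quat)
    (Rfp : quat -> quat) : Prop :=
  slice_regular Rfp /\
  forall q : quat, unit_ball q ->
    f q = (f p + star (fun q => q - p) Rfp q)%quat.

(* Unique on the ball only: the value outside it is an arbitrary choice, which
   the operations above do not see. *)
Definition difference_quotient (f : quat -> quat) (p : quat) : quat -> quat :=
  epsilon (inhabits (fun _ : quat => 0%quat)) (is_difference_quotient f p).

Definition hyp_difference_quotient (f : quat -> quat) (p : quat) : quat -> quat :=
  star (star (fun q => 1 - q * qconj p)%quat (difference_quotient f p))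
       (star_inv (fun q => 1 - star (fun _ => qconj (f p)) f q)%quat).

Definition hyp_derivative (f : quat -> quat) (p : quat) : quat :=
  hyp_difference_quotient f p p.

Definition alpha (f : quat -> quat) (q : quat) : R :=
  (1 - norm (f q) ^ 2) / (1 - norm q ^ 2).

(* Main.v *)
Require Import Defs.
From Stdlib Require Import Reals Arith Lra Lia Psatz ClassicalEpsilon FunctionalExtensionality.
From Coquelicot Require Import Coquelicot.

(** Write [rho] for the modulus of [q0], [w] for [f q0] and [c] for
    [q0^-1 w]. In one complex variable the claim follows from the invariant
    Schwarz lemma: the hyperbolic difference quotient [phi] of [f] at [q0] maps
    the disc to itself, [phi 0 = c] because [f 0 = 0], and [phi q0] is the
    hyperbolic derivative; hence [phi q0] lies in the pseudohyperbolic disc of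
    radius [rho] about [c]. This is a Euclidean disc, and scaling by
    [alpha f q0] moves its centre to [c] and its radius to the bound claimed
    ([scaled_disc]). Since star products do not evaluate pointwise over the
    quaternions, the two facts about [phi] are proved here by Hilbert space
    methods: power series act by star multiplication, that is by convolution of
    coefficients, on square-summable sequences.

    - A regular function has a power series ([slice_regular_expansion]). On the
      slice of [I] this is Cauchy's formula, proved by differentiating along a
      homotopy that contracts the circle to a point; the coefficients of
      different slices agree because they agree on the real axis. Conversely
      power series are regular ([qPSeries_slice_regular]), which provides the
      difference quotient.

    - A function bounded by 1 acts contractively ([bounded_contractive]). On the
      circle of radius [r] its values at [r e^(I t)] are [A + I B], with [A] and
      [B] independent of [I]; star multiplication is multiplication by [A + i B]
      in the complexified quaternions, where [i] is central, and the operator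
      norm of [A + i B] is the supremum of the norms of [A + I B]. Parseval's
      identity concludes.

    - From [phi * (1 - conj(w) * f) = (1 - q conj(q0)) * R] and
      [(q - q0) * R = f - w], the operator of [phi] is contractive: the
      operators of [1 - q conj(q0)] and [q - q0] give vectors of equal norms,
      and [f - w] is dominated by [1 - conj(w) * f] because [f] is contractive
      ([hyperbolic_quotient_contractive]). The star inverse of
      [1 - conj(w) * f] is a geometric series, identified with the pointwise
      formula in [star_inv_expansion].

    - The adjoint of a contractive operator contracts combinations of the
      evaluation vectors at 0 and at [q0]; this is the two-point Pick inequality
      [pick_inequality], which says that [phi q0] lies in the pseudohyperbolic
      disc about [phi 0]. *)

(** * Quaternions in coordinates *)

Lemma quat_ext (p q : quat) :
  qre p = qre q -> qim_i p = qim_i q -> qim_j p = qim_j q -> qim_k p = qim_k q ->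
  p = q.
Proof.
destruct p as [[a b] [c d]], q as [[a' b'] [c' d']]; simpl.
now intros; apply quat_eq.
Qed.

Section Components.
Variables (p q : quat) (x : R).

Lemma qre_plus : qre (p + q)%quat = qre p + qre q. Proof. reflexivity. Qed.
Lemma qim_i_plus : qim_i (p + q)%quat = qim_i p + qim_i q. Proof. reflexivity. Qed.
Lemma qim_j_plus : qim_j (p + q)%quat = qim_j p + qim_j q. Proof. reflexivity. Qed.
Lemma qim_k_plus : qim_k (p + q)%quat = qim_k p + qim_k q. Proof. reflexivity. Qed.
Lemma qre_opp : qre (- p)%quat = - qre p. Proof. reflexivity. Qed.
Lemma qim_i_opp : qim_i (- p)%quat = - qim_i p. Proof. reflexivity. Qed.
Lemma qim_j_opp : qim_j (- p)%quat = - qim_j p. Proof. reflexivity. Qed.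
Lemma qim_k_opp : qim_k (- p)%quat = - qim_k p. Proof. reflexivity. Qed.
Lemma qre_minus : qre (p - q)%quat = qre p - qre q. Proof. reflexivity. Qed.
Lemma qim_i_minus : qim_i (p - q)%quat = qim_i p - qim_i q. Proof. reflexivity. Qed.
Lemma qim_j_minus : qim_j (p - q)%quat = qim_j p - qim_j q. Proof. reflexivity. Qed.
Lemma qim_k_minus : qim_k (p - q)%quat = qim_k p - qim_k q. Proof. reflexivity. Qed.
Lemma qre_scal : qre (scal x p) = x * qre p. Proof. reflexivity. Qed.
Lemma qim_i_scal : qim_i (scal x p) = x * qim_i p. Proof. reflexivity. Qed.
Lemma qim_j_scal : qim_j (scal x p) = x * qim_j p. Proof. reflexivity. Qed.
Lemma qim_k_scal : qim_k (scal x p) = x * qim_k p. Proof. reflexivity. Qed.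
Lemma qre_conj : qre (qconj p) = qre p. Proof. reflexivity. Qed.
Lemma qim_i_conj : qim_i (qconj p) = - qim_i p. Proof. reflexivity. Qed.
Lemma qim_j_conj : qim_j (qconj p) = - qim_j p. Proof. reflexivity. Qed.
Lemma qim_k_conj : qim_k (qconj p) = - qim_k p. Proof. reflexivity. Qed.

Lemma qre_mult : qre (p * q)%quat =
  qre p * qre q - qim_i p * qim_i q - qim_j p * qim_j q - qim_k p * qim_k q.
Proof. now destruct p as [[? ?] [? ?]], q as [[? ?] [? ?]]. Qed.

Lemma qim_i_mult : qim_i (p * q)%quat =
  qre p * qim_i q + qim_i p * qre q + qim_j p * qim_k q - qim_k p * qim_j q.
Proof. now destruct p as [[? ?] [? ?]], q as [[? ?] [? ?]]. Qed.

Lemma qim_j_mult : qim_j (p * q)%quat =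
  qre p * qim_j q - qim_i p * qim_k q + qim_j p * qre q + qim_k p * qim_i q.
Proof. now destruct p as [[? ?] [? ?]], q as [[? ?] [? ?]]. Qed.

Lemma qim_k_mult : qim_k (p * q)%quat =
  qre p * qim_k q + qim_i p * qim_j q - qim_j p * qim_i q + qim_k p * qre q.
Proof. now destruct p as [[? ?] [? ?]], q as [[? ?] [? ?]]. Qed.
End Components.

Lemma qre_Quat a b c d : qre (Quat a b c d) = a. Proof. reflexivity. Qed.
Lemma qim_i_Quat a b c d : qim_i (Quat a b c d) = b. Proof. reflexivity. Qed.
Lemma qim_j_Quat a b c d : qim_j (Quat a b c d) = c. Proof. reflexivity. Qed.
Lemma qim_k_Quat a b c d : qim_k (Quat a b c d) = d. Proof. reflexivity. Qed.
Lemma one_Quat : 1%quat = Quat 1 0 0 0. Proof. reflexivity. Qed.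
Lemma zero_Quat : 0%quat = Quat 0 0 0 0. Proof. reflexivity. Qed.

Global Hint Rewrite qre_plus qim_i_plus qim_j_plus qim_k_plus
  qre_opp qim_i_opp qim_j_opp qim_k_opp
  qre_minus qim_i_minus qim_j_minus qim_k_minus
  qre_scal qim_i_scal qim_j_scal qim_k_scal
  qre_conj qim_i_conj qim_j_conj qim_k_conj
  qre_mult qim_i_mult qim_j_mult qim_k_mult
  one_Quat zero_Quat qre_Quat qim_i_Quat qim_j_Quat qim_k_Quat : quatc.

Ltac qcomp := unfold slice_pt, qreal; autorewrite with quatc.
Ltac qcomp_all := unfold slice_pt, qreal in *; autorewrite with quatc in *.
(* Sums and powers are abstracted first, so that rewriting with the coordinates
   of [p + q] and [p * q] does not try to unfold them. *)
Ltac qgen := repeat match goal with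
  | |- context [@sum_n ?G ?u ?n] => generalize (@sum_n G u n); intro
  | |- context [@pow_n ?G ?u ?n] => generalize (@pow_n G u n); intro
  | |- context [qPSeries ?a ?q] => generalize (qPSeries a q); intro
  end.
Ltac qring := intros; qgen; apply quat_ext; unfold slice_pt, qreal; autorewrite with quatc; ring.

(** The squared norm is kept as a polynomial in the coordinates, so that norm
    identities become identities for [ring]. *)
Definition normsq (q : quat) : R :=
  qre q ^ 2 + qim_i q ^ 2 + qim_j q ^ 2 + qim_k q ^ 2.

Lemma normsq_ge0 q : 0 <= normsq q.
Proof. unfold normsq; nra. Qed.

Lemma norm_normsq q : norm q = sqrt (normsq q).
Proof. apply norm_quatE. Qed.

Lemma norm_sq q : norm q ^ 2 = normsq q.
Proof. rewrite norm_normsq; apply pow2_sqrt, normsq_ge0. Qed.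

Lemma qnorm_ge0 (q : quat) : 0 <= norm q.
Proof. apply norm_ge_0. Qed.

Lemma normsq_mult p q : normsq (p * q)%quat = normsq p * normsq q.
Proof. unfold normsq; qcomp; ring. Qed.

Lemma normsq_conj p : normsq (qconj p) = normsq p.
Proof. unfold normsq; qcomp; ring. Qed.

Lemma normsq_scal x p : normsq (scal x p) = x ^ 2 * normsq p.
Proof. unfold normsq; qcomp; ring. Qed.

Lemma normsq_zero : normsq 0%quat = 0.
Proof. unfold normsq; qcomp; ring. Qed.

Lemma normsq_eq0 q : normsq q = 0 -> q = 0%quat.
Proof. unfold normsq; intros H; apply quat_ext; qcomp; nra. Qed.

Lemma norm_le_normsq (p : quat) x : 0 <= x -> normsq p <= x ^ 2 -> norm p <= x.
Proof.
intros Hx H; rewrite norm_normsq, <- (sqrt_pow2 x Hx).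
now apply sqrt_le_1_alt.
Qed.

Lemma normsq_le_norm (p : quat) x : norm p <= x -> normsq p <= x ^ 2.
Proof. intros H; rewrite <- norm_sq; generalize (qnorm_ge0 p); nra. Qed.

Lemma norm_mult (p q : quat) : norm (p * q)%quat = norm p * norm q.
Proof.
now rewrite !norm_normsq, normsq_mult, sqrt_mult by apply normsq_ge0.
Qed.

Lemma norm_conj (p : quat) : norm (qconj p) = norm p.
Proof. now rewrite !norm_normsq, normsq_conj. Qed.

Lemma norm_scalq x (p : quat) : norm (scal x p) = Rabs x * norm p.
Proof.
rewrite !norm_normsq, normsq_scal, sqrt_mult, <- (sqrt_Rsqr_abs x).
- unfold Rsqr; do 2 f_equal; ring.
- nra.
- apply normsq_ge0.
Qed.

Lemma norm_one : norm 1%quat = 1.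
Proof. rewrite norm_normsq; unfold normsq; qcomp.
transitivity (sqrt 1); [f_equal; ring | apply sqrt_1].
Qed.

Lemma norm_zeroq : norm 0%quat = 0.
Proof. rewrite norm_normsq, normsq_zero; apply sqrt_0. Qed.

Lemma norm_qreal x : norm (qreal x) = Rabs x.
Proof.
replace (qreal x) with (scal x 1%quat) by qring.
rewrite norm_scalq, norm_one; ring.
Qed.

Lemma norm_pow (q : quat) m : norm (q ^ m)%quat = norm q ^ m.
Proof.
induction m as [|m IH]; simpl; [apply norm_one|].
now rewrite norm_mult, IH.
Qed.

Lemma norm_plus (p q : quat) : norm (p + q)%quat <= norm p + norm q.
Proof. apply norm_triangle. Qed.

Lemma norm_oppq (p : quat) : norm (- p)%quat = norm p.
Proof. apply (norm_opp (V := quat_NormedModule)). Qed.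

Lemma norm_minus (p q : quat) : norm (p - q)%quat <= norm p + norm q.
Proof. unfold minus; rewrite <- (norm_oppq q); apply norm_plus. Qed.

Lemma norm_eq0q (p : quat) : norm p = 0 -> p = 0%quat.
Proof. intros H; apply normsq_eq0; rewrite <- norm_sq, H; ring. Qed.

Lemma Rabs_le_sqrt x y : x ^ 2 <= y -> Rabs x <= sqrt y.
Proof.
intros H; rewrite <- sqrt_Rsqr_abs; apply sqrt_le_1_alt; unfold Rsqr; lra.
Qed.

Lemma Rabs_qre (q : quat) : Rabs (qre q) <= norm q.
Proof. rewrite norm_normsq; apply Rabs_le_sqrt; unfold normsq; nra. Qed.
Lemma Rabs_qim_i (q : quat) : Rabs (qim_i q) <= norm q.
Proof. rewrite norm_normsq; apply Rabs_le_sqrt; unfold normsq; nra. Qed.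
Lemma Rabs_qim_j (q : quat) : Rabs (qim_j q) <= norm q.
Proof. rewrite norm_normsq; apply Rabs_le_sqrt; unfold normsq; nra. Qed.
Lemma Rabs_qim_k (q : quat) : Rabs (qim_k q) <= norm q.
Proof. rewrite norm_normsq; apply Rabs_le_sqrt; unfold normsq; nra. Qed.

Lemma norm_le_components (q : quat) :
  norm q <= Rabs (qre q) + Rabs (qim_i q) + Rabs (qim_j q) + Rabs (qim_k q).
Proof.
apply norm_le_normsq.
- generalize (Rabs_pos (qre q)) (Rabs_pos (qim_i q)) (Rabs_pos (qim_j q))
    (Rabs_pos (qim_k q)); lra.
- unfold normsq.
  rewrite <- (pow2_abs (qre q)), <- (pow2_abs (qim_i q)),
    <- (pow2_abs (qim_j q)), <- (pow2_abs (qim_k q)).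
  generalize (Rabs_pos (qre q)) (Rabs_pos (qim_i q)) (Rabs_pos (qim_j q))
    (Rabs_pos (qim_k q)); nra.
Qed.

Lemma qmult_assoc (p q r : quat) : (p * (q * r) = p * q * r)%quat.
Proof. apply mult_assoc. Qed.

Lemma qconj_mult p q : qconj (p * q)%quat = (qconj q * qconj p)%quat.
Proof. qring. Qed.
Lemma qconj_plus p q : qconj (p + q)%quat = (qconj p + qconj q)%quat.
Proof. qring. Qed.
Lemma qconj_invol p : qconj (qconj p) = p.
Proof. qring. Qed.
Lemma qmult_conj_r p : (p * qconj p)%quat = qreal (normsq p).
Proof. apply quat_ext; unfold normsq; qcomp; ring. Qed.
Lemma qmult_conj_l p : (qconj p * p)%quat = qreal (normsq p).
Proof. apply quat_ext; unfold normsq; qcomp; ring. Qed.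

Lemma qinv_l (q : quat) : q <> 0%quat -> (qinv q * q)%quat = 1%quat.
Proof.
intros Hq; unfold qinv; rewrite norm_sq.
assert (normsq q <> 0) by (intros H; now apply Hq, normsq_eq0).
replace (scal (/ normsq q) (qconj q) * q)%quat
  with (scal (/ normsq q) (qconj q * q)%quat) by qring.
rewrite qmult_conj_l; apply quat_ext; qcomp; field; assumption.
Qed.

Lemma qmult_one_l (q : quat) : (1 * q)%quat = q. Proof. apply mult_one_l. Qed.
Lemma qmult_one_r (q : quat) : (q * 1)%quat = q. Proof. apply mult_one_r. Qed.
Lemma qmult_zero_l (q : quat) : (0 * q)%quat = 0%quat. Proof. qring. Qed.
Lemma qmult_zero_r (q : quat) : (q * 0)%quat = 0%quat. Proof. qring. Qed.
Lemma qplus_zero_r (q : quat) : (q + 0)%quat = q. Proof. qring. Qed.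

(** * Series of quaternions *)

Lemma qre_sum_n (u : nat -> quat) n : qre (sum_n u n) = sum_n (fun k => qre (u k)) n.
Proof. induction n as [|n IH]; [now rewrite !sum_O|]; now rewrite !sum_Sn, <- IH. Qed.
Lemma qim_i_sum_n (u : nat -> quat) n : qim_i (sum_n u n) = sum_n (fun k => qim_i (u k)) n.
Proof. induction n as [|n IH]; [now rewrite !sum_O|]; now rewrite !sum_Sn, <- IH. Qed.
Lemma qim_j_sum_n (u : nat -> quat) n : qim_j (sum_n u n) = sum_n (fun k => qim_j (u k)) n.
Proof. induction n as [|n IH]; [now rewrite !sum_O|]; now rewrite !sum_Sn, <- IH. Qed.
Lemma qim_k_sum_n (u : nat -> quat) n : qim_k (sum_n u n) = sum_n (fun k => qim_k (u k)) n.
Proof. induction n as [|n IH]; [now rewrite !sum_O|]; now rewrite !sum_Sn, <- IH. Qed.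

Lemma norm_sum_nq (u : nat -> quat) n :
  norm (sum_n u n) <= sum_n (fun k => norm (u k)) n.
Proof. apply norm_sum_n_m. Qed.

Lemma qsum_mult_l (c : quat) (u : nat -> quat) n :
  sum_n (fun k => c * u k)%quat n = (c * sum_n u n)%quat.
Proof. apply (sum_n_mult_l (K := quat_Ring)). Qed.

Lemma qsum_mult_r (c : quat) (u : nat -> quat) n :
  sum_n (fun k => u k * c)%quat n = (sum_n u n * c)%quat.
Proof. apply (sum_n_mult_r (K := quat_Ring)). Qed.

Lemma qsum_plus (u v : nat -> quat) n :
  (sum_n u n + sum_n v n)%quat = sum_n (fun k => u k + v k)%quat n.
Proof. symmetry; apply (sum_n_plus (G := quat_AbelianMonoid)). Qed.

Lemma qsum_minus (u v : nat -> quat) n :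
  (sum_n u n - sum_n v n)%quat = sum_n (fun k => u k - v k)%quat n.
Proof.
induction n as [|n IH]; [now rewrite !sum_O|].
rewrite !sum_Sn, <- IH.
change ((sum_n u n + u (S n)) - (sum_n v n + v (S n))
  = (sum_n u n - sum_n v n) + (u (S n) - v (S n)))%quat.
generalize (sum_n u n) (sum_n v n); qring.
Qed.

Lemma filterlim_quat {T : Type} (F : (T -> Prop) -> Prop) {FF : Filter F}
    (u : T -> quat) (l : quat) :
  filterlim u F (locally l) <->
  forall eps, 0 < eps -> F (fun x => norm (u x - l)%quat < eps).
Proof.
rewrite (filterlim_locally_ball_norm (U := quat_NormedModule)).
split; intros H.
- intros e He; exact (H (mkposreal e He)).
- intros [e He]; exact (H e He).
Qed.

Lemma filterlim_realq {T : Type} (F : (T -> Prop) -> Prop) {FF : Filter F}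
    (u : T -> R) (l : R) :
  filterlim u F (locally l) <->
  forall eps, 0 < eps -> F (fun x => Rabs (u x - l) < eps).
Proof.
rewrite (filterlim_locally_ball_norm (U := R_NormedModule)).
split; intros H.
- intros e He; exact (H (mkposreal e He)).
- intros [e He]; exact (H e He).
Qed.

Lemma filterlim_components {T : Type} (F : (T -> Prop) -> Prop) {FF : Filter F}
    (u : T -> quat) (l : quat) :
  filterlim u F (locally l) <->
  filterlim (fun x => qre (u x)) F (locally (qre l)) /\
  filterlim (fun x => qim_i (u x)) F (locally (qim_i l)) /\
  filterlim (fun x => qim_j (u x)) F (locally (qim_j l)) /\
  filterlim (fun x => qim_k (u x)) F (locally (qim_k l)).
Proof.
rewrite filterlim_quat, !filterlim_realq by assumption.
split.
- intros H; repeat split; intros e He; generalize (H e He); apply filter_imp;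
    intros x Hx; (eapply Rle_lt_trans; [|exact Hx]).
  + rewrite <- qre_minus; apply Rabs_qre.
  + rewrite <- qim_i_minus; apply Rabs_qim_i.
  + rewrite <- qim_j_minus; apply Rabs_qim_j.
  + rewrite <- qim_k_minus; apply Rabs_qim_k.
- intros (H0 & H1 & H2 & H3) e He.
  assert (He4 : 0 < e / 4) by lra.
  generalize (filter_and _ _ (H0 _ He4) (filter_and _ _ (H1 _ He4)
    (filter_and _ _ (H2 _ He4) (H3 _ He4)))).
  apply filter_imp; intros x (K0 & K1 & K2 & K3).
  eapply Rle_lt_trans; [apply norm_le_components|]; qcomp; lra.
Qed.

Lemma is_series_components (u : nat -> quat) (l : quat) :
  is_series u l <->
  is_series (fun n => qre (u n)) (qre l) /\
  is_series (fun n => qim_i (u n)) (qim_i l) /\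
  is_series (fun n => qim_j (u n)) (qim_j l) /\
  is_series (fun n => qim_k (u n)) (qim_k l).
Proof.
unfold is_series.
rewrite (filterlim_components eventually).
split; intros (H0 & H1 & H2 & H3); repeat split.
all: eapply filterlim_ext; [|eassumption]; intros n; simpl.
- apply qre_sum_n.
- apply qim_i_sum_n.
- apply qim_j_sum_n.
- apply qim_k_sum_n.
- symmetry; apply qre_sum_n.
- symmetry; apply qim_i_sum_n.
- symmetry; apply qim_j_sum_n.
- symmetry; apply qim_k_sum_n.
Qed.

Lemma is_series_uniq (u : nat -> quat) (l l' : quat) :
  is_series u l -> is_series u l' -> l = l'.
Proof.
intros H H'.
rewrite is_series_components in H, H'.
destruct H as (A & B & C & D), H' as (A' & B' & C' & D').
apply is_series_unique in A, B, C, D, A', B', C', D'.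
apply quat_ext; congruence.
Qed.

Lemma qSeries_unique (u : nat -> quat) (l : quat) : is_series u l -> qSeries u = l.
Proof.
intros H; rewrite is_series_components in H; destruct H as (A & B & C & D).
apply is_series_unique in A, B, C, D.
now apply quat_ext; unfold qSeries; qcomp.
Qed.

Lemma qSeries_correct (u : nat -> quat) :
  ex_series (fun n => norm (u n)) -> is_series u (qSeries u).
Proof.
intros H.
assert (K : forall g : quat -> R, (forall q, Rabs (g q) <= norm q) ->
          ex_series (fun n => g (u n))).
{ intros g Hg; apply (ex_series_le (V := R_CompleteNormedModule)
    (fun n => g (u n)) (fun n => norm (u n))); [|exact H].
  intros n; apply Hg. }
rewrite is_series_components; unfold qSeries; autorewrite with quatc.
repeat split; apply Series_correct, K.
- apply Rabs_qre.
- apply Rabs_qim_i.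
- apply Rabs_qim_j.
- apply Rabs_qim_k.
Qed.

Lemma small_factor (c e : R) :
  0 <= c -> 0 < e ->
  exists e', 0 < e' /\ forall x, 0 <= x -> x < e' -> c * x < e.
Proof.
intros Hc He; exists (e / (c + 1)); split.
- apply Rdiv_lt_0_compat; lra.
- intros x Hx Hlt.
  apply (Rmult_lt_compat_r (c + 1)) in Hlt; [|lra].
  replace (e / (c + 1) * (c + 1)) with e in Hlt by (field; lra).
  nra.
Qed.

Lemma is_series_qmult_l (c : quat) (u : nat -> quat) (l : quat) :
  is_series u l -> is_series (fun n => c * u n)%quat (c * l)%quat.
Proof.
unfold is_series; rewrite !(filterlim_quat eventually).
intros H e He.
destruct (small_factor (norm c) e (qnorm_ge0 c) He) as (e' & He' & K).
generalize (H _ He'); apply filter_imp; intros n Hn.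
rewrite qsum_mult_l.
replace (c * sum_n u n - c * l)%quat with (c * (sum_n u n - l))%quat by qring.
rewrite norm_mult; apply K; [apply qnorm_ge0 | exact Hn].
Qed.

Lemma is_series_qmult_r (c : quat) (u : nat -> quat) (l : quat) :
  is_series u l -> is_series (fun n => u n * c)%quat (l * c)%quat.
Proof.
unfold is_series; rewrite !(filterlim_quat eventually).
intros H e He.
destruct (small_factor (norm c) e (qnorm_ge0 c) He) as (e' & He' & K).
generalize (H _ He'); apply filter_imp; intros n Hn.
rewrite qsum_mult_r.
replace (sum_n u n * c - l * c)%quat with ((sum_n u n - l) * c)%quat by qring.
rewrite norm_mult, Rmult_comm; apply K; [apply qnorm_ge0 | exact Hn].
Qed.

Lemma is_series_qplus (u v : nat -> quat) (l l' : quat) :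
  is_series u l -> is_series v l' -> is_series (fun n => u n + v n)%quat (l + l')%quat.
Proof. apply (is_series_plus (V := quat_NormedModule)). Qed.

Lemma is_series_norm_le (u : nat -> quat) (l : quat) (M : R) :
  is_series u l -> (forall n, norm (sum_n u n) <= M) -> norm l <= M.
Proof.
intros H HM; apply Rnot_lt_le; intros Hlt.
unfold is_series in H; rewrite (filterlim_quat eventually) in H.
destruct (H (norm l - M)) as [N HN]; [lra|].
assert (H1 : norm (sum_n u N - l)%quat < norm l - M) by exact (HN N (Nat.le_refl N)).
assert (H2 : norm (sum_n u N) <= M) by apply HM.
assert (norm l <= norm (sum_n u N) + norm (sum_n u N - l)%quat).
{ replace l with (sum_n u N - (sum_n u N - l))%quat at 1 by qring.
  apply norm_minus. }
lra.
Qed.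

Lemma is_series_bounded (u : nat -> quat) (l : quat) :
  is_series u l -> exists M, forall n, norm (u n) <= M.
Proof.
intros H; rewrite is_series_components in H; destruct H as (A & B & C & D).
assert (K : forall (v : nat -> R) (x : R), is_series v x ->
  exists M, forall n, Rabs (v n) <= M).
{ intros v x Hv.
  assert (Hl : is_lim_seq v 0) by (apply ex_series_lim_0; now exists x).
  assert (ex : ex_finite_lim_seq v) by now exists 0.
  destruct (filterlim_bounded (V := R_NormedModule) v) as [M HM].
  { exists 0; exact Hl. }
  now exists M. }
destruct (K _ _ A) as [Ma Ha], (K _ _ B) as [Mb Hb],
  (K _ _ C) as [Mc Hc], (K _ _ D) as [Md Hd].
exists (Ma + Mb + Mc + Md); intros n.
eapply Rle_trans; [apply norm_le_components|].
generalize (Ha n) (Hb n) (Hc n) (Hd n); lra.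
Qed.

Ltac as_real := match goal with |- @eq _ ?a ?b => change (@eq R a b) end.

(** * The algebra of formal power series *)

(** The coefficients of the star product, that is the product of formal power
    series whose variable commutes with the coefficients. *)
Definition conv (a b : nat -> quat) : nat -> quat :=
  fun m => sum_n (fun l => a (m - l)%nat * b l)%quat m.

(* Coefficients of products are abstracted as well. *)
Ltac qgen ::= repeat match goal with
  | |- context [@sum_n ?G ?u ?n] => generalize (@sum_n G u n); intro
  | |- context [@pow_n ?G ?u ?n] => generalize (@pow_n G u n); intro
  | |- context [qPSeries ?a ?q] => generalize (qPSeries a q); intro
  | |- context [conv ?a ?b ?m] => generalize (conv a b m); intro
  end.

Definition tail (a : nat -> quat) : nat -> quat := fun m => a (S m).

Definition conj_seq (a : nat -> quat) : nat -> quat := fun m => qconj (a m).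

(** The series of the functions [c] and [c + q d]. *)
Definition single (c : quat) : nat -> quat :=
  fun m => match m with O => c | S _ => 0%quat end.

Definition affine (c d : quat) : nat -> quat :=
  fun m => match m with O => c | S m' => single d m' end.

Lemma sum_n_split_first {G : AbelianMonoid} (u : nat -> G) m :
  sum_n u (S m) = plus (u O) (sum_n (fun l => u (S l)) m).
Proof.
induction m as [|m IH].
- now rewrite sum_Sn, !sum_O.
- rewrite sum_Sn, IH, sum_Sn; symmetry; apply plus_assoc.
Qed.

Lemma conv_0 a b : conv a b 0 = (a 0%nat * b 0%nat)%quat.
Proof. apply sum_O. Qed.

(** This recursion and [conv_S_r] replace manipulations of triangular sums: the
    algebraic laws below follow from them by induction on the degree. *)
Lemma conv_S a b m :
  conv a b (S m) = (conv (tail a) b m + a 0%nat * b (S m))%quat.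
Proof.
unfold conv; rewrite sum_Sn; apply f_equal2.
- apply sum_n_ext_loc; intros n Hn; unfold tail.
  now replace (S m - n)%nat with (S (m - n)) by lia.
- now rewrite Nat.sub_diag.
Qed.

Lemma conv_S_r a b m :
  conv a b (S m) = (a (S m) * b 0%nat + conv a (tail b) m)%quat.
Proof. unfold conv; now rewrite sum_n_split_first. Qed.

Lemma conv_ext_le a a' b b' m :
  (forall n, (n <= m)%nat -> a n = a' n) -> (forall n, (n <= m)%nat -> b n = b' n) ->
  conv a b m = conv a' b' m.
Proof.
intros Ha Hb; apply sum_n_ext_loc; intros n Hn.
now rewrite Ha, Hb by lia.
Qed.

Lemma conv_plus_l a b c m :
  conv (fun n => a n + b n)%quat c m = (conv a c m + conv b c m)%quat.
Proof.
revert a b; induction m as [|m IH]; intros a b.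
- rewrite !conv_0; qring.
- rewrite !conv_S.
  change (tail (fun n => a n + b n)%quat) with (fun n => tail a n + tail b n)%quat.
  rewrite IH; qring.
Qed.

Lemma conv_minus_l a b c m :
  conv (fun n => a n - b n)%quat c m = (conv a c m - conv b c m)%quat.
Proof.
revert a b; induction m as [|m IH]; intros a b.
- rewrite !conv_0; qring.
- rewrite !conv_S.
  change (tail (fun n => a n - b n)%quat) with (fun n => tail a n - tail b n)%quat.
  rewrite IH; qring.
Qed.

Lemma conv_mult_l x a b m :
  conv (fun n => x * a n)%quat b m = (x * conv a b m)%quat.
Proof.
revert a; induction m as [|m IH]; intros a.
- rewrite !conv_0; qring.
- rewrite !conv_S.
  change (tail (fun n => x * a n)%quat) with (fun n => x * tail a n)%quat.
  rewrite IH; qring.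
Qed.

Lemma conv_0_l b m : conv (fun _ => 0%quat) b m = 0%quat.
Proof.
induction m as [|m IH]; [rewrite conv_0; qring|].
rewrite conv_S; change (tail (fun _ => 0%quat)) with (fun _ : nat => 0%quat).
rewrite IH; qring.
Qed.

Lemma conv_single_l c b m : conv (single c) b m = (c * b m)%quat.
Proof.
destruct m as [|m]; [apply conv_0|].
rewrite conv_S; change (tail (single c)) with (fun _ : nat => 0%quat).
rewrite conv_0_l; apply plus_zero_l.
Qed.

Lemma conv_single_r a c m : conv a (single c) m = (a m * c)%quat.
Proof.
revert a; induction m as [|m IH]; intros a; [apply conv_0|].
rewrite conv_S, IH; unfold tail; simpl; qring.
Qed.

Lemma conv_affine_S c d b m :
  conv (affine c d) b (S m) = (d * b m + c * b (S m))%quat.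
Proof.
rewrite conv_S; change (tail (affine c d)) with (single d).
now rewrite conv_single_l.
Qed.

Lemma conv_assoc a b c m : conv (conv a b) c m = conv a (conv b c) m.
Proof.
revert a b; induction m as [|m IH]; intros a b.
- rewrite !conv_0; symmetry; apply qmult_assoc.
- rewrite !conv_S.
  replace (tail (conv a b))
    with (fun n => conv (tail a) b n + a 0%nat * tail b n)%quat
    by (apply functional_extensionality; intros n; unfold tail at 3; now rewrite conv_S).
  rewrite conv_plus_l, (conv_mult_l (a 0%nat) (tail b)), IH, !conv_0.
  qring.
Qed.

(** Conjugation exchanges the two recursions for the product. *)
Lemma conv_conj a b m : qconj (conv a b m) = conv (conj_seq b) (conj_seq a) m.
Proof.
revert a; induction m as [|m IH]; intros a.
- rewrite !conv_0; apply qconj_mult.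
- rewrite conv_S, conv_S_r, qconj_plus, IH, qconj_mult.
  apply plus_comm.
Qed.

(** * Formal inverses *)

Fixpoint neumann (u : nat -> quat) (j : nat) : nat -> quat :=
  match j with
  | O => fun _ => 0%quat
  | S j => fun m => (single 1 m + conv u (neumann u j) m)%quat
  end.

(** The star inverse of [1 - u] for [u] without constant term; the partial
    sums of the geometric series of [u] are stationary at each degree. *)
Definition geometric (u : nat -> quat) : nat -> quat := fun m => neumann u (S m) m.

Lemma conv_no_constant u b b' m : u 0%nat = 0%quat ->
  (forall n, (n < m)%nat -> b n = b' n) -> conv u b m = conv u b' m.
Proof.
intros Hu Hb; destruct m as [|m].
- now rewrite !conv_0, Hu, !qmult_zero_l.
- rewrite !conv_S, Hu, !qmult_zero_l; apply f_equal2; [|easy].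
  apply conv_ext_le; [easy|]; intros n Hn; apply Hb; lia.
Qed.

Lemma neumann_stationary u j m : u 0%nat = 0%quat ->
  (m < j)%nat -> neumann u j m = geometric u m.
Proof.
intros Hu; revert j; induction m as [m IH] using (well_founded_induction Wf_nat.lt_wf).
intros [|j] Hj; [lia|]; unfold geometric; simpl; f_equal.
apply conv_no_constant; [easy|]; intros n Hn.
now rewrite !IH by lia.
Qed.

Lemma geometric_eq u m : u 0%nat = 0%quat ->
  geometric u m = (single 1 m + conv u (geometric u) m)%quat.
Proof.
intros Hu; unfold geometric at 1; simpl; f_equal.
apply conv_no_constant; [easy|]; intros n Hn.
now apply neumann_stationary.
Qed.

Lemma geometric_right_inverse u m : u 0%nat = 0%quat ->
  conv (fun n => single 1 n - u n)%quat (geometric u) m = single 1 m.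
Proof.
intros Hu; rewrite conv_minus_l, conv_single_l, qmult_one_l.
rewrite (geometric_eq u m Hu) at 1; qring.
Qed.

Lemma geometric_left_inverse u m : u 0%nat = 0%quat ->
  conv (geometric u) (fun n => single 1 n - u n)%quat m = single 1 m.
Proof.
intros Hu.
set (k := fun n => (single 1 n - u n)%quat).
set (v := fun n => (single 1 n - geometric u n)%quat).
assert (Hv : v 0%nat = 0%quat).
{ unfold v; rewrite (geometric_eq u 0 Hu), conv_0, Hu; simpl; qring. }
assert (Ev : geometric u = (fun n => single 1 n - v n)%quat).
{ apply functional_extensionality; intros n; unfold v; qring. }
assert (K1 : conv k (geometric u) = single 1).
{ apply functional_extensionality; intros n; now apply geometric_right_inverse. }
assert (K2 : conv (geometric u) (geometric v) = single 1).
{ apply functional_extensionality; intros n; rewrite Ev.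
  now apply geometric_right_inverse. }
(* a left and a right inverse of [geometric u] coincide *)
assert (Ek : k = geometric v).
{ apply functional_extensionality; intros n.
  rewrite <- (qmult_one_r (k n)), <- conv_single_r, <- K2, <- conv_assoc, K1.
  now rewrite conv_single_l, qmult_one_l. }
now rewrite Ek, K2.
Qed.

(** * Series converging on the ball *)

(** Cauchy-type bounds, equivalent to convergence on the unit ball. *)
Definition tame (a : nat -> quat) : Prop :=
  forall r, 0 < r < 1 -> exists M, forall m, norm (a m) * r ^ m <= M.

Lemma tame_ex_series a r : tame a -> 0 <= r < 1 ->
  ex_series (fun m => norm (a m) * r ^ m).
Proof.
intros Ha Hr.
destruct (Ha ((1 + r) / 2)) as [M HM]; [lra|].
apply (ex_series_le (V := R_CompleteNormedModule) _
  (fun m => M * (r / ((1 + r) / 2)) ^ m)).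
- intros m.
  change (Rabs (norm (a m) * r ^ m) <= M * (r / ((1 + r) / 2)) ^ m).
  assert (Hp : 0 < ((1 + r) / 2) ^ m) by (apply pow_lt; lra).
  assert (Hq : 0 <= (r / ((1 + r) / 2)) ^ m).
  { apply pow_le, Rmult_le_pos; [lra|]; left; apply Rinv_0_lt_compat; lra. }
  assert (E : r ^ m = ((1 + r) / 2) ^ m * (r / ((1 + r) / 2)) ^ m).
  { rewrite <- Rpow_mult_distr; f_equal; field; lra. }
  rewrite Rabs_pos_eq, E, <- Rmult_assoc.
  + apply Rmult_le_compat_r; [exact Hq | apply HM].
  + apply Rmult_le_pos; [apply qnorm_ge0 | now apply pow_le].
- apply (ex_series_scal_l (K := R_AbsRing) (V := R_NormedModule) M).
  apply ex_series_geom; rewrite Rabs_pos_eq.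
  + apply Rmult_lt_reg_r with ((1 + r) / 2); [lra|].
    unfold Rdiv at 1; rewrite Rmult_assoc, Rinv_l; lra.
  + apply Rmult_le_pos; [lra|]; left; apply Rinv_0_lt_compat; lra.
Qed.

Lemma qnorm_pow_mult (q : quat) m (c : quat) :
  norm (q ^ m * c)%quat = norm c * norm q ^ m.
Proof. rewrite norm_mult, norm_pow; apply Rmult_comm. Qed.

Lemma tame_abs a q : tame a -> unit_ball q ->
  ex_series (fun m => norm (q ^ m * a m)%quat).
Proof.
intros Ha Hq.
apply (ex_series_ext (V := R_NormedModule) (fun m => norm (a m) * norm q ^ m)).
- intros m; symmetry; apply qnorm_pow_mult.
- apply tame_ex_series; [exact Ha|]; split; [apply qnorm_ge0 | exact Hq].
Qed.

Lemma tame_is_expansion a : tame a -> is_expansion (qPSeries a) a.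
Proof. intros Ha q Hq; now apply qSeries_correct, tame_abs. Qed.

Lemma ball_real x : Rabs x < 1 -> unit_ball (qreal x).
Proof. intros H; unfold unit_ball; now rewrite norm_qreal. Qed.

Lemma qreal_pow x m : (qreal x ^ m)%quat = qreal (x ^ m).
Proof. induction m as [|m IH]; [reflexivity|]; change (qreal x * qreal x ^ m = qreal (x * x ^ m))%quat; rewrite IH; qring.
Qed.

(** Convergence at the real point [r] bounds the terms there. *)
Lemma expansion_tame f a : is_expansion f a -> tame a.
Proof.
intros H r Hr.
destruct (is_series_bounded _ _ (H (qreal r) (ball_real r ltac:(rewrite Rabs_pos_eq; lra))))
  as [M HM].
exists M; intros m; eapply Rle_trans; [|apply HM].
rewrite qnorm_pow_mult, norm_qreal, (Rabs_pos_eq r) by lra; apply Rle_refl.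
Qed.

Lemma pseries_coefficients_unique (a b : nat -> R) (F : R -> R) rho : 0 < rho ->
  (forall x, Rabs x < rho -> is_series (fun m => x ^ m * a m) (F x)) ->
  (forall x, Rabs x < rho -> is_series (fun m => x ^ m * b m) (F x)) ->
  forall m, a m = b m.
Proof.
intros Hrho.
assert (K : forall c : nat -> R,
  (forall x, Rabs x < rho -> is_series (fun m => x ^ m * c m) (F x)) ->
  Rbar_lt 0 (CV_radius c) /\ forall x, Rabs x < rho -> PSeries c x = F x).
{ intros c Hc; split.
  - apply Rbar_lt_le_trans with (rho / 2); [simpl; lra|].
    apply CV_radius_bounded.
    destruct (filterlim_bounded (V := R_NormedModule) (fun m => (rho / 2) ^ m * c m))
      as [M HM].
    + exists 0.
      apply (ex_series_lim_0 (fun m => (rho / 2) ^ m * c m)).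
      exists (F (rho / 2)); apply Hc; rewrite Rabs_pos_eq; lra.
    + exists M; intros n; rewrite Rmult_comm; apply HM.
  - intros x Hx; apply is_series_unique; eapply is_series_ext; [|apply (Hc x Hx)].
    intros n; simpl; apply Rmult_comm. }
intros Ha Hb m; apply K in Ha, Hb; destruct Ha as [Ha1 Ha2], Hb as [Hb1 Hb2].
apply PSeries_ext_recip; [easy|easy|].
exists (mkposreal rho Hrho); intros x Hx.
change (Rabs (x - 0) < rho) in Hx; rewrite Rminus_0_r in Hx.
now rewrite Ha2, Hb2.
Qed.

(** The restriction to a real interval around 0 already determines the
    coefficients, whichever slice they were computed on. *)
Lemma real_expansion_unique (F : R -> quat) a b rho : 0 < rho ->
  (forall x, Rabs x < rho -> is_series (fun m => qreal x ^ m * a m)%quat (F x)) ->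
  (forall x, Rabs x < rho -> is_series (fun m => qreal x ^ m * b m)%quat (F x)) ->
  a = b.
Proof.
intros Hrho Ha Hb; apply functional_extensionality; intros m.
assert (K : forall c, (forall x, Rabs x < rho ->
    is_series (fun m => qreal x ^ m * c m)%quat (F x)) ->
  (forall x, Rabs x < rho -> is_series (fun m => x ^ m * qre (c m)) (qre (F x))) /\
  (forall x, Rabs x < rho -> is_series (fun m => x ^ m * qim_i (c m)) (qim_i (F x))) /\
  (forall x, Rabs x < rho -> is_series (fun m => x ^ m * qim_j (c m)) (qim_j (F x))) /\
  (forall x, Rabs x < rho -> is_series (fun m => x ^ m * qim_k (c m)) (qim_k (F x)))).
{ intros c Hc.
  repeat split; intros x Hx; specialize (Hc x Hx); rewrite is_series_components in Hc;
    destruct Hc as (A & B & C & D).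
  - eapply is_series_ext; [|exact A]; intros n; cbv beta; rewrite qreal_pow; qcomp; as_real; ring.
  - eapply is_series_ext; [|exact B]; intros n; cbv beta; rewrite qreal_pow; qcomp; as_real; ring.
  - eapply is_series_ext; [|exact C]; intros n; cbv beta; rewrite qreal_pow; qcomp; as_real; ring.
  - eapply is_series_ext; [|exact D]; intros n; cbv beta; rewrite qreal_pow; qcomp; as_real; ring. }
apply K in Ha, Hb.
destruct Ha as (A & B & C & D), Hb as (A' & B' & C' & D').
apply quat_ext.
- apply (pseries_coefficients_unique _ _ _ rho Hrho A A').
- apply (pseries_coefficients_unique _ _ _ rho Hrho B B').
- apply (pseries_coefficients_unique _ _ _ rho Hrho C C').
- apply (pseries_coefficients_unique _ _ _ rho Hrho D D').
Qed.

Lemma expansion_unique f a b : is_expansion f a -> is_expansion f b -> a = b.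
Proof.
intros Ha Hb; apply (real_expansion_unique (fun x => f (qreal x)) a b 1 Rlt_0_1).
- intros x Hx; apply Ha, ball_real, Hx.
- intros x Hx; apply Hb, ball_real, Hx.
Qed.

Lemma coeffs_eq f a : is_expansion f a -> coeffs f = a.
Proof.
intros H; apply (expansion_unique f); [|exact H].
unfold coeffs; apply epsilon_spec; now exists a.
Qed.

Lemma is_expansion_ext f g a :
  (forall q, unit_ball q -> f q = g q) -> is_expansion f a -> is_expansion g a.
Proof. intros E H q Hq; rewrite <- E by exact Hq; now apply H. Qed.

Lemma expansion_at_zero f a : is_expansion f a -> f 0%quat = a 0%nat.
Proof.
intros H.
assert (H0 : is_expansion f a) by exact H.
specialize (H0 0%quat ltac:(unfold unit_ball; rewrite norm_zeroq; lra)).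
eapply is_series_uniq; [exact H0|].
unfold is_series; eapply filterlim_ext; [|apply filterlim_const].
intros n; simpl.
induction n as [|n IH].
- rewrite sum_O; simpl; symmetry; apply qmult_one_l.
- rewrite sum_Sn, <- IH; simpl; rewrite qmult_zero_l, qmult_zero_l; symmetry.
  apply (plus_zero_r (G := quat_AbelianMonoid)).
Qed.

Lemma sum_n_nonneg_bounded (u : nat -> R) : (forall n, 0 <= u n) -> ex_series u ->
  exists B, forall n, sum_n u n <= B.
Proof.
intros Hu [l Hl]; exists l; intros n.
apply (is_lim_seq_incr_compare (sum_n u)); [exact Hl|].
intros m; rewrite sum_Sn; change (sum_n u m <= sum_n u m + u (S m)).
generalize (Hu (S m)); lra.
Qed.

Lemma sum_n_le (u v : nat -> R) n : (forall k, (k <= n)%nat -> u k <= v k) ->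
  sum_n u n <= sum_n v n.
Proof.
induction n as [|n IH]; intros H.
- rewrite !sum_O; now apply H.
- rewrite !sum_Sn; apply Rplus_le_compat; [|now apply H].
  apply IH; intros k Hk; apply H; lia.
Qed.

(** Bounded terms of one factor against summable terms of the other. *)
Lemma tame_conv a b : tame a -> tame b -> tame (conv a b).
Proof.
intros Ha Hb r Hr.
destruct (Ha r Hr) as [M HM].
destruct (sum_n_nonneg_bounded (fun m => norm (b m) * r ^ m)) as [B HB].
{ intros m; apply Rmult_le_pos; [apply qnorm_ge0 | apply pow_le; lra]. }
{ apply tame_ex_series; [exact Hb | lra]. }
exists (M * B); intros m.
assert (HM0 : 0 <= M).
{ eapply Rle_trans; [|apply (HM O)]; simpl; rewrite Rmult_1_r; apply qnorm_ge0. }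
apply Rle_trans with (sum_n (fun l => M * (norm (b l) * r ^ l)) m).
- apply Rle_trans with (sum_n (fun l => norm (a (m - l)%nat * b l)%quat) m * r ^ m).
  + apply Rmult_le_compat_r; [apply pow_le; lra | apply norm_sum_nq].
  + rewrite <- (sum_n_mult_r (K := R_Ring) (r ^ m)).
    apply sum_n_le; intros l Hl.
    change (norm (a (m - l)%nat * b l)%quat * r ^ m <= M * (norm (b l) * r ^ l)).
    rewrite norm_mult.
    replace (r ^ m) with (r ^ (m - l) * r ^ l)
      by (rewrite <- pow_add; f_equal; lia).
    generalize (HM (m - l)%nat); intros K.
    replace (norm (a (m - l)%nat) * norm (b l) * (r ^ (m - l) * r ^ l))
      with (norm (a (m - l)%nat) * r ^ (m - l) * (norm (b l) * r ^ l)) by ring.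
    apply Rmult_le_compat_r; [|exact K].
    apply Rmult_le_pos; [apply qnorm_ge0 | apply pow_le; lra].
- rewrite (sum_n_mult_l (K := R_Ring) M).
  apply Rmult_le_compat_l; [exact HM0 | apply HB].
Qed.

Lemma star_is_expansion f g a b : is_expansion f a -> is_expansion g b ->
  is_expansion (star f g) (conv a b).
Proof.
intros Ha Hb; unfold star.
rewrite (coeffs_eq f a Ha), (coeffs_eq g b Hb).
apply (tame_is_expansion (conv a b)), tame_conv; now eapply expansion_tame; eassumption.
Qed.

Lemma regular_conj_is_expansion f a : is_expansion f a ->
  is_expansion (regular_conj f) (conj_seq a).
Proof.
intros Ha; unfold regular_conj; rewrite (coeffs_eq f a Ha).
apply (tame_is_expansion (conj_seq a)).
intros r Hr; destruct (expansion_tame f a Ha r Hr) as [M HM].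
exists M; intros m; unfold conj_seq; rewrite norm_conj; apply HM.
Qed.

Lemma is_expansion_affine c d : is_expansion (fun q => c + q * d)%quat (affine c d).
Proof.
intros q _.
unfold is_series; rewrite (filterlim_quat eventually); intros e He.
exists 1%nat; intros [|n] Hn; [lia|].
assert (E : sum_n (fun m => q ^ m * affine c d m)%quat (S n) = (c + q * d)%quat).
{ clear Hn; induction n as [|n IH].
  - rewrite sum_Sn, sum_O; simpl; rewrite qmult_one_l, qmult_one_r; reflexivity.
  - rewrite sum_Sn; etransitivity; [apply f_equal2; [exact IH|reflexivity]|].
    simpl affine; rewrite qmult_zero_r; apply qplus_zero_r. }
apply Rle_lt_trans with (norm 0%quat); [|now rewrite norm_zeroq].
apply Req_le, f_equal; etransitivity; [exact (f_equal (fun x => x - (c + q * d))%quat E)|].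
qring.
Qed.

Lemma is_expansion_const c : is_expansion (fun _ => c) (single c).
Proof.
replace (single c) with (affine c 0%quat).
- eapply is_expansion_ext; [|apply is_expansion_affine].
  intros q _; simpl; rewrite qmult_zero_r; apply qplus_zero_r.
- apply functional_extensionality; now intros [|[|m]].
Qed.

Lemma is_expansion_minus f g a b : is_expansion f a -> is_expansion g b ->
  is_expansion (fun q => f q - g q)%quat (fun m => a m - b m)%quat.
Proof.
intros Ha Hb q Hq.
eapply is_series_ext; [|apply (is_series_minus (V := quat_NormedModule) _ _ _ _ (Ha q Hq) (Hb q Hq))].
intros n; simpl.
change ((q ^ n * a n + - (q ^ n * b n)) = q ^ n * (a n - b n))%quat.
qring.
Qed.

(** * Evaluation of products by a central series *)

Lemma real_cauchy_product (u v : nat -> R) lu lv :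
  is_series u lu -> is_series v lv ->
  ex_series (fun n => Rabs (u n)) -> ex_series (fun n => Rabs (v n)) ->
  is_series (fun n => sum_n (fun k => u (n - k)%nat * v k) n) (lu * lv).
Proof.
intros Hu Hv Au Av.
rewrite Rmult_comm.
eapply is_series_ext; [|apply (is_series_mult v u lv lu Hv Hu Av Au)].
intros n; simpl; rewrite <- sum_n_Reals; apply sum_n_ext; intros k; apply Rmult_comm.
Qed.

Lemma sum_n_four (A B C D : nat -> R) (x y z : R) n :
  sum_n (fun k => A k + x * B k + y * C k + z * D k) n =
  sum_n A n + x * sum_n B n + y * sum_n C n + z * sum_n D n.
Proof.
induction n as [|n IH]; [now rewrite !sum_O|].
rewrite !sum_Sn, IH; unfold plus; simpl; ring.
Qed.

Lemma is_series_four (A B C D : nat -> R) (la lb lc ld x y z : R) :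
  is_series A la -> is_series B lb -> is_series C lc -> is_series D ld ->
  is_series (fun k => A k + x * B k + y * C k + z * D k)
    (la + x * lb + y * lc + z * ld).
Proof.
intros HA HB HC HD.
apply (is_series_plus (V := R_NormedModule)
  (fun k => A k + x * B k + y * C k) (fun k => z * D k)).
- apply (is_series_plus (V := R_NormedModule) (fun k => A k + x * B k) (fun k => y * C k)).
  + apply (is_series_plus (V := R_NormedModule) A (fun k => x * B k)); [exact HA|].
    now apply (is_series_scal (V := R_NormedModule) x).
  + now apply (is_series_scal (V := R_NormedModule) y).
- now apply (is_series_scal (V := R_NormedModule) z).
Qed.

Lemma cauchy_product (u v : nat -> quat) (lu lv : quat) :
  is_series u lu -> is_series v lv ->
  ex_series (fun n => norm (u n)) -> ex_series (fun n => norm (v n)) ->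
  is_series (fun n => sum_n (fun k => u (n - k)%nat * v k)%quat n) (lu * lv)%quat.
Proof.
intros Hu Hv Au Av.
assert (K : forall (w : nat -> quat) (g : quat -> R), (forall q, Rabs (g q) <= norm q) ->
   ex_series (fun n => norm (w n)) -> ex_series (fun n => Rabs (g (w n)))).
{ intros w g Hg H; apply (ex_series_le (V := R_CompleteNormedModule) _
    (fun n => norm (w n))); [|exact H].
  intros n; change (Rabs (Rabs (g (w n))) <= norm (w n)); rewrite Rabs_Rabsolu; apply Hg. }
rewrite is_series_components in Hu, Hv.
destruct Hu as (u0 & u1 & u2 & u3), Hv as (v0 & v1 & v2 & v3).
assert (u0' := K u qre Rabs_qre Au).
assert (u1' := K u qim_i Rabs_qim_i Au).
assert (u2' := K u qim_j Rabs_qim_j Au).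
assert (u3' := K u qim_k Rabs_qim_k Au).
assert (v0' := K v qre Rabs_qre Av).
assert (v1' := K v qim_i Rabs_qim_i Av).
assert (v2' := K v qim_j Rabs_qim_j Av).
assert (v3' := K v qim_k Rabs_qim_k Av).
rewrite is_series_components; repeat split; qcomp.
- replace (qre lu * qre lv - qim_i lu * qim_i lv - qim_j lu * qim_j lv - qim_k lu * qim_k lv)
    with (qre lu * qre lv + -1 * (qim_i lu * qim_i lv) + -1 * (qim_j lu * qim_j lv)
          + -1 * (qim_k lu * qim_k lv)) by ring.
  eapply is_series_ext; [|apply is_series_four; apply real_cauchy_product; eassumption].
  intros n; simpl; rewrite qre_sum_n, <- sum_n_four; apply sum_n_ext; intros k; qcomp; as_real; ring.
- replace (qre lu * qim_i lv + qim_i lu * qre lv + qim_j lu * qim_k lv - qim_k lu * qim_j lv)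
    with (qre lu * qim_i lv + 1 * (qim_i lu * qre lv) + 1 * (qim_j lu * qim_k lv)
          + -1 * (qim_k lu * qim_j lv)) by ring.
  eapply is_series_ext; [|apply is_series_four; apply real_cauchy_product; eassumption].
  intros n; simpl; rewrite qim_i_sum_n, <- sum_n_four; apply sum_n_ext; intros k; qcomp; as_real; ring.
- replace (qre lu * qim_j lv - qim_i lu * qim_k lv + qim_j lu * qre lv + qim_k lu * qim_i lv)
    with (qre lu * qim_j lv + -1 * (qim_i lu * qim_k lv) + 1 * (qim_j lu * qre lv)
          + 1 * (qim_k lu * qim_i lv)) by ring.
  eapply is_series_ext; [|apply is_series_four; apply real_cauchy_product; eassumption].
  intros n; simpl; rewrite qim_j_sum_n, <- sum_n_four; apply sum_n_ext; intros k; qcomp; as_real; ring.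
- replace (qre lu * qim_k lv + qim_i lu * qim_j lv - qim_j lu * qim_i lv + qim_k lu * qre lv)
    with (qre lu * qim_k lv + 1 * (qim_i lu * qim_j lv) + -1 * (qim_j lu * qim_i lv)
          + 1 * (qim_k lu * qre lv)) by ring.
  eapply is_series_ext; [|apply is_series_four; apply real_cauchy_product; eassumption].
  intros n; simpl; rewrite qim_k_sum_n, <- sum_n_four; apply sum_n_ext; intros k; qcomp; as_real; ring.
Qed.

Lemma pow_n_plus (q : quat) m n : (q ^ (m + n) = q ^ m * q ^ n)%quat.
Proof.
induction m as [|m IH]; simpl; [now rewrite qmult_one_l|].
now rewrite IH, qmult_assoc.
Qed.

Definition central (s : nat -> quat) : Prop := forall m (q : quat), (s m * q = q * s m)%quat.

(** Quaternions fixed by conjugation are real. *)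
Lemma central_of_conj_fixed (s : nat -> quat) :
  (forall m, qconj (s m) = s m) -> central s.
Proof.
intros H m q; specialize (H m).
assert (H1 := f_equal qim_i H); assert (H2 := f_equal qim_j H);
  assert (H3 := f_equal qim_k H); qcomp_all.
assert (E1 : qim_i (s m) = 0) by lra; assert (E2 : qim_j (s m) = 0) by lra;
  assert (E3 : qim_k (s m) = 0) by lra.
apply quat_ext; qcomp; rewrite E1, E2, E3; ring.
Qed.

Lemma conv_central s a m : central s -> conv s a m = conv a s m.
Proof.
intros Hs; revert s Hs; induction m as [|m IH]; intros s Hs.
- rewrite !conv_0; apply Hs.
- rewrite conv_S, conv_S_r, Hs, IH by (intros n; apply Hs).
  apply plus_comm.
Qed.

(** Powers of [q] move past central coefficients; without this the star product
    does not evaluate pointwise. *)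
Lemma qPSeries_conv_central s a q : central s -> tame s -> tame a -> unit_ball q ->
  qPSeries (conv s a) q = (qPSeries s q * qPSeries a q)%quat.
Proof.
intros Hs Ts Ta Hq; apply qSeries_unique.
eapply is_series_ext; [|apply cauchy_product;
  [apply (tame_is_expansion s Ts q Hq) | apply (tame_is_expansion a Ta q Hq)
  | now apply tame_abs | now apply tame_abs]].
intros n; simpl; unfold conv; rewrite <- qsum_mult_l.
apply sum_n_ext_loc; intros k Hk.
replace (q ^ n)%quat with (q ^ (n - k) * q ^ k)%quat
  by (rewrite <- pow_n_plus; f_equal; lia).
change ((q ^ (n - k) * s (n - k)%nat) * (q ^ k * a k)
  = (q ^ (n - k) * q ^ k) * (s (n - k)%nat * a k))%quat.
rewrite <- !qmult_assoc; f_equal.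
now rewrite !qmult_assoc, Hs.
Qed.

(** * Continuity and differentiation of quaternion-valued functions *)

Lemma continuous_components {U : UniformSpace} (F : U -> quat) (x : U) :
  continuous F x <->
  continuous (fun t => qre (F t)) x /\ continuous (fun t => qim_i (F t)) x /\
  continuous (fun t => qim_j (F t)) x /\ continuous (fun t => qim_k (F t)) x.
Proof. apply (filterlim_components (locally x)). Qed.

Section RealContinuity.
Context {U : UniformSpace}.
Variables (f g : U -> R) (x : U).
Hypotheses (Hf : continuous f x) (Hg : continuous g x).

Lemma continuous_Rmult : continuous (fun t => f t * g t) x.
Proof. exact (continuous_mult (K := R_AbsRing) f g x Hf Hg). Qed.
Lemma continuous_Rplus : continuous (fun t => f t + g t) x.
Proof. exact (continuous_plus (V := R_NormedModule) f g x Hf Hg). Qed.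
Lemma continuous_Rminus : continuous (fun t => f t - g t) x.
Proof. exact (continuous_minus (V := R_NormedModule) f g x Hf Hg). Qed.
Lemma continuous_Ropp : continuous (fun t => - f t) x.
Proof. exact (continuous_opp (V := R_NormedModule) f x Hf). Qed.
End RealContinuity.

Lemma continuous_Rpow {U : UniformSpace} (f : U -> R) (x : U) n :
  continuous f x -> continuous (fun t => f t ^ n) x.
Proof.
intros Hf; induction n as [|n IH]; simpl; [apply continuous_const|].
now apply continuous_Rmult.
Qed.

Ltac rcont := repeat match goal with
  | H : _ |- _ => exact H
  | |- continuous (fun _ => _ + _) _ => apply continuous_Rplus
  | |- continuous (fun _ => _ - _) _ => apply continuous_Rminus
  | |- continuous (fun _ => _ * _) _ => apply continuous_Rmult
  | |- continuous (fun _ => - _) _ => apply continuous_Ropp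
  | |- continuous (fun _ => _ ^ _) _ => apply continuous_Rpow
  | |- continuous (fun _ => cos _) _ =>
      refine (continuous_comp _ cos _ _ (continuous_cos _))
  | |- continuous (fun _ => sin _) _ =>
      refine (continuous_comp _ sin _ _ (continuous_sin _))
  | |- continuous fst _ => apply continuous_fst
  | |- continuous snd _ => apply continuous_snd
  | |- continuous (fun _ => fst _) _ => apply continuous_fst
  | |- continuous (fun _ => snd _) _ => apply continuous_snd
  | |- continuous (fun _ => _) _ => apply continuous_const
  end.

Lemma continuous_qmult {U : UniformSpace} (F G : U -> quat) (x : U) :
  continuous F x -> continuous G x -> continuous (fun t => F t * G t)%quat x.
Proof.
rewrite !continuous_components; intros (A & B & C & D) (A' & B' & C' & D').
repeat split.
- apply (continuous_ext (fun t => qre (F t) * qre (G t) - qim_i (F t) * qim_i (G t)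
    - qim_j (F t) * qim_j (G t) - qim_k (F t) * qim_k (G t))); [intros t; now rewrite qre_mult|rcont].
- apply (continuous_ext (fun t => qre (F t) * qim_i (G t) + qim_i (F t) * qre (G t)
    + qim_j (F t) * qim_k (G t) - qim_k (F t) * qim_j (G t))); [intros t; now rewrite qim_i_mult|rcont].
- apply (continuous_ext (fun t => qre (F t) * qim_j (G t) - qim_i (F t) * qim_k (G t)
    + qim_j (F t) * qre (G t) + qim_k (F t) * qim_i (G t))); [intros t; now rewrite qim_j_mult|rcont].
- apply (continuous_ext (fun t => qre (F t) * qim_k (G t) + qim_i (F t) * qim_j (G t)
    - qim_j (F t) * qim_i (G t) + qim_k (F t) * qre (G t))); [intros t; now rewrite qim_k_mult|rcont].
Qed.

Lemma continuous_qplus {U : UniformSpace} (F G : U -> quat) (x : U) :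
  continuous F x -> continuous G x -> continuous (fun t => F t + G t)%quat x.
Proof. apply (continuous_plus (V := quat_NormedModule)). Qed.

Lemma continuous_qconst {U : UniformSpace} (c : quat) (x : U) :
  continuous (fun _ : U => c) x.
Proof. apply continuous_const. Qed.

Lemma continuous_qminus {U : UniformSpace} (F G : U -> quat) (x : U) :
  continuous F x -> continuous G x -> continuous (fun t => F t - G t)%quat x.
Proof. apply (continuous_minus (V := quat_NormedModule)). Qed.

Lemma continuous_qpow {U : UniformSpace} (F : U -> quat) (x : U) n :
  continuous F x -> continuous (fun t => F t ^ n)%quat x.
Proof.
intros HF; induction n as [|n IH]; [apply continuous_qconst|].
exact (continuous_qmult F (fun t => F t ^ n)%quat x HF IH).
Qed.

Lemma continuous_slice_pt {U : UniformSpace} I (f g : U -> R) (x : U) :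
  continuous f x -> continuous g x -> continuous (fun t => slice_pt I (f t) (g t)) x.
Proof.
intros Hf Hg; rewrite continuous_components; unfold slice_pt.
repeat split; autorewrite with quatc; rcont.
- apply (continuous_ext (fun t => f t + g t * qre I)); [reflexivity|rcont].
- apply (continuous_ext (fun t => 0 + g t * qim_i I)); [reflexivity|rcont].
- apply (continuous_ext (fun t => 0 + g t * qim_j I)); [reflexivity|rcont].
- apply (continuous_ext (fun t => 0 + g t * qim_k I)); [reflexivity|rcont].
Qed.

Lemma continuous_qre {U : UniformSpace} (F : U -> quat) (x : U) :
  continuous F x -> continuous (fun t => qre (F t)) x.
Proof. rewrite continuous_components; tauto. Qed.

(** Real-linear functionals of the form [q |-> Re (c q)] separate quaternions
    and reduce calculus in [quat] to calculus in [R]. *)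
Lemma is_linear_functional c :
  is_linear (U := quat_NormedModule) (V := R_NormedModule) (fun q => qre (c * q)%quat).
Proof.
split.
- intros p q; change (qre (c * (p + q))%quat = qre (c * p)%quat + qre (c * q)%quat).
  rewrite <- qre_plus; f_equal; qring.
- intros k p; change (qre (c * scal k p)%quat = k * qre (c * p)%quat).
  rewrite <- qre_scal; f_equal; qring.
- exists (norm c + 1); split; [generalize (qnorm_ge0 c); lra|]; intros q.
  change (Rabs (qre (c * q)%quat) <= (norm c + 1) * norm q).
  eapply Rle_trans; [apply Rabs_qre|]; rewrite norm_mult.
  apply Rmult_le_compat_r; [apply qnorm_ge0 | lra].
Qed.

Lemma is_derive_functional c (F : R -> quat) x (l : quat) :
  is_derive F x l -> is_derive (fun t => qre (c * F t)%quat) x (qre (c * l)%quat).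
Proof.
intros H; unfold is_derive in *.
apply (filterdiff_ext_lin _ (fun y : R => qre (c * scal y l)%quat)).
- apply (filterdiff_comp' (U := R_NormedModule) (V := quat_NormedModule) (W := R_NormedModule)
    F (fun q => qre (c * q)%quat) x (fun y => scal y l) (fun q => qre (c * q)%quat));
    [exact H|].
  apply filterdiff_linear, is_linear_functional.
- intros y; change (qre (c * scal y l)%quat = y * qre (c * l)%quat).
  rewrite <- qre_scal; f_equal; qring.
Qed.

(** * Imaginary units and slices *)

Lemma imaginary_unit_components I : imaginary_unit I ->
  qre I = 0 /\ qim_i I ^ 2 + qim_j I ^ 2 + qim_k I ^ 2 = 1.
Proof.
unfold imaginary_unit; intros H.
assert (H0 := f_equal qre H); assert (H1 := f_equal qim_i H);
  assert (H2 := f_equal qim_j H); assert (H3 := f_equal qim_k H); qcomp_all.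
assert (E : qre I = 0).
{ destruct (Req_dec (qre I) 0) as [E|E]; [exact E|].
  assert (qim_i I = 0) by (apply (Rmult_eq_reg_l (qre I)); [lra|exact E]).
  assert (qim_j I = 0) by (apply (Rmult_eq_reg_l (qre I)); [lra|exact E]).
  assert (qim_k I = 0) by (apply (Rmult_eq_reg_l (qre I)); [lra|exact E]).
  nra. }
split; [exact E | nra].
Qed.

Lemma normsq_slice_pt I x y : imaginary_unit I -> normsq (slice_pt I x y) = x ^ 2 + y ^ 2.
Proof.
intros HI; destruct (imaginary_unit_components I HI) as [E N].
unfold normsq; qcomp; rewrite E.
replace (x ^ 2 + y ^ 2)
  with (x ^ 2 + y ^ 2 * (qim_i I ^ 2 + qim_j I ^ 2 + qim_k I ^ 2)) by (rewrite N; ring).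
ring.
Qed.

Lemma normsq_lt1 q : unit_ball q <-> normsq q < 1.
Proof.
unfold unit_ball; rewrite <- norm_sq; generalize (qnorm_ge0 q).
split; nra.
Qed.

Lemma slice_pt_ball I x y : imaginary_unit I ->
  (unit_ball (slice_pt I x y) <-> x ^ 2 + y ^ 2 < 1).
Proof. intros HI; now rewrite normsq_lt1, normsq_slice_pt. Qed.

Lemma slice_pt_mult I x y x' y' : imaginary_unit I ->
  (slice_pt I x y * slice_pt I x' y' =
   slice_pt I (x * x' - y * y') (x * y' + y * x'))%quat.
Proof.
intros HI; destruct (imaginary_unit_components I HI) as [E N].
apply quat_ext; qcomp; rewrite ?E; try ring.
replace (y * y') with (y * y' * (qim_i I ^ 2 + qim_j I ^ 2 + qim_k I ^ 2))
  by (rewrite N; ring).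
ring.
Qed.

Lemma slice_pt_comm I x y x' y' : imaginary_unit I ->
  (slice_pt I x y * slice_pt I x' y' = slice_pt I x' y' * slice_pt I x y)%quat.
Proof. intros HI; rewrite !slice_pt_mult by exact HI; f_equal; ring. Qed.

Lemma slice_pt_unit_pow I t m : imaginary_unit I ->
  (slice_pt I (cos t) (sin t) ^ m)%quat = slice_pt I (cos (INR m * t)) (sin (INR m * t)).
Proof.
intros HI; induction m as [|m IH].
- simpl INR; rewrite Rmult_0_l, cos_0, sin_0.
  apply quat_ext; change (slice_pt I (cos t) (sin t) ^ 0)%quat with 1%quat; qcomp; ring.
- change (slice_pt I (cos t) (sin t) * slice_pt I (cos t) (sin t) ^ m =
    slice_pt I (cos (INR (S m) * t)) (sin (INR (S m) * t)))%quat.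
  rewrite IH, slice_pt_mult, S_INR by exact HI.
  replace ((INR m + 1) * t) with (t + INR m * t) by ring.
  rewrite cos_plus, sin_plus; f_equal; ring.
Qed.

Lemma circle_sq r t : (r * cos t) ^ 2 + (r * sin t) ^ 2 = r ^ 2.
Proof.
transitivity (r ^ 2 * ((sin t)² + (cos t)²)); [unfold Rsqr; ring|].
rewrite sin2_cos2; ring.
Qed.

Lemma disc_open x y : x ^ 2 + y ^ 2 < 1 ->
  locally (x, y) (fun u : R * R => fst u ^ 2 + snd u ^ 2 < 1).
Proof.
intros H.
assert (C : continuous (fun u : R * R => fst u ^ 2 + snd u ^ 2) (x, y)).
{ apply continuous_Rplus; apply continuous_Rpow; [apply continuous_fst | apply continuous_snd]. }
apply (C (fun v => v < 1)); exact (open_lt 1 _ H).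
Qed.

(** Uniform continuity, along a chain of [n] small steps from the corner. *)
Lemma bounded_on_rectangle (g : R -> R -> R) (b d : R) :
  0 <= b -> 0 <= d ->
  (forall s t, 0 <= s <= b -> 0 <= t <= d -> continuity_2d_pt g s t) ->
  exists B, forall s t, 0 <= s <= b -> 0 <= t <= d -> Rabs (g s t) <= B.
Proof.
intros Hb Hd Hg.
destruct (uniform_continuity_2d g 0 b 0 d Hg (mkposreal 1 Rlt_0_1)) as [delta Hdelta].
destruct (archimed_cor1 (delta / (b + d + 1))) as [n [Hn Hn0]].
{ apply Rdiv_lt_0_compat; [apply cond_pos | lra]. }
assert (Hn' : 0 < INR n) by (apply lt_0_INR; lia).
assert (Hstep : (b + d + 1) / INR n < delta).
{ apply Rmult_lt_reg_r with (/ (b + d + 1)); [apply Rinv_0_lt_compat; lra|].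
  replace ((b + d + 1) / INR n * / (b + d + 1)) with (/ INR n) by (field; lra).
  exact Hn. }
exists (Rabs (g 0 0) + INR n); intros s t Hs Ht.
assert (Hs' : 0 <= s / INR n < delta).
{ split; [apply Rmult_le_pos; [lra | left; now apply Rinv_0_lt_compat]|].
  eapply Rle_lt_trans; [|exact Hstep]; apply Rmult_le_compat_r; [|lra].
  left; now apply Rinv_0_lt_compat. }
assert (Ht' : 0 <= t / INR n < delta).
{ split; [apply Rmult_le_pos; [lra | left; now apply Rinv_0_lt_compat]|].
  eapply Rle_lt_trans; [|exact Hstep]; apply Rmult_le_compat_r; [|lra].
  left; now apply Rinv_0_lt_compat. }
assert (K : forall k, (k <= n)%nat ->
  Rabs (g (INR k * (s / INR n)) (INR k * (t / INR n))) <= Rabs (g 0 0) + INR k).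
{ induction k as [|k IH]; intros Hk.
  - simpl INR; rewrite !Rmult_0_l; lra.
  - specialize (IH ltac:(lia)).
    assert (Hk1 : INR k + 1 <= INR n) by (rewrite <- S_INR; apply le_INR; lia).
    assert (Hk0 : 0 <= INR k) by apply pos_INR.
    assert (Es : INR n * (s / INR n) = s) by (field; lra).
    assert (Et : INR n * (t / INR n) = t) by (field; lra).
    assert (D := Hdelta (INR k * (s / INR n)) (INR k * (t / INR n))
      (INR (S k) * (s / INR n)) (INR (S k) * (t / INR n))).
    rewrite S_INR in *.
    assert (D' : Rabs (g ((INR k + 1) * (s / INR n)) ((INR k + 1) * (t / INR n))
      - g (INR k * (s / INR n)) (INR k * (t / INR n))) < 1).
    { apply D.
      - split; [nra|]; nra.
      - split; [nra|]; nra.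
      - split; [nra|]; nra.
      - split; [nra|]; nra.
      - rewrite Rabs_pos_eq; lra.
      - rewrite Rabs_pos_eq; lra. }
    revert D' IH; unfold Rabs; repeat destruct Rcase_abs; lra. }
specialize (K n (Nat.le_refl n)).
now replace (INR n * (s / INR n)) with s in K by (field; lra);
  replace (INR n * (t / INR n)) with t in K by (field; lra).
Qed.

(** * Regular functions have power series *)

Section Cauchy.

Variables (I : quat) (F fw : R -> R -> quat).
Hypothesis HI : imaginary_unit I.
Hypothesis F_x : forall x y, x ^ 2 + y ^ 2 < 1 ->
  is_derive (fun t => F t y) x (fw x y).
Hypothesis F_y : forall x y, x ^ 2 + y ^ 2 < 1 ->
  is_derive (fun t => F x t) y (I * fw x y)%quat.
Hypothesis fw_cont : forall x y, x ^ 2 + y ^ 2 < 1 ->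
  continuous (fun z : R * R => fw (fst z) (snd z)) (x, y).

(** As [d/dy = I d/dx], the differential of [F] is left multiplication of [fw]
    by the complex velocity of the curve. *)
Lemma chain_rule c (X Y : R -> R) t X' Y' :
  X t ^ 2 + Y t ^ 2 < 1 -> is_derive X t X' -> is_derive Y t Y' ->
  is_derive (fun t => qre (c * F (X t) (Y t))%quat) t
    (qre (c * (slice_pt I X' Y' * fw (X t) (Y t)))%quat).
Proof.
intros Hd HX HY.
assert (D := is_derive_filterdiff (fun x y => qre (c * F x y)%quat) (X t) (Y t)
  (fun x y => qre (c * fw x y)%quat) (qre (c * (I * fw (X t) (Y t)))%quat)).
unfold is_derive.
apply (filterdiff_ext_lin _ (fun y : R =>
  plus (scal (scal y X' : R) (qre (c * fw (X t) (Y t))%quat))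
       (scal (scal y Y' : R) (qre (c * (I * fw (X t) (Y t)))%quat)))).
- apply (filterdiff_comp'_2 (T := R_NormedModule) (U := R_NormedModule)
    (V := R_NormedModule) (W := R_NormedModule) X Y (fun x y => qre (c * F x y)%quat) t
    (fun y => scal y X') (fun y => scal y Y')
    (fun u v => plus (scal u (qre (c * fw (X t) (Y t))%quat))
       (scal v (qre (c * (I * fw (X t) (Y t)))%quat)))); [exact HX | exact HY|].
  apply D.
  + generalize (disc_open _ _ Hd); apply filter_imp; intros [u v] Huv; simpl in *.
    apply (is_derive_functional c (fun t => F t v)); now apply F_x.
  + apply (is_derive_functional c (fun s => F (X t) s)); now apply F_y.
  + apply continuous_qre, continuous_qmult; [apply continuous_qconst | now apply fw_cont].
- intros y.
  change (y * X' * qre (c * fw (X t) (Y t))%quat + y * Y' * qre (c * (I * fw (X t) (Y t)))%quat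
    = y * qre (c * (slice_pt I X' Y' * fw (X t) (Y t)))%quat).
  qcomp; ring.
Qed.

Lemma F_cont x y : x ^ 2 + y ^ 2 < 1 ->
  continuous (fun z : R * R => F (fst z) (snd z)) (x, y).
Proof.
intros Hd.
assert (K : forall c, continuous (fun z : R * R => qre (c * F (fst z) (snd z))%quat) (x, y)).
{ intros c.
  apply (filterdiff_continuous (K := R_AbsRing)
    (U := prod_NormedModule R_AbsRing R_NormedModule R_NormedModule) (V := R_NormedModule)).
  eexists.
  apply (is_derive_filterdiff (fun x y => qre (c * F x y)%quat) x y
    (fun x y => qre (c * fw x y)%quat) (qre (c * (I * fw x y))%quat)).
  + generalize (disc_open _ _ Hd); apply filter_imp; intros [u v] Huv; simpl in *.
    apply (is_derive_functional c (fun t => F t v)); now apply F_x.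
  + apply (is_derive_functional c (fun s => F x s)); now apply F_y.
  + apply continuous_qre, continuous_qmult; [apply continuous_qconst | now apply fw_cont]. }
rewrite continuous_components; repeat split.
- eapply continuous_ext; [|apply (K (Quat 1 0 0 0))]; intros z; simpl; qcomp; ring.
- eapply continuous_ext; [|apply (K (Quat 0 (-1) 0 0))]; intros z; simpl; qcomp; ring.
- eapply continuous_ext; [|apply (K (Quat 0 0 (-1) 0))]; intros z; simpl; qcomp; ring.
- eapply continuous_ext; [|apply (K (Quat 0 0 0 (-1)))]; intros z; simpl; qcomp; ring.
Qed.

End Cauchy.

(** * Integrals over the circle *)

Definition circle_int (A : R -> quat) : quat :=
  Quat (RInt (fun t => qre (A t)) 0 (2 * PI)) (RInt (fun t => qim_i (A t)) 0 (2 * PI))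
       (RInt (fun t => qim_j (A t)) 0 (2 * PI)) (RInt (fun t => qim_k (A t)) 0 (2 * PI)).

Lemma is_RInt_circle_int c (A : R -> quat) : (forall t, continuous A t) ->
  is_RInt (fun t => qre (c * A t)%quat) 0 (2 * PI) (qre (c * circle_int A)%quat).
Proof.
intros HA.
assert (K : forall g : quat -> R, (forall t, continuous (fun s => g (A s)) t) ->
  is_RInt (fun t => g (A t)) 0 (2 * PI) (RInt (fun t => g (A t)) 0 (2 * PI))).
{ intros g Hg; apply (RInt_correct (V := R_CompleteNormedModule)), ex_RInt_continuous; intros; apply Hg. }
assert (K0 := K qre (fun t => proj1 (proj1 (continuous_components A t) (HA t)))).
assert (K1 := K qim_i (fun t => proj1 (proj2 (proj1 (continuous_components A t) (HA t))))).
assert (K2 := K qim_j (fun t => proj1 (proj2 (proj2 (proj1 (continuous_components A t) (HA t)))))).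
assert (K3 := K qim_k (fun t => proj2 (proj2 (proj2 (proj1 (continuous_components A t) (HA t)))))).
apply (is_RInt_scal _ _ _ (qre c)) in K0.
apply (is_RInt_scal _ _ _ (- qim_i c)) in K1.
apply (is_RInt_scal _ _ _ (- qim_j c)) in K2.
apply (is_RInt_scal _ _ _ (- qim_k c)) in K3.
assert (S := is_RInt_plus _ _ _ _ _ _ (is_RInt_plus _ _ _ _ _ _ (is_RInt_plus _ _ _ _ _ _ K0 K1) K2) K3).
replace (qre (c * circle_int A)%quat) with
  (qre c * RInt (fun t => qre (A t)) 0 (2 * PI) + - qim_i c * RInt (fun t => qim_i (A t)) 0 (2 * PI)
   + - qim_j c * RInt (fun t => qim_j (A t)) 0 (2 * PI)
   + - qim_k c * RInt (fun t => qim_k (A t)) 0 (2 * PI)) by (unfold circle_int; qcomp; ring).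
eapply is_RInt_ext; [|exact S]; intros t _.
change (qre c * qre (A t) + - qim_i c * qim_i (A t) + - qim_j c * qim_j (A t)
  + - qim_k c * qim_k (A t) = qre (c * A t)%quat).
qcomp; ring.
Qed.

Lemma is_RInt_harmonic al be m :
  is_RInt (fun t => al * cos (INR (S m) * t) + be * sin (INR (S m) * t)) 0 (2 * PI) 0.
Proof.
assert (Hm : INR (S m) <> 0) by (apply not_0_INR; lia).
set (k := INR (S m)) in *.
replace 0 with (minus (/ k * (al * sin (k * (2 * PI)) - be * cos (k * (2 * PI))))
  (/ k * (al * sin (k * 0) - be * cos (k * 0)))) at 2.
- apply (is_RInt_derive (V := R_CompleteNormedModule)
    (fun t => / k * (al * sin (k * t) - be * cos (k * t)))
    (fun t => al * cos (k * t) + be * sin (k * t))).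
  + intros t _; auto_derive; [easy|]; field; exact Hm.
  + intros t _; apply (ex_derive_continuous (V := R_NormedModule)).
    auto_derive; easy.
- replace (k * (2 * PI)) with (0 + 2 * INR (S m) * PI) by (unfold k; ring).
  rewrite sin_period, cos_period, Rmult_0_r.
  change (/ k * (al * sin 0 - be * cos 0) + - (/ k * (al * sin 0 - be * cos 0)) = 0); ring.
Qed.

Lemma geometric_sum (T : quat) N :
  (sum_n (fun m => T ^ m) N * (1 - T) = 1 - T ^ S N)%quat.
Proof.
induction N as [|N IH].
- rewrite sum_O; change (1 * (1 - T) = 1 - T * 1)%quat; rewrite qmult_one_r; apply qmult_one_l.
- rewrite sum_Sn.
  change ((sum_n (fun m => T ^ m) N + T ^ S N) * (1 - T) = 1 - T ^ S (S N))%quat.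
  replace (T ^ S (S N))%quat with (T ^ S N * T)%quat
    by (rewrite <- (Nat.add_1_r (S N)), pow_n_plus; f_equal; symmetry; apply qmult_one_r).
  replace ((sum_n (fun m => T ^ m) N + T ^ S N) * (1 - T))%quat
    with (sum_n (fun m => T ^ m) N * (1 - T) + (T ^ S N - T ^ S N * T))%quat by qring.
  rewrite IH; qring.
Qed.

Lemma pow_mult_comm (p q : quat) m : (p * q = q * p)%quat ->
  ((p * q) ^ m = p ^ m * q ^ m)%quat.
Proof.
intros H; induction m as [|m IH]; [symmetry; apply qmult_one_l|].
assert (C : (q * p ^ m = p ^ m * q)%quat).
{ clear IH; induction m as [|m IH]; [now rewrite qmult_one_l, qmult_one_r|].
  change (q * (p * p ^ m) = p * p ^ m * q)%quat.
  now rewrite qmult_assoc, <- H, <- !qmult_assoc, IH. }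
change (p * q * (p * q) ^ m = p * p ^ m * (q * q ^ m))%quat.
rewrite IH, <- !qmult_assoc; f_equal; now rewrite !qmult_assoc, C.
Qed.

Lemma qre_distr (c p q w : quat) :
  qre (c * (p * w))%quat + qre (c * (q * w))%quat = qre (c * ((p + q) * w))%quat.
Proof. qcomp; ring. Qed.

Lemma qre_distr_minus (c p q : quat) :
  qre (c * p)%quat - qre (c * q)%quat = qre (c * (p - q))%quat.
Proof. qcomp; ring. Qed.

Lemma qmult_scal_l t (p q : quat) : (scal t p * q)%quat = scal t (p * q)%quat.
Proof. qring. Qed.

Lemma qmult_scal_r t (p q : quat) : (p * scal t q)%quat = scal t (p * q)%quat.
Proof. qring. Qed.

Lemma qmult_scal_cancel t (p q : quat) : t <> 0 ->
  (scal (/ t) p * scal t q)%quat = (p * q)%quat.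
Proof. intros Ht; apply quat_ext; qcomp; field; exact Ht. Qed.

(** * Cauchy's formula on a slice *)

(** The circle of radius [r] is contracted to the point [z] by the paths
    [s |-> z + s (r e(t) - z)]. Weighting [F] along the path by the kernel
    [K N t], a partial geometric sum, the integral over the circle is [2 PI F z]
    at [s = 0] and [2 PI] times a partial sum of the power series at [s = 1].
    Its derivative in [s] only sees the remainder [T t ^ S N] of the geometric
    sum, which tends to 0 uniformly. The finite kernel spares the exchange of
    series and integrals. *)
Section CauchyFormula.

Variables (I : quat) (F fw : R -> R -> quat).
Hypothesis HI : imaginary_unit I.
Hypothesis F_x : forall x y, x ^ 2 + y ^ 2 < 1 ->
  is_derive (fun t => F t y) x (fw x y).
Hypothesis F_y : forall x y, x ^ 2 + y ^ 2 < 1 ->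
  is_derive (fun t => F x t) y (I * fw x y)%quat.
Hypothesis fw_cont : forall x y, x ^ 2 + y ^ 2 < 1 ->
  continuous (fun z : R * R => fw (fst z) (snd z)) (x, y).

Variables (r x y : R).
Hypotheses (r_pos : 0 < r) (r_lt1 : r < 1) (z_lt_r : x ^ 2 + y ^ 2 < r ^ 2).

Let z := slice_pt I x y.
Let X s t := x + s * (r * cos t - x).
Let Y s t := y + s * (r * sin t - y).
Let T t := slice_pt I ((x * cos t + y * sin t) / r) ((y * cos t - x * sin t) / r).
Let K N t := sum_n (fun m => T t ^ m)%quat N.

Lemma norm_circle t : norm (slice_pt I (r * cos t) (r * sin t)) = r.
Proof.
rewrite norm_normsq, normsq_slice_pt by exact HI.
rewrite circle_sq, sqrt_pow2; lra.
Qed.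

Lemma norm_z_lt : norm z < r.
Proof.
apply Rsqr_incrst_0; [|apply qnorm_ge0 | lra].
rewrite !Rsqr_pow2, norm_sq; unfold z; now rewrite normsq_slice_pt.
Qed.

(** The margin beyond [0 <= s <= 1] allows differentiation at the end points. *)
Lemma path_in_disc s t : - (1 - r) / 4 < s < 1 + (1 - r) / 4 ->
  X s t ^ 2 + Y s t ^ 2 < 1.
Proof.
intros Hs; rewrite <- (normsq_slice_pt I) by exact HI; apply normsq_lt1.
unfold unit_ball.
replace (slice_pt I (X s t) (Y s t))
  with (scal (1 - s)%R z + scal s (slice_pt I (r * cos t) (r * sin t)))%quat
  by (unfold X, Y, z; qring).
eapply Rle_lt_trans; [apply norm_plus|].
rewrite !norm_scalq, norm_circle.
assert (Hz := norm_z_lt); assert (Hz0 := qnorm_ge0 z).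
assert (Rabs (1 - s) * norm z <= Rabs (1 - s) * r)
  by (apply Rmult_le_compat_l; [apply Rabs_pos | lra]).
assert (Rabs (1 - s) + Rabs s < 1 + (1 - r) / 2)
  by (unfold Rabs; repeat destruct Rcase_abs; lra).
nra.
Qed.

Lemma T_e t : (T t * slice_pt I (r * cos t) (r * sin t) = z)%quat.
Proof.
unfold T, z; rewrite slice_pt_mult by exact HI.
assert (E : cos t * cos t + sin t * sin t = 1) by (generalize (sin2_cos2 t); unfold Rsqr; lra).
f_equal.
- transitivity (x * (cos t * cos t + sin t * sin t)); [field; lra | rewrite E; ring].
- transitivity (y * (cos t * cos t + sin t * sin t)); [field; lra | rewrite E; ring].
Qed.

(** [K N] truncates the Cauchy kernel [(1 - z / (r e))^-1]. *)
Lemma K_kernel N t :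
  (K N t * slice_pt I (r * cos t - x) (r * sin t - y) =
   (1 - T t ^ S N) * slice_pt I (r * cos t) (r * sin t))%quat.
Proof.
replace (slice_pt I (r * cos t - x) (r * sin t - y))
  with ((1 - T t) * slice_pt I (r * cos t) (r * sin t))%quat.
- now rewrite qmult_assoc; unfold K; rewrite geometric_sum.
- transitivity (slice_pt I (r * cos t) (r * sin t) - z)%quat.
  + rewrite <- (T_e t); qring.
  + unfold z; qring.
Qed.

Lemma T_pow t m :
  (T t ^ m = z ^ m * scal (/ r ^ m) (slice_pt I (cos (INR m * t)) (- sin (INR m * t))))%quat.
Proof.
replace (T t) with (z * slice_pt I (cos t / r) (- sin t / r))%quat.
- unfold z; rewrite pow_mult_comm by now apply slice_pt_comm.
  f_equal.
  induction m as [|m IH].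
  + simpl INR; rewrite Rmult_0_l, cos_0, sin_0.
    change (1 = scal (/ 1) (slice_pt I 1 (- 0)))%quat.
    rewrite Rinv_1; apply quat_ext; qcomp; ring.
  + change (slice_pt I (cos t / r) (- sin t / r) * slice_pt I (cos t / r) (- sin t / r) ^ m =
      scal (/ r ^ S m) (slice_pt I (cos (INR (S m) * t)) (- sin (INR (S m) * t))))%quat.
    rewrite IH, S_INR.
    replace ((INR m + 1) * t) with (INR m * t + t) by ring.
    rewrite cos_plus, sin_plus; simpl pow.
    assert (Hr : r ^ m <> 0) by (apply pow_nonzero; lra).
    transitivity (scal (/ (r * r ^ m)) (slice_pt I (cos t) (- sin t)
      * slice_pt I (cos (INR m * t)) (- sin (INR m * t))))%quat.
    * apply quat_ext; qcomp; field; split; lra.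
    * rewrite slice_pt_mult by exact HI; do 2 f_equal; ring.
- unfold z, T; rewrite slice_pt_mult by exact HI; f_equal; field; lra.
Qed.

Lemma T_cont t : continuous T t.
Proof.
unfold T; apply continuous_slice_pt; apply (ex_derive_continuous (V := R_NormedModule));
  auto_derive; lra.
Qed.

Lemma K_cont N t : continuous (K N) t.
Proof.
unfold K; induction N as [|N IH].
- apply (continuous_ext (fun s => T s ^ 0)%quat); [intros s; symmetry; apply (sum_O (G := quat_AbelianMonoid))|].
  apply continuous_qpow, T_cont.
- apply (continuous_ext (fun s => sum_n (fun m => T s ^ m) N + T s ^ S N)%quat);
    [intros s; symmetry; apply (sum_Sn (G := quat_AbelianMonoid))|].
  apply continuous_qplus; [exact IH | apply continuous_qpow, T_cont].
Qed.

Lemma X_cont u : continuous (fun p : R * R => X (fst p) (snd p)) u.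
Proof.
unfold X; rcont.
Qed.

Lemma Y_cont u : continuous (fun p : R * R => Y (fst p) (snd p)) u.
Proof.
unfold Y; rcont.
Qed.

Lemma along_path_cont (H : R -> R -> quat) s t :
  - (1 - r) / 4 < s < 1 + (1 - r) / 4 ->
  (forall u v, u ^ 2 + v ^ 2 < 1 -> continuous (fun p : R * R => H (fst p) (snd p)) (u, v)) ->
  continuous (fun p : R * R => H (X (fst p) (snd p)) (Y (fst p) (snd p))) (s, t).
Proof.
intros Hs HH.
apply (continuous_comp_2 (fun p : R * R => X (fst p) (snd p))
  (fun p : R * R => Y (fst p) (snd p)) H); [apply X_cont | apply Y_cont|].
apply HH; now apply path_in_disc.
Qed.

Lemma slice_r_cont t : continuous (fun t => slice_pt I (r * cos t) (r * sin t)) t.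
Proof.
apply continuous_slice_pt; apply (ex_derive_continuous (V := R_NormedModule));
  auto_derive; easy.
Qed.

Let dG N s t := (((1 - T t ^ S N) * slice_pt I (r * cos t) (r * sin t))
                  * fw (X s t) (Y s t))%quat.

Lemma dG_cont c N s t : - (1 - r) / 4 < s < 1 + (1 - r) / 4 ->
  continuous (fun p : R * R => qre (c * dG N (fst p) (snd p))%quat) (s, t).
Proof.
intros Hs; unfold dG.
apply continuous_qre, continuous_qmult; [apply continuous_qconst|].
apply continuous_qmult; [|now apply along_path_cont].
apply (continuous_comp snd (fun t => (1 - T t ^ S N) * slice_pt I (r * cos t) (r * sin t))%quat);
  [apply continuous_snd|]; change (snd (s, t)) with t.
apply continuous_qmult; [|apply slice_r_cont].
apply continuous_qminus; [apply continuous_qconst | apply continuous_qpow, T_cont].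
Qed.

Lemma snd_cont (A : R * R -> R) s t : continuous A (s, t) -> continuous (fun v => A (s, v)) t.
Proof.
intros HA.
apply (continuous_comp_2 (fun _ => s) (fun v => v) (fun a b => A (a, b)));
  [apply continuous_const | apply continuous_id|].
eapply continuous_ext; [|exact HA]; now intros [a b].
Qed.

Lemma G_derive_s c N s t : - (1 - r) / 4 < s < 1 + (1 - r) / 4 ->
  is_derive (fun s => qre (c * (K N t * F (X s t) (Y s t)))%quat) s (qre (c * dG N s t)%quat).
Proof.
intros Hs.
replace (qre (c * dG N s t)%quat) with
  (qre (c * K N t * (slice_pt I (r * cos t - x) (r * sin t - y) * fw (X s t) (Y s t)))%quat).
- eapply is_derive_ext;
    [|apply (chain_rule I F fw F_x F_y fw_cont (c * K N t)%quat (fun s => X s t) (fun s => Y s t))].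
  + intros u; cbv beta; now rewrite qmult_assoc.
  + now apply path_in_disc.
  + unfold X; auto_derive; [easy|ring].
  + unfold Y; auto_derive; [easy|ring].
- unfold dG; rewrite <- K_kernel; f_equal; now rewrite <- !qmult_assoc.
Qed.

Lemma G_cont c N s t : - (1 - r) / 4 < s < 1 + (1 - r) / 4 ->
  continuous (fun t => qre (c * (K N t * F (X s t) (Y s t)))%quat) t.
Proof.
intros Hs.
apply (snd_cont (fun p => qre (c * (K N (snd p) * F (X (fst p) (snd p)) (Y (fst p) (snd p))))%quat)).
apply continuous_qre, continuous_qmult; [apply continuous_qconst|].
apply continuous_qmult.
- apply (continuous_comp snd (K N)); [apply continuous_snd | apply K_cont].
- apply along_path_cont; [exact Hs|]; intros u v Huv; now apply (F_cont I F fw).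
Qed.

Lemma near_param s : 0 <= s <= 1 ->
  locally s (fun u => - (1 - r) / 4 < u < 1 + (1 - r) / 4).
Proof.
intros Hs; exists (mkposreal ((1 - r) / 4) ltac:(lra)); intros u Hu.
change (Rabs (u - s) < (1 - r) / 4) in Hu.
apply Rabs_def2 in Hu; lra.
Qed.

Lemma G_derive c N s : 0 <= s <= 1 ->
  is_derive (fun s => RInt (fun t => qre (c * (K N t * F (X s t) (Y s t)))%quat) 0 (2 * PI)) s
    (RInt (fun t => qre (c * dG N s t)%quat) 0 (2 * PI)).
Proof.
intros Hs.
assert (Hs0 : - (1 - r) / 4 < s < 1 + (1 - r) / 4) by lra.
replace (RInt (fun t => qre (c * dG N s t)%quat) 0 (2 * PI)) with
  (RInt (fun t => Derive (fun u => qre (c * (K N t * F (X u t) (Y u t)))%quat) s) 0 (2 * PI)).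
- apply (is_derive_RInt_param (fun s t => qre (c * (K N t * F (X s t) (Y s t)))%quat)).
  + generalize (near_param s Hs); apply filter_imp; intros u Hu t _.
    eexists; now apply G_derive_s.
  + intros t _.
    apply (continuity_2d_pt_ext_loc (fun u v => qre (c * dG N u v)%quat)).
    * apply locally_2d_locally.
      assert (L : locally (s, t) (fun p : R * R => - (1 - r) / 4 < fst p < 1 + (1 - r) / 4)).
      { assert (C : continuous (fun p : R * R => fst p) (s, t)) by apply continuous_fst.
        apply (C (fun u => - (1 - r) / 4 < u < 1 + (1 - r) / 4)); now apply near_param. }
      revert L; apply filter_imp; intros [u v] Hu; simpl in *.
      symmetry; apply is_derive_unique; now apply G_derive_s.
    * apply continuity_2d_pt_filterlim; now apply dG_cont.
  + generalize (near_param s Hs); apply filter_imp; intros u Hu.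
    apply (ex_RInt_continuous (V := R_CompleteNormedModule)); intros t _; now apply G_cont.
- apply RInt_ext; intros t _; apply is_derive_unique; now apply G_derive_s.
Qed.

(** With the exact Cauchy kernel the derivative along the homotopy would vanish:
    its integrand is [1 / s] times the derivative of [- I F] in the angle [t],
    and [F] is periodic in [t]. *)
Lemma main_part_zero c s : 0 < s <= 1 ->
  is_RInt (fun t => qre (c * (slice_pt I (r * cos t) (r * sin t) * fw (X s t) (Y s t)))%quat)
    0 (2 * PI) 0.
Proof.
intros Hs.
assert (Hs0 : - (1 - r) / 4 < s < 1 + (1 - r) / 4) by lra.
set (P t := qre (scal (/ s) (c * - I)%quat * F (X s t) (Y s t))%quat).
replace 0 with (minus (P (2 * PI)) (P 0)) at 2.
- apply (is_RInt_derive (V := R_CompleteNormedModule) P).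
  + intros t _; unfold P.
    replace (qre (c * (slice_pt I (r * cos t) (r * sin t) * fw (X s t) (Y s t)))%quat)
      with (qre (scal (/ s) (c * - I) * (slice_pt I (s * (r * - sin t)) (s * (r * cos t))
               * fw (X s t) (Y s t)))%quat).
    * apply (chain_rule I F fw F_x F_y fw_cont _ (fun t => X s t) (fun t => Y s t)).
      -- now apply path_in_disc.
      -- unfold X; auto_derive; [easy|ring].
      -- unfold Y; auto_derive; [easy|ring].
    * transitivity (qre (c * (slice_pt I 0 (-1) * slice_pt I (r * - sin t) (r * cos t)
        * fw (X s t) (Y s t)))%quat).
      -- replace (slice_pt I (s * (r * - sin t)) (s * (r * cos t)))
           with (scal s (slice_pt I (r * - sin t) (r * cos t))) by qring.
         replace (- I)%quat with (slice_pt I 0 (-1)) by qring.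
         rewrite qmult_assoc, qmult_scal_cancel by lra; now rewrite <- !qmult_assoc.
      -- rewrite slice_pt_mult by exact HI; do 4 f_equal; ring.
  + intros t _.
    apply (snd_cont (fun p => qre (c * (slice_pt I (r * cos (snd p)) (r * sin (snd p))
      * fw (X (fst p) (snd p)) (Y (fst p) (snd p))))%quat)).
    apply continuous_qre, continuous_qmult; [apply continuous_qconst|].
    apply continuous_qmult; [|now apply along_path_cont].
    apply (continuous_comp snd (fun t => slice_pt I (r * cos t) (r * sin t)));
      [apply continuous_snd | apply slice_r_cont].
- unfold P, X, Y; rewrite cos_2PI, sin_2PI, cos_0, sin_0.
  apply (minus_eq_zero (G := R_AbelianGroup)).
Qed.

Lemma T_norm t : norm (T t) = norm z / r.
Proof.
assert (N : norm (T t) * r = norm z).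
{ rewrite <- (T_e t), norm_mult; f_equal.
  symmetry; apply norm_circle. }
rewrite <- N; field; lra.
Qed.

Lemma derivative_bounded : exists B, 0 <= B /\ forall s t,
  0 <= s <= 1 -> 0 <= t <= 2 * PI -> norm (fw (X s t) (Y s t)) <= B.
Proof.
destruct (bounded_on_rectangle (fun s t => norm (fw (X s t) (Y s t))) 1 (2 * PI)) as [B HB].
- lra.
- generalize PI_RGT_0; lra.
- intros s t Hs Ht; apply continuity_2d_pt_filterlim.
  assert (C : continuous (fun p : R * R => fw (X (fst p) (snd p)) (Y (fst p) (snd p))) (s, t))
    by (apply along_path_cont; [lra | exact fw_cont]).
  exact (continuous_comp (fun p : R * R => fw (X (fst p) (snd p)) (Y (fst p) (snd p)))
    (@norm R_AbsRing quat_NormedModule) (s, t) C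
    (filterlim_norm (V := quat_NormedModule) _)).
- assert (HB' : forall s t, 0 <= s <= 1 -> 0 <= t <= 2 * PI -> norm (fw (X s t) (Y s t)) <= B).
  { intros s t Hs Ht; eapply Rle_trans; [apply Rle_abs | now apply HB]. }
  exists B; split; [|exact HB'].
  eapply Rle_trans; [apply qnorm_ge0|]; apply (HB' 0 0); generalize PI_RGT_0; lra.
Qed.

Lemma dG_integral_bound B c N s : 0 < s <= 1 ->
  (forall t, 0 <= t <= 2 * PI -> norm (fw (X s t) (Y s t)) <= B) ->
  Rabs (RInt (fun t => qre (c * dG N s t)%quat) 0 (2 * PI))
  <= 2 * PI * (norm c * (r * B * (norm z / r) ^ S N)).
Proof.
intros Hs HB.
set (A t := qre (c * (T t ^ S N * (slice_pt I (r * cos t) (r * sin t) * fw (X s t) (Y s t))))%quat).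
assert (Hs0 : - (1 - r) / 4 < s < 1 + (1 - r) / 4) by lra.
assert (EA : is_RInt A 0 (2 * PI) (RInt A 0 (2 * PI))).
{ apply (RInt_correct (V := R_CompleteNormedModule)), (ex_RInt_continuous (V := R_CompleteNormedModule)); intros t _.
  apply (snd_cont (fun p => qre (c * (T (snd p) ^ S N * (slice_pt I (r * cos (snd p)) (r * sin (snd p))
      * fw (X (fst p) (snd p)) (Y (fst p) (snd p)))))%quat)).
  apply continuous_qre, continuous_qmult; [apply continuous_qconst|].
  apply continuous_qmult.
  - apply (continuous_comp snd (fun t => T t ^ S N)%quat);
      [apply continuous_snd | apply continuous_qpow, T_cont].
  - apply continuous_qmult; [|now apply along_path_cont].
    apply (continuous_comp snd (fun t => slice_pt I (r * cos t) (r * sin t)));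
      [apply continuous_snd | apply slice_r_cont]. }
assert (E : RInt (fun t => qre (c * dG N s t)%quat) 0 (2 * PI) = 0 - RInt A 0 (2 * PI)).
{ apply (is_RInt_unique (V := R_CompleteNormedModule)).
  eapply is_RInt_ext;
    [|exact (is_RInt_minus (V := R_NormedModule) _ _ _ _ _ _ (main_part_zero c s Hs) EA)].
  intros t _; unfold A, dG.
  change (qre (c * (slice_pt I (r * cos t) (r * sin t) * fw (X s t) (Y s t)))%quat
    - qre (c * (T t ^ S N * (slice_pt I (r * cos t) (r * sin t) * fw (X s t) (Y s t))))%quat
    = qre (c * ((1 - T t ^ S N) * slice_pt I (r * cos t) (r * sin t) * fw (X s t) (Y s t)))%quat).
  rewrite qre_distr_minus; do 2 f_equal.
  generalize (T t ^ S N)%quat (fw (X s t) (Y s t)) (slice_pt I (r * cos t) (r * sin t)).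
  clear; qring. }
rewrite E, Rminus_0_l, Rabs_Ropp.
replace (2 * PI) with (2 * PI - 0) at 2 by ring.
apply abs_RInt_le_const.
- generalize PI_RGT_0; lra.
- eexists; exact EA.
- intros t Ht; unfold A; eapply Rle_trans; [apply Rabs_qre|].
  rewrite !norm_mult, norm_pow, T_norm, norm_circle.
  apply Rmult_le_compat_l; [apply qnorm_ge0|].
  rewrite (Rmult_comm (r * B)).
  apply Rmult_le_compat_l; [apply pow_le, Rmult_le_pos; [apply qnorm_ge0|]|].
  + left; now apply Rinv_0_lt_compat.
  + apply Rmult_le_compat_l; [lra | now apply HB].
Qed.

Let A m t := scal (/ r ^ m) (slice_pt I (cos (INR m * t)) (- sin (INR m * t))
  * F (r * cos t) (r * sin t))%quat.

Lemma A_cont m t : continuous (A m) t.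
Proof.
assert (C1 : continuous (fun t => slice_pt I (cos (INR m * t)) (- sin (INR m * t))) t).
{ apply continuous_slice_pt; apply (ex_derive_continuous (V := R_NormedModule));
    auto_derive; easy. }
assert (C2 : continuous (fun t => F (r * cos t) (r * sin t)) t).
{ apply (continuous_comp_2 (fun t => r * cos t) (fun t => r * sin t) F).
  - apply (ex_derive_continuous (V := R_NormedModule)); auto_derive; easy.
  - apply (ex_derive_continuous (V := R_NormedModule)); auto_derive; easy.
  - apply (F_cont I F fw F_x F_y fw_cont).
    rewrite circle_sq; nra. }
unfold A; apply (continuous_scal_r (V := quat_NormedModule) (/ r ^ m)).
now apply continuous_qmult.
Qed.

Lemma G_at_1 c N : is_RInt (fun t => qre (c * (K N t * F (X 1 t) (Y 1 t)))%quat) 0 (2 * PI)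
  (2 * PI * qre (c * sum_n (fun m => z ^ m * scal (/ (2 * PI)) (circle_int (A m)))%quat N)%quat).
Proof.
assert (HPI := PI_RGT_0).
assert (S1 : forall m, is_RInt (fun t => qre (c * (T t ^ m * F (r * cos t) (r * sin t)))%quat)
  0 (2 * PI) (2 * PI * qre (c * (z ^ m * scal (/ (2 * PI)) (circle_int (A m))))%quat)).
{ intros m.
  replace (2 * PI * qre (c * (z ^ m * scal (/ (2 * PI)) (circle_int (A m))))%quat)
    with (qre (c * z ^ m * circle_int (A m))%quat).
  - eapply is_RInt_ext; [|apply is_RInt_circle_int; intros t; apply A_cont].
    intros t _; cbv beta; rewrite T_pow; unfold A.
    f_equal.
    now rewrite !qmult_scal_r, !qmult_scal_l, qmult_scal_r, !qmult_assoc.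
  - rewrite <- qre_scal; f_equal; generalize (z ^ m)%quat (circle_int (A m)); intros q q'.
    apply quat_ext; qcomp; field; lra. }
assert (S2 : is_RInt (fun t => qre (c * (K N t * F (r * cos t) (r * sin t)))%quat) 0 (2 * PI)
  (2 * PI * qre (c * sum_n (fun m => z ^ m * scal (/ (2 * PI)) (circle_int (A m)))%quat N)%quat)).
{ induction N as [|N IH].
  - rewrite sum_O; eapply is_RInt_ext; [|apply (S1 O)].
    intros t _; unfold K; now rewrite sum_O.
  - rewrite sum_Sn.
    replace (2 * PI * _) with
     (2 * PI * qre (c * sum_n (fun m => z ^ m * scal (/ (2 * PI)) (circle_int (A m)))%quat N)%quat
      + 2 * PI * qre (c * (z ^ S N * scal (/ (2 * PI)) (circle_int (A (S N)))))%quat).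
    + eapply is_RInt_ext; [|exact (is_RInt_plus (V := R_NormedModule) _ _ _ _ _ _ IH (S1 (S N)))].
      intros t _; unfold K; rewrite sum_Sn.
      change (qre (c * (K N t * F (r * cos t) (r * sin t)))%quat
        + qre (c * (T t ^ S N * F (r * cos t) (r * sin t)))%quat
        = qre (c * ((K N t + T t ^ S N) * F (r * cos t) (r * sin t)))%quat).
      apply qre_distr.
    + rewrite <- Rmult_plus_distr_l, <- qre_plus; do 2 f_equal.
      symmetry; apply qmulDr. }
eapply is_RInt_ext; [|exact S2]; intros t _.
replace (X 1 t) with (r * cos t) by (unfold X; ring).
now replace (Y 1 t) with (r * sin t) by (unfold Y; ring).
Qed.

(** On average over the circle, only the term [m = 0] of the kernel survives. *)
Lemma G_at_0 c N : is_RInt (fun t => qre (c * (K N t * F (X 0 t) (Y 0 t)))%quat) 0 (2 * PI)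
  (2 * PI * qre (c * F x y)%quat).
Proof.
assert (S2 : is_RInt (fun t => qre (c * (K N t * F x y))%quat) 0 (2 * PI)
  (2 * PI * qre (c * F x y)%quat)).
{ induction N as [|N IH].
  - replace (2 * PI * qre (c * F x y)%quat)
      with (scal (2 * PI - 0) (qre (c * F x y)%quat))
      by (rewrite Rminus_0_r; reflexivity).
    eapply is_RInt_ext; [|apply (is_RInt_const (V := R_NormedModule))].
    intros t _; unfold K; rewrite sum_O.
    change (qre (c * F x y)%quat = qre (c * (1 * F x y))%quat); now rewrite qmult_one_l.
  - replace (2 * PI * qre (c * F x y)%quat) with (2 * PI * qre (c * F x y)%quat + 0) by ring.
    set (w := scal (/ r ^ S N) (F x y)).
    eapply is_RInt_ext; [|exact (is_RInt_plus (V := R_NormedModule) _ _ _ _ _ _ IH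
      (is_RInt_harmonic (qre (c * (z ^ S N * w))%quat) (- qre (c * (z ^ S N * (I * w)))%quat) N))].
    intros t _; unfold K; rewrite sum_Sn.
    change (qre (c * (K N t * F x y))%quat + (qre (c * (z ^ S N * w))%quat * cos (INR (S N) * t)
      + - qre (c * (z ^ S N * (I * w)))%quat * sin (INR (S N) * t))
      = qre (c * ((K N t + T t ^ S N) * F x y))%quat).
    replace (qre (c * (z ^ S N * w))%quat * cos (INR (S N) * t)
      + - qre (c * (z ^ S N * (I * w)))%quat * sin (INR (S N) * t))
      with (qre (c * (T t ^ S N * F x y))%quat).
    + apply qre_distr.
    + rewrite T_pow; unfold w.
      generalize (cos (INR (S N) * t)) (sin (INR (S N) * t)) (z ^ S N)%quat (/ r ^ S N).
      intros; qcomp; ring. }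
eapply is_RInt_ext; [|exact S2]; intros t _.
replace (X 0 t) with x by (unfold X; ring).
now replace (Y 0 t) with y by (unfold Y; ring).
Qed.

(** The mean value theorem in [s], applied to the functional given by the
    conjugate of the error itself. *)
Lemma partial_sum_error : exists C, 0 <= C /\ forall N,
  norm (sum_n (fun m => z ^ m * scal (/ (2 * PI)) (circle_int (A m)))%quat N - F x y)%quat
  <= C * (norm z / r) ^ S N.
Proof.
destruct derivative_bounded as (B & HB0 & HB).
exists (r * B); split; [apply Rmult_le_pos; lra|]; intros N.
set (S := sum_n (fun m => z ^ m * scal (/ (2 * PI)) (circle_int (A m)))%quat N).
assert (HPI := PI_RGT_0).
set (d := (S - F x y)%quat); set (c := qconj d).
destruct (MVT_cor2
  (fun s => RInt (fun t => qre (c * (K N t * F (X s t) (Y s t)))%quat) 0 (2 * PI))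
  (fun s => RInt (fun t => qre (c * dG N s t)%quat) 0 (2 * PI)) 0 1 Rlt_0_1) as (s & Es & Hs).
{ intros s Hs; apply is_derive_Reals; now apply G_derive. }
rewrite (is_RInt_unique (V := R_CompleteNormedModule) _ _ _ _ (G_at_1 c N)), (is_RInt_unique (V := R_CompleteNormedModule) _ _ _ _ (G_at_0 c N)) in Es.
assert (Bd := dG_integral_bound B c N s ltac:(lra) ltac:(intros t Ht; apply HB; lra)).
assert (Ed : 2 * PI * norm d ^ 2 = RInt (fun t => qre (c * dG N s t)%quat) 0 (2 * PI)).
{ rewrite Rminus_0_r, Rmult_1_r in Es; rewrite <- Es.
  transitivity (2 * PI * qre (c * d)%quat).
  - unfold c; rewrite qmult_conj_l, norm_sq; now unfold qreal; qcomp.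
  - now rewrite <- Rmult_minus_distr_l, qre_distr_minus. }
rewrite <- Ed in Bd; unfold c in Bd; rewrite norm_conj in Bd.
rewrite Rabs_pos_eq in Bd by (apply Rmult_le_pos; [lra | apply pow2_ge_0]).
apply Rmult_le_reg_l in Bd; [|lra].
destruct (Req_dec (norm d) 0) as [E|E].
- rewrite E; apply Rmult_le_pos; [apply Rmult_le_pos; lra|].
  apply pow_le, Rmult_le_pos; [apply qnorm_ge0 | left; now apply Rinv_0_lt_compat].
- apply Rmult_le_reg_l with (norm d); [generalize (qnorm_ge0 d); lra|].
  simpl pow at 1 in Bd; rewrite Rmult_1_r in Bd; exact Bd.
Qed.

Lemma circle_series :
  is_series (fun m => z ^ m * scal (/ (2 * PI)) (circle_int
    (fun t => scal (/ r ^ m) (slice_pt I (cos (INR m * t)) (- sin (INR m * t))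
       * F (r * cos t) (r * sin t)))))%quat (F x y).
Proof.
change (is_series (fun m => z ^ m * scal (/ (2 * PI)) (circle_int (A m)))%quat (F x y)).
unfold is_series; rewrite (filterlim_quat eventually); intros eps Heps.
destruct partial_sum_error as (C & HC & Herr).
assert (Hq0 : 0 <= norm z / r).
{ apply Rmult_le_pos; [apply qnorm_ge0 | left; now apply Rinv_0_lt_compat]. }
assert (Hq1 : norm z / r < 1).
{ apply Rmult_lt_reg_r with r; [lra|]; replace (norm z / r * r) with (norm z) by (field; lra).
  rewrite Rmult_1_l; exact norm_z_lt. }
destruct (pow_lt_1_zero (norm z / r) ltac:(rewrite Rabs_pos_eq; lra) (eps / (C + 1))) as [N HN].
{ apply Rdiv_lt_0_compat; lra. }
exists N; intros n Hn.
eapply Rle_lt_trans; [exact (Herr n)|].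
specialize (HN (S n) ltac:(lia)); rewrite Rabs_pos_eq in HN by now apply pow_le.
apply (Rmult_lt_compat_l (C + 1)) in HN; [|lra].
replace ((C + 1) * (eps / (C + 1))) with eps in HN by (field; lra).
generalize (pow_le _ (S n) Hq0); nra.
Qed.

End CauchyFormula.

Lemma quat_slice q : exists I x y, imaginary_unit I /\ q = slice_pt I x y.
Proof.
set (v := sqrt (qim_i q ^ 2 + qim_j q ^ 2 + qim_k q ^ 2)).
assert (Hv : v ^ 2 = qim_i q ^ 2 + qim_j q ^ 2 + qim_k q ^ 2) by (apply pow2_sqrt; nra).
destruct (Req_dec v 0) as [E|E].
- exists (Quat 0 1 0 0), (qre q), 0; rewrite E in Hv; split.
  + unfold imaginary_unit; qring.
  + apply quat_ext; qcomp; nra.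
- exists (Quat 0 (qim_i q / v) (qim_j q / v) (qim_k q / v)), (qre q), v; split.
  + unfold imaginary_unit; apply quat_ext; qcomp; try (field; exact E).
    transitivity (- ((qim_i q ^ 2 + qim_j q ^ 2 + qim_k q ^ 2) / v ^ 2));
      [field; exact E | rewrite <- Hv; field; exact E].
  + apply quat_ext; qcomp; field; exact E.
Qed.

Theorem slice_regular_expansion f : slice_regular f -> exists a, is_expansion f a.
Proof.
intros Hf.
set (a I r m := scal (/ (2 * PI)) (circle_int
    (fun t => scal (/ r ^ m) (slice_pt I (cos (INR m * t)) (- sin (INR m * t))
       * f (slice_pt I (r * cos t) (r * sin t)))%quat))).
assert (K : forall I r x y, imaginary_unit I -> 0 < r < 1 -> x ^ 2 + y ^ 2 < r ^ 2 ->
  is_series (fun m => slice_pt I x y ^ m * a I r m)%quat (f (slice_pt I x y))).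
{ intros I r x y HI Hr Hxy.
  destruct (Hf I HI) as (dx & dy & Hd).
  apply (circle_series I (fun x y => f (slice_pt I x y)) dx HI).
  - intros u v Huv; now apply (Hd u v), slice_pt_ball.
  - intros u v Huv; destruct (Hd u v) as (_ & H2 & _ & _ & H5); [now apply slice_pt_ball|].
    replace (I * dx u v)%quat with (dy u v); [exact H2|].
    assert (E : (dx u v = - (I * dy u v))%quat).
    { assert (E0 := f_equal qre H5); assert (E1 := f_equal qim_i H5);
        assert (E2 := f_equal qim_j H5); assert (E3 := f_equal qim_k H5).
      apply quat_ext; qcomp_all; lra. }
    rewrite E; unfold imaginary_unit in HI.
    transitivity (- (I * I * dy u v))%quat; [rewrite HI; qring | qring].
  - intros u v Huv; now apply (Hd u v), slice_pt_ball.
  - lra.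
  - lra.
  - exact Hxy. }
(* Every slice and radius yields the same coefficients: compare on the real axis. *)
set (I0 := Quat 0 1 0 0); assert (HI0 : imaginary_unit I0) by (unfold imaginary_unit, I0; qring).
assert (Real : forall I r x, imaginary_unit I -> 0 < r < 1 -> Rabs x < r ->
  is_series (fun m => qreal x ^ m * a I r m)%quat (f (qreal x))).
{ intros I r x HI Hr Hx.
  replace (qreal x) with (slice_pt I x 0) by qring.
  apply K; [exact HI | exact Hr|].
  rewrite <- (pow2_abs x); generalize (Rabs_pos x); nra. }
exists (a I0 (1 / 2)); intros q Hq.
destruct (quat_slice q) as (I & x & y & HI & ->).
apply slice_pt_ball in Hq; [|exact HI].
set (r := (1 + sqrt (x ^ 2 + y ^ 2)) / 2).
assert (Hz0 : 0 <= x ^ 2 + y ^ 2) by nra.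
assert (Hsq := pow2_sqrt _ Hz0); assert (Hs0 := sqrt_pos (x ^ 2 + y ^ 2)).
assert (Hs1 : sqrt (x ^ 2 + y ^ 2) < 1) by nra.
assert (Hr : 0 < r < 1) by (unfold r; lra).
replace (a I0 (1 / 2)) with (a I r).
- apply K; [exact HI | exact Hr|]; unfold r; nra.
- apply (real_expansion_unique (fun x => f (qreal x)) _ _ (Rmin r (1 / 2))).
  + apply Rmin_pos; lra.
  + intros u Hu; apply Real; [exact HI | exact Hr|].
    eapply Rlt_le_trans; [exact Hu | apply Rmin_l].
  + intros u Hu; apply Real; [exact HI0 | lra|].
    eapply Rlt_le_trans; [exact Hu | apply Rmin_r].
Qed.

(** * Power series are regular *)

Definition deriv (a : nat -> quat) : nat -> quat := fun m => scal (INR (S m)) (a (S m)).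

Lemma linear_times_geometric t : 0 < t < 1 ->
  exists C, 0 < C /\ forall m, INR (S m) * t ^ m <= C.
Proof.
intros Ht.
set (d := / t - 1).
assert (Hd : 0 < d).
{ unfold d; apply Rlt_0_minus; rewrite <- Rinv_1; apply Rinv_lt_contravar; lra. }
exists (1 + / d); split; [generalize (Rinv_0_lt_compat d Hd); lra|]; intros m.
assert (P := poly m d Hd).
replace (1 + d) with (/ t) in P by (unfold d; ring).
assert (Htm : 0 < t ^ m) by (apply pow_lt; lra).
assert (Q : (1 + INR m * d) * t ^ m <= 1).
{ rewrite pow_inv in P.
  apply (Rmult_le_compat_r (t ^ m)) in P; [|lra].
  rewrite Rinv_l in P by lra; exact P. }
assert (E : INR (S m) <= (1 + / d) * (1 + INR m * d)).
{ rewrite S_INR.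
  replace ((1 + / d) * (1 + INR m * d)) with (1 + INR m * d + / d + INR m) by (field; lra).
  assert (0 <= INR m * d) by (apply Rmult_le_pos; [apply pos_INR | lra]).
  generalize (Rinv_0_lt_compat d Hd); lra. }
apply Rle_trans with ((1 + / d) * (1 + INR m * d) * t ^ m).
- apply Rmult_le_compat_r; lra.
- rewrite Rmult_assoc; rewrite <- (Rmult_1_r (1 + / d)) at 2.
  apply Rmult_le_compat_l; [|exact Q]; generalize (Rinv_0_lt_compat d Hd); lra.
Qed.

Lemma tame_deriv a : tame a -> tame (deriv a).
Proof.
intros Ha r Hr.
set (r' := (1 + r) / 2); assert (Hr' : 0 < r' < 1) by (unfold r'; lra).
destruct (Ha r' Hr') as [M HM].
destruct (linear_times_geometric (r / r')) as (C & HC & Hgeo).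
{ split; [apply Rdiv_lt_0_compat; lra|].
  apply Rmult_lt_reg_r with r'; [lra|].
  replace (r / r' * r') with r by (field; lra); unfold r'; lra. }
exists (M / r' * C); intros m; unfold deriv.
rewrite norm_scalq, Rabs_pos_eq by apply pos_INR.
replace (INR (S m) * norm (a (S m)) * r ^ m)
  with (norm (a (S m)) * r' ^ S m / r' * (INR (S m) * (r / r') ^ m)).
- apply Rmult_le_compat; [| |apply Rmult_le_compat_r | apply Hgeo].
  + apply Rmult_le_pos; [|left; apply Rinv_0_lt_compat; lra].
    apply Rmult_le_pos; [apply qnorm_ge0 | apply pow_le; lra].
  + apply Rmult_le_pos; [apply pos_INR | apply pow_le].
    left; apply Rdiv_lt_0_compat; lra.
  + left; apply Rinv_0_lt_compat; lra.
  + apply HM.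
- unfold Rdiv at 2; rewrite Rpow_mult_distr, pow_inv; simpl (r' ^ S m).
  field; split; try apply pow_nonzero; lra.
Qed.

Definition pow_deriv (z : quat) (m : nat) : quat :=
  match m with O => 0%quat | S k => scal (INR (S k)) (z ^ k)%quat end.

(** Taylor's formula with a quadratic remainder for [z ^ m], in the commutative
    algebra generated by [z] and [h]; the factor [rho ^ 2] on the left avoids
    the exponent [m - 2]. *)
Lemma pow_remainder (z h : quat) rho m : (h * z = z * h)%quat -> 0 < rho ->
  norm z <= rho -> norm (z + h)%quat <= rho ->
  rho ^ 2 * norm ((z + h) ^ m - z ^ m - h * pow_deriv z m)%quat
  <= INR m ^ 2 * rho ^ m * norm h ^ 2.
Proof.
intros C Hrho Hz Hzh.
induction m as [|m IH].
- simpl pow_deriv; change ((z + h) ^ 0)%quat with 1%quat; change (z ^ 0)%quat with 1%quat.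
  replace (1 - 1 - h * 0)%quat with 0%quat by qring.
  rewrite norm_zeroq; simpl; lra.
- set (Rm := ((z + h) ^ m - z ^ m - h * pow_deriv z m)%quat) in *.
  assert (E : ((z + h) ^ S m - z ^ S m - h * pow_deriv z (S m) =
    (z + h) * Rm + h * (h * pow_deriv z m))%quat).
  { assert (E1 : (z * (h * pow_deriv z m) = scal (INR m) (h * z ^ m))%quat).
    { destruct m as [|k].
      - simpl; qring.
      - unfold pow_deriv; change (z ^ S k)%quat with (z * z ^ k)%quat.
        rewrite !qmult_assoc, <- C; generalize (INR (S k)); qring. }
    assert (E2 : pow_deriv z (S m) = (scal (INR m) (z ^ m) + z ^ m)%quat).
    { unfold pow_deriv; rewrite S_INR; qring. }
    rewrite E2; unfold Rm.
    change ((z + h) ^ S m)%quat with ((z + h) * (z + h) ^ m)%quat.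
    change (z ^ S m)%quat with (z * z ^ m)%quat.
    transitivity ((z + h) * (z + h) ^ m - z * z ^ m - h * z ^ m
      - scal (INR m) (h * z ^ m))%quat; [generalize (INR m); qring|].
    rewrite <- E1; generalize (pow_deriv z m); qring. }
  rewrite E.
  assert (Hd : rho * norm (pow_deriv z m) <= INR m * rho ^ m).
  { destruct m as [|k]; [simpl; rewrite norm_zeroq; lra|].
    unfold pow_deriv; rewrite norm_scalq, norm_pow, Rabs_pos_eq by apply pos_INR.
    replace (rho ^ S k) with (rho * rho ^ k) by reflexivity.
    replace (rho * (INR (S k) * norm z ^ k)) with (INR (S k) * (rho * norm z ^ k)) by ring.
    apply Rmult_le_compat_l; [apply pos_INR|]; apply Rmult_le_compat_l; [lra|].
    apply pow_incr; split; [apply qnorm_ge0 | exact Hz]. }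
  assert (HR0 := qnorm_ge0 Rm); assert (Hh0 := qnorm_ge0 h).
  assert (Hrm : 0 < rho ^ m) by now apply pow_lt.
  assert (Hm := pos_INR m).
  apply Rle_trans with (rho ^ 2 * (rho * norm Rm + norm h * (norm h * norm (pow_deriv z m)))).
  + apply Rmult_le_compat_l; [nra|].
    eapply Rle_trans; [apply norm_plus|]; rewrite !norm_mult.
    apply Rplus_le_compat_r, Rmult_le_compat_r; lra.
  + rewrite S_INR; simpl (rho ^ S m).
    apply Rle_trans with (rho * (INR m ^ 2 * rho ^ m * norm h ^ 2)
      + rho * (norm h ^ 2 * (INR m * rho ^ m))).
    * replace (rho ^ 2 * (rho * norm Rm + norm h * (norm h * norm (pow_deriv z m))))
        with (rho * (rho ^ 2 * norm Rm) + rho * (norm h ^ 2 * (rho * norm (pow_deriv z m)))) by ring.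
      apply Rplus_le_compat.
      -- apply Rmult_le_compat_l; lra.
      -- apply Rmult_le_compat_l; [lra|]; apply Rmult_le_compat_l; [nra | exact Hd].
    * replace (rho * (INR m ^ 2 * rho ^ m * norm h ^ 2) + rho * (norm h ^ 2 * (INR m * rho ^ m)))
        with ((INR m ^ 2 + INR m) * (rho * rho ^ m * norm h ^ 2)) by ring.
      replace ((INR m + 1) ^ 2 * (rho * rho ^ m) * norm h ^ 2)
        with ((INR m + 1) ^ 2 * (rho * rho ^ m * norm h ^ 2)) by ring.
      apply Rmult_le_compat_r; [|nra].
      apply Rmult_le_pos; [apply Rmult_le_pos; lra | apply pow2_ge_0].
Qed.

Lemma is_series_pow_deriv a z : tame a -> unit_ball z ->
  is_series (fun m => pow_deriv z m * a m)%quat (qPSeries (deriv a) z).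
Proof.
intros Ha Hz.
apply (is_series_decr_1 (V := quat_NormedModule)).
match goal with |- is_series _ ?l => replace l with (qPSeries (deriv a) z) end.
- eapply is_series_ext; [|apply (tame_is_expansion _ (tame_deriv a Ha) z Hz)].
  intros n; cbv beta; unfold deriv, pow_deriv; generalize (INR (S n)); qring.
- change (qPSeries (deriv a) z = (qPSeries (deriv a) z - 0 * a 0%nat))%quat.
  generalize (qPSeries (deriv a) z); qring.
Qed.

(** The remainders of the monomials sum up, because the second derivative of a
    tame series is tame. Differentiability and continuity both follow. *)
Lemma series_remainder a rho : tame a -> 0 < rho < 1 ->
  exists C, 0 <= C /\ forall z h, (h * z = z * h)%quat -> norm z <= rho ->
    norm (z + h)%quat <= rho ->
  norm (qPSeries a (z + h)%quat - qPSeries a z - h * qPSeries (deriv a) z)%quat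
  <= C * norm h ^ 2.
Proof.
intros Ha Hrho.
assert (Tdd : ex_series (fun m => norm (deriv (deriv a) m) * rho ^ m)).
{ apply tame_ex_series; [now apply tame_deriv, tame_deriv | lra]. }
assert (Ex : ex_series (fun m => INR m ^ 2 * rho ^ m * norm (a m))).
{ apply (ex_series_incr_n (V := R_NormedModule) _ 2).
  apply (ex_series_le (V := R_CompleteNormedModule) _
    (fun m => 4 * rho ^ 2 * (norm (deriv (deriv a) m) * rho ^ m))).
  - intros m.
    change (Rabs (INR (S (S m)) ^ 2 * rho ^ (S (S m)) * norm (a (S (S m)))) <=
      4 * rho ^ 2 * (norm (deriv (deriv a) m) * rho ^ m)).
    assert (Hrm : 0 < rho ^ m) by (apply pow_lt; lra).
    assert (Hm := pos_INR m); assert (Ham := qnorm_ge0 (a (S (S m)))).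
    rewrite Rabs_pos_eq.
    + unfold deriv; rewrite !norm_scalq, !Rabs_pos_eq by apply pos_INR.
      rewrite !S_INR.
      replace ((INR m + 1 + 1) ^ 2 * rho ^ S (S m) * norm (a (S (S m))))
        with ((INR m + 2) ^ 2 * (rho ^ 2 * rho ^ m * norm (a (S (S m))))) by (simpl; ring).
      replace (4 * rho ^ 2 * ((INR m + 1) * ((INR m + 1 + 1) * norm (a (S (S m)))) * rho ^ m))
        with (4 * (INR m + 1) * (INR m + 2) * (rho ^ 2 * rho ^ m * norm (a (S (S m))))) by ring.
      apply Rmult_le_compat_r; [|nra].
      apply Rmult_le_pos; [apply Rmult_le_pos; nra | exact Ham].
    + apply Rmult_le_pos; [apply Rmult_le_pos; [apply pow2_ge_0 | apply pow_le; lra] | exact Ham].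
  - now apply (ex_series_scal_l (K := R_AbsRing) (V := R_NormedModule)). }
destruct (sum_n_nonneg_bounded _ (fun m => Rmult_le_pos _ _
  (Rmult_le_pos _ _ (pow2_ge_0 (INR m)) (pow_le rho m (Rlt_le _ _ (proj1 Hrho))))
  (qnorm_ge0 (a m))) Ex) as [B HB].
assert (HB0 : 0 <= B).
{ eapply Rle_trans; [|apply (HB O)]; rewrite sum_O; simpl; lra. }
assert (Hrho2 : 0 < rho ^ 2) by nra.
exists (B / rho ^ 2); split.
{ apply Rmult_le_pos; [exact HB0 | left; now apply Rinv_0_lt_compat]. }
intros z h C Hz Hzh.
assert (Uz : unit_ball z) by (unfold unit_ball; lra).
assert (Uzh : unit_ball (z + h)%quat) by (unfold unit_ball; lra).
assert (S : is_series (fun m => ((z + h) ^ m - z ^ m - h * pow_deriv z m) * a m)%quat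
  (qPSeries a (z + h)%quat - qPSeries a z - h * qPSeries (deriv a) z)%quat).
{ eapply is_series_ext; [|exact (is_series_minus (V := quat_NormedModule) _ _ _ _
    (is_series_minus (V := quat_NormedModule) _ _ _ _
      (tame_is_expansion a Ha _ Uzh) (tame_is_expansion a Ha _ Uz))
    (is_series_qmult_l h _ _ (is_series_pow_deriv a z Ha Uz)))].
  intros m; cbv beta.
  change ((z + h) ^ m * a m - z ^ m * a m - h * (pow_deriv z m * a m)
    = ((z + h) ^ m - z ^ m - h * pow_deriv z m) * a m)%quat.
  generalize (pow_deriv z m); qring. }
apply (is_series_norm_le _ _ _ S); intros n.
eapply Rle_trans; [apply norm_sum_nq|].
apply Rle_trans with (sum_n (fun m => norm h ^ 2 / rho ^ 2 * (INR m ^ 2 * rho ^ m * norm (a m))) n).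
- apply sum_n_le; intros m _; rewrite norm_mult.
  assert (P := pow_remainder z h rho m C (proj1 Hrho) Hz Hzh).
  replace (norm h ^ 2 / rho ^ 2 * (INR m ^ 2 * rho ^ m * norm (a m)))
    with (INR m ^ 2 * rho ^ m * norm h ^ 2 / rho ^ 2 * norm (a m)) by (field; lra).
  apply Rmult_le_compat_r; [apply qnorm_ge0|].
  apply Rmult_le_reg_l with (rho ^ 2); [exact Hrho2|].
  replace (rho ^ 2 * (INR m ^ 2 * rho ^ m * norm h ^ 2 / rho ^ 2))
    with (INR m ^ 2 * rho ^ m * norm h ^ 2) by (field; lra).
  exact P.
- rewrite (sum_n_mult_l (K := R_Ring) (norm h ^ 2 / rho ^ 2)).
  replace (B / rho ^ 2 * norm h ^ 2) with (norm h ^ 2 / rho ^ 2 * B) by (field; lra).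
  apply Rmult_le_compat_l; [|apply HB].
  apply Rmult_le_pos; [apply pow2_ge_0 | left; now apply Rinv_0_lt_compat].
Qed.

(** Both partial derivatives on a slice are instances, with [v] equal to 1 and to
    [I]. *)
Lemma qPSeries_derive a (g : R -> quat) (v : quat) x : tame a ->
  (forall t, g t = g x + scal (t - x)%R v)%quat -> (v * g x = g x * v)%quat ->
  unit_ball (g x) ->
  is_derive (fun t => qPSeries a (g t)) x (v * qPSeries (deriv a) (g x))%quat.
Proof.
intros Ha Hg Hc Hx.
set (rho := (1 + norm (g x)) / 2).
assert (Hn := qnorm_ge0 (g x)); unfold unit_ball in Hx.
assert (Hrho : 0 < rho < 1) by (unfold rho; lra).
destruct (series_remainder a rho Ha Hrho) as (C & HC & Hrem).
assert (Hv := qnorm_ge0 v).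
split; [apply is_linear_scal_l|].
intros x' Hx'.
rewrite <- (is_filter_lim_locally_unique (V := R_NormedModule) x x' Hx'); clear x' Hx'.
intros [eps Heps]; simpl.
set (d := Rmin ((1 - norm (g x)) / 2 / (norm v + 1)) (eps / (C * norm v ^ 2 + 1))).
assert (Hden : 0 <= C * norm v ^ 2) by (apply Rmult_le_pos; [exact HC | apply pow2_ge_0]).
assert (Hd : 0 < d).
{ unfold d; apply Rmin_pos; apply Rdiv_lt_0_compat; lra. }
exists (mkposreal d Hd); intros t Ht.
change (Rabs (t - x) < d) in Ht.
change (norm (qPSeries a (g t) - qPSeries a (g x) - scal (t - x)%R (v * qPSeries (deriv a) (g x)))%quat
  <= eps * Rabs (t - x)).
assert (Habs := Rabs_pos (t - x)).
rewrite (Hg t).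
replace (scal (t - x)%R (v * qPSeries (deriv a) (g x)))%quat
  with (scal (t - x)%R v * qPSeries (deriv a) (g x))%quat
  by (generalize (qPSeries (deriv a) (g x)); generalize (t - x); qring).
eapply Rle_trans; [apply Hrem|].
- transitivity (scal (t - x)%R (v * g x))%quat; [generalize (t - x); qring|].
  rewrite Hc; generalize (t - x); qring.
- unfold rho; lra.
- eapply Rle_trans; [apply norm_plus|]; rewrite norm_scalq.
  assert (H1 : Rabs (t - x) * (norm v + 1) <= (1 - norm (g x)) / 2).
  { apply Rmult_le_reg_r with (/ (norm v + 1)); [apply Rinv_0_lt_compat; lra|].
    rewrite Rmult_assoc, Rinv_r, Rmult_1_r by lra.
    left; eapply Rlt_le_trans; [exact Ht | apply Rmin_l]. }
  unfold rho; nra.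
- rewrite norm_scalq.
  assert (H2 : Rabs (t - x) * (C * norm v ^ 2 + 1) <= eps).
  { apply Rmult_le_reg_r with (/ (C * norm v ^ 2 + 1)); [apply Rinv_0_lt_compat; lra|].
    rewrite Rmult_assoc, Rinv_r, Rmult_1_r by lra.
    left; eapply Rlt_le_trans; [exact Ht | apply Rmin_r]. }
  replace (C * (Rabs (t - x) * norm v) ^ 2)
    with (Rabs (t - x) * (C * norm v ^ 2) * Rabs (t - x)) by ring.
  apply Rmult_le_compat_r; [exact Habs|]; nra.
Qed.

Lemma qPSeries_slice_continuous a I x y : tame a -> imaginary_unit I ->
  unit_ball (slice_pt I x y) ->
  continuous (fun p : R * R => qPSeries a (slice_pt I (fst p) (snd p))) (x, y).
Proof.
intros Ha HI Hz.
assert (Cz : continuous (fun p : R * R => slice_pt I (fst p) (snd p)) (x, y)).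
{ apply continuous_slice_pt; [apply continuous_fst | apply continuous_snd]. }
set (z := slice_pt I x y) in *.
assert (Hn := qnorm_ge0 z); unfold unit_ball in Hz.
set (rho := (1 + norm z) / 2).
assert (Hrho : 0 < rho < 1) by (unfold rho; lra).
destruct (series_remainder a rho Ha Hrho) as (C & HC & Hrem).
unfold continuous in *; rewrite (filterlim_quat (locally (x, y))) in *.
change (fst (x, y)) with x in *; change (snd (x, y)) with y in *; fold z in Cz |- *.
intros eps Heps.
set (M := norm (qPSeries (deriv a) z)).
assert (HM : 0 <= M) by apply qnorm_ge0.
set (d := Rmin (Rmin 1 ((1 - norm z) / 2)) (eps / (M + C + 1))).
assert (Hd : 0 < d).
{ unfold d; repeat apply Rmin_pos; try lra; apply Rdiv_lt_0_compat; lra. }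
generalize (Cz d Hd); apply filter_imp; intros [u v]; simpl (fst _); simpl (snd _); intros Huv.
set (h := (slice_pt I u v - z)%quat).
change (norm h < d) in Huv.
assert (Hh := qnorm_ge0 h).
assert (D1 : norm h < 1) by (eapply Rlt_le_trans; [exact Huv|]; eapply Rle_trans; [apply Rmin_l | apply Rmin_l]).
assert (D2 : norm h < (1 - norm z) / 2)
  by (eapply Rlt_le_trans; [exact Huv|]; eapply Rle_trans; [apply Rmin_l | apply Rmin_r]).
assert (D3 : norm h * (M + C + 1) < eps).
{ apply Rmult_lt_reg_r with (/ (M + C + 1)); [apply Rinv_0_lt_compat; lra|].
  rewrite Rmult_assoc, Rinv_r, Rmult_1_r by lra.
  eapply Rlt_le_trans; [exact Huv | apply Rmin_r]. }
assert (Eh : slice_pt I u v = (z + h)%quat) by (unfold h; qring).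
assert (Hc : (h * z = z * h)%quat).
{ unfold h; transitivity (slice_pt I u v * z - z * z)%quat; [qring|].
  unfold z; rewrite slice_pt_comm by exact HI; qring. }
assert (K := Hrem z h Hc ltac:(unfold rho; lra)
  ltac:(eapply Rle_trans; [apply norm_plus | unfold rho; lra])).
rewrite Eh.
apply Rle_lt_trans with (norm h * M + C * norm h ^ 2).
- replace (qPSeries a (z + h)%quat - qPSeries a z)%quat
    with (h * qPSeries (deriv a) z
     + (qPSeries a (z + h)%quat - qPSeries a z - h * qPSeries (deriv a) z))%quat
    by (generalize (qPSeries a (z + h)%quat) (qPSeries a z) (qPSeries (deriv a) z); clear; qring).
  eapply Rle_trans; [apply norm_plus|]; rewrite norm_mult.
  apply Rplus_le_compat_l; exact K.
- assert (norm h ^ 2 <= norm h) by nra. nra.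
Qed.

Theorem qPSeries_slice_regular a : tame a -> slice_regular (qPSeries a).
Proof.
intros Ha I HI.
exists (fun x y => qPSeries (deriv a) (slice_pt I x y)),
  (fun x y => (I * qPSeries (deriv a) (slice_pt I x y))%quat).
intros x y Hz.
assert (Cd : continuous (fun p : R * R => qPSeries (deriv a) (slice_pt I (fst p) (snd p))) (x, y))
  by (apply qPSeries_slice_continuous; [now apply tame_deriv | exact HI | exact Hz]).
refine (conj _ (conj _ (conj _ (conj _ _)))).
- rewrite <- (qmult_one_l (qPSeries (deriv a) (slice_pt I x y))).
  apply (qPSeries_derive a (fun t => slice_pt I t y) 1%quat x Ha).
  + intros t; qring.
  + now rewrite qmult_one_l, qmult_one_r.
  + exact Hz.
- apply (qPSeries_derive a (fun t => slice_pt I x t) I y Ha).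
  + intros t; qring.
  + qring.
  + exact Hz.
- exact Cd.
- apply continuous_qmult; [apply continuous_qconst | exact Cd].
- generalize (qPSeries (deriv a) (slice_pt I x y)); intros q.
  unfold imaginary_unit in HI.
  transitivity (scal (/ 2) (q + I * I * q))%quat.
  + now rewrite <- qmult_assoc.
  + rewrite HI; qring.
Qed.

(** * Functions bounded by 1 are contractive multipliers *)

Definition sqsum (x : nat -> quat) (N : nat) : R := sum_n (fun n => normsq (x n)) N.

(** Contraction of the left star multiplication by [a] on square-summable
    sequences, stated on truncations: convolution is lower triangular. *)
Definition contractive (a : nat -> quat) : Prop :=
  forall N x, sqsum (conv a x) N <= sqsum x N.

Lemma sqsum_S x N : sqsum x (S N) = sqsum x N + normsq (x (S N)).
Proof. exact (sum_Sn (fun n => normsq (x n)) N). Qed.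

Lemma sqsum_0 x : sqsum x 0 = normsq (x 0%nat).
Proof. exact (sum_O (fun n => normsq (x n))). Qed.

Lemma sqsum_ge0 x N : 0 <= sqsum x N.
Proof.
induction N as [|N IH]; [rewrite sqsum_0 | rewrite sqsum_S; generalize (normsq_ge0 (x (S N)))];
  [apply normsq_ge0 | lra].
Qed.

Lemma sqsum_single_one N : sqsum (single 1%quat) N = 1.
Proof.
induction N as [|N IH].
- rewrite sqsum_0; unfold normsq; simpl single; qcomp; ring.
- rewrite sqsum_S, IH; simpl single; rewrite normsq_zero; ring.
Qed.

Lemma sqsum_mono x N M : (N <= M)%nat -> sqsum x N <= sqsum x M.
Proof.
intros H; induction H as [|M H IH]; [lra|].
rewrite sqsum_S; generalize (normsq_ge0 (x (S M))); lra.
Qed.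

Lemma sqsum_ext_le x y N : (forall n, (n <= N)%nat -> x n = y n) -> sqsum x N = sqsum y N.
Proof. intros H; apply sum_n_ext_loc; intros n Hn; now rewrite H. Qed.

(** * Pointwise bound in the complexified quaternions *)

(** The norm of [A + I B] is largest when [I] points along the imaginary part of
    [A conj(B)], whose length is [w]. *)
Lemma sup_over_sphere (A B : quat) :
  (forall I, imaginary_unit I -> norm (A + I * B)%quat <= 1) ->
  exists w, 0 <= w /\ normsq A + normsq B + 2 * w <= 1 /\
    w ^ 2 = qim_i (qconj B * A)%quat ^ 2 + qim_j (qconj B * A)%quat ^ 2
          + qim_k (qconj B * A)%quat ^ 2.
Proof.
intros H.
set (W := (A * qconj B)%quat).
set (w := sqrt (qim_i W ^ 2 + qim_j W ^ 2 + qim_k W ^ 2)).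
assert (Hw : w ^ 2 = qim_i W ^ 2 + qim_j W ^ 2 + qim_k W ^ 2) by (apply pow2_sqrt; nra).
exists w; split; [apply sqrt_pos|]; split; [|rewrite Hw; unfold W; qcomp; ring].
assert (E : forall I, qre I = 0 -> normsq (A + I * B)%quat =
  normsq A + normsq I * normsq B + 2 * (qim_i I * qim_i W + qim_j I * qim_j W + qim_k I * qim_k W)).
{ intros I HI; unfold normsq, W; qcomp; rewrite HI; ring. }
assert (K : forall b c d, b ^ 2 + c ^ 2 + d ^ 2 = 1 ->
  normsq A + normsq B + 2 * (b * qim_i W + c * qim_j W + d * qim_k W) <= 1).
{ intros b c d Hbcd.
  assert (HI : imaginary_unit (Quat 0 b c d)).
  { unfold imaginary_unit; apply quat_ext; qcomp; try ring.
    rewrite <- Hbcd; ring. }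
  assert (N := normsq_le_norm _ _ (H _ HI)).
  rewrite E in N by reflexivity; unfold normsq at 2 in N.
  autorewrite with quatc in N.
  replace (0 ^ 2 + b ^ 2 + c ^ 2 + d ^ 2) with 1 in N by (rewrite <- Hbcd; ring).
  lra. }
destruct (Req_dec w 0) as [Z|Z].
- specialize (K 1 0 0 ltac:(ring)); rewrite Z in Hw.
  assert (qim_i W = 0) by nra. lra.
- assert (N1 : (qim_i W / w) ^ 2 + (qim_j W / w) ^ 2 + (qim_k W / w) ^ 2 = 1).
  { transitivity ((qim_i W ^ 2 + qim_j W ^ 2 + qim_k W ^ 2) / w ^ 2); [field; exact Z|].
    rewrite <- Hw; field; exact Z. }
  specialize (K _ _ _ N1).
  replace (qim_i W / w * qim_i W + qim_j W / w * qim_j W + qim_k W / w * qim_k W) with w in K; [exact K|].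
  transitivity ((qim_i W ^ 2 + qim_j W ^ 2 + qim_k W ^ 2) / w); [|field; exact Z].
  rewrite <- Hw; field; exact Z.
Qed.

(** The left-hand side is the squared norm of [(A + i B) (X + i Y)] in the
    complexified quaternions; its cross term is bounded by Cauchy-Schwarz for
    the imaginary parts of [conj(B) A] and [Y conj(X)]. *)
Lemma complexified_bound (A B X Y : quat) :
  (forall I, imaginary_unit I -> norm (A + I * B)%quat <= 1) ->
  normsq (A * X - B * Y)%quat + normsq (A * Y + B * X)%quat <= normsq X + normsq Y.
Proof.
intros H; destruct (sup_over_sphere A B H) as (w & Hw0 & Hw1 & Hw2).
set (C := (qconj B * A)%quat) in *; set (V := (Y * qconj X)%quat).
assert (E : normsq (A * X - B * Y)%quat + normsq (A * Y + B * X)%quat =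
  (normsq A + normsq B) * (normsq X + normsq Y)
  - 4 * (qim_i C * qim_i V + qim_j C * qim_j V + qim_k C * qim_k V)).
{ unfold normsq, C, V; qcomp; ring. }
assert (HV : qim_i V ^ 2 + qim_j V ^ 2 + qim_k V ^ 2 <= ((normsq X + normsq Y) / 2) ^ 2).
{ apply Rle_trans with (normsq V); [unfold normsq; generalize (pow2_ge_0 (qre V)); lra|].
  unfold V; rewrite normsq_mult, normsq_conj.
  generalize (pow2_ge_0 (normsq X - normsq Y)); lra. }
set (S := normsq X + normsq Y) in *.
assert (HS : 0 <= S) by (unfold S; generalize (normsq_ge0 X) (normsq_ge0 Y); lra).
set (d := qim_i C * qim_i V + qim_j C * qim_j V + qim_k C * qim_k V) in *.
assert (CS : d ^ 2 <= (w * (S / 2)) ^ 2).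
{ apply Rle_trans with (w ^ 2 * (qim_i V ^ 2 + qim_j V ^ 2 + qim_k V ^ 2)).
  - rewrite Hw2; unfold d.
    generalize (pow2_ge_0 (qim_i C * qim_j V - qim_j C * qim_i V))
      (pow2_ge_0 (qim_i C * qim_k V - qim_k C * qim_i V))
      (pow2_ge_0 (qim_j C * qim_k V - qim_k C * qim_j V)); nra.
  - rewrite Rpow_mult_distr; apply Rmult_le_compat_l; [apply pow2_ge_0 | exact HV]. }
assert (Hd : - d <= w * (S / 2)).
{ assert (0 <= w * (S / 2)) by (apply Rmult_le_pos; lra). nra. }
rewrite E; nra.
Qed.

(** * Parseval *)

Definition inner (p q : quat) : R := qre (p * qconj q)%quat.

Definition cos_sum (c : nat -> quat) N t : quat :=
  sum_n (fun n => scal (cos (INR n * t)) (c n)) N.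
Definition sin_sum (c : nat -> quat) N t : quat :=
  sum_n (fun n => scal (sin (INR n * t)) (c n)) N.

Lemma cos_sum_S c N t :
  cos_sum c (S N) t = (cos_sum c N t + scal (cos (INR (S N) * t)) (c (S N)))%quat.
Proof. apply (sum_Sn (G := quat_AbelianMonoid)). Qed.

Lemma sin_sum_S c N t :
  sin_sum c (S N) t = (sin_sum c N t + scal (sin (INR (S N) * t)) (c (S N)))%quat.
Proof. apply (sum_Sn (G := quat_AbelianMonoid)). Qed.

Lemma inner_cross (c : nat -> quat) d N t M : (N <= M)%nat ->
  inner (cos_sum c N t) d * cos (INR (S M) * t) + inner (sin_sum c N t) d * sin (INR (S M) * t)
  = sum_n (fun n => inner (c n) d * cos (INR (S (M - n)) * t)) N.
Proof.
assert (K : forall n, (n <= M)%nat -> INR (S (M - n)) * t = INR (S M) * t - INR n * t).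
{ intros n Hn; rewrite !S_INR, minus_INR by exact Hn; ring. }
induction N as [|N IH]; intros HN.
- unfold cos_sum, sin_sum; rewrite !sum_O, K by exact HN; rewrite cos_minus.
  unfold inner; qcomp; ring.
- rewrite sum_Sn, <- IH by lia; rewrite cos_sum_S, sin_sum_S.
  rewrite K by exact HN; rewrite cos_minus.
  match goal with |- _ = plus ?a ?b => change (plus a b) with (a + b) end.
  generalize (cos_sum c N t) (sin_sum c N t); intros p q; unfold inner; qcomp; ring.
Qed.

Lemma is_RInt_sum_zero (g : nat -> R -> R) a b N :
  (forall n, (n <= N)%nat -> is_RInt (g n) a b 0) ->
  is_RInt (fun t => sum_n (fun n => g n t) N) a b 0.
Proof.
induction N as [|N IH]; intros H.
- eapply is_RInt_ext; [|apply (H O); lia]; intros t _; symmetry; apply sum_O.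
- replace 0 with (0 + 0) by ring.
  eapply is_RInt_ext;
    [|exact (is_RInt_plus (V := R_NormedModule) _ _ _ _ _ _ (IH (fun n Hn => H n (le_S _ _ Hn)))
       (H (S N) (Nat.le_refl _)))].
  intros t _; symmetry; apply (sum_Sn (G := R_AbelianMonoid)).
Qed.

(** Induction on the degree: the new cross terms are harmonics of positive
    frequency by [inner_cross]. *)
Lemma parseval (c : nat -> quat) N :
  is_RInt (fun t => normsq (cos_sum c N t) + normsq (sin_sum c N t)) 0 (2 * PI)
    (2 * PI * sqsum c N).
Proof.
assert (Const : forall d : quat, is_RInt (fun _ : R => normsq d) 0 (2 * PI) (2 * PI * normsq d)).
{ intros d; replace (2 * PI * normsq d) with (scal (2 * PI - 0) (normsq d))
    by (rewrite Rminus_0_r; reflexivity).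
  apply (is_RInt_const (V := R_NormedModule)). }
induction N as [|N IH].
- rewrite sqsum_0; eapply is_RInt_ext; [|apply Const].
  intros t _; unfold cos_sum, sin_sum; rewrite !sum_O; simpl INR.
  rewrite Rmult_0_l, cos_0, sin_0, !normsq_scal; as_real; ring.
- rewrite sqsum_S, Rmult_plus_distr_l.
  assert (Z : is_RInt (fun t => sum_n (fun n => 2 * inner (c n) (c (S N)) * cos (INR (S (N - n)) * t)) N)
    0 (2 * PI) 0).
  { apply is_RInt_sum_zero; intros n Hn.
    eapply is_RInt_ext; [|apply (is_RInt_harmonic (2 * inner (c n) (c (S N))) 0 (N - n))].
    intros t _; cbv beta; as_real; ring. }
  replace (2 * PI * sqsum c N + 2 * PI * normsq (c (S N)))
    with (2 * PI * sqsum c N + (2 * PI * normsq (c (S N)) + 0)) by ring.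
  eapply is_RInt_ext; [|exact (is_RInt_plus (V := R_NormedModule) _ _ _ _ _ _ IH
     (is_RInt_plus (V := R_NormedModule) _ _ _ _ _ _ (Const (c (S N))) Z))].
  intros t _; cbv beta; as_real.
  match goal with |- plus ?a (plus ?b ?d) = _ => change (plus a (plus b d)) with (a + (b + d)) end.
  replace (sum_n (fun n => 2 * inner (c n) (c (S N)) * cos (INR (S (N - n)) * t)) N)
    with (2 * sum_n (fun n => inner (c n) (c (S N)) * cos (INR (S (N - n)) * t)) N).
  + rewrite <- inner_cross by apply Nat.le_refl.
    rewrite cos_sum_S, sin_sum_S.
    assert (E := sin2_cos2 (INR (S N) * t)).
    set (co := cos (INR (S N) * t)) in *; set (si := sin (INR (S N) * t)) in *.
    generalize (cos_sum c N t) (sin_sum c N t) (c (S N)); intros p q d.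
    replace (normsq d) with (((si)² + (co)²) * normsq d) by (rewrite E; ring).
    unfold inner, normsq, Rsqr; qcomp; ring.
  + rewrite <- (sum_n_mult_l (K := R_Ring) 2); apply sum_n_ext; intros n.
    symmetry; apply (Rmult_assoc 2).
Qed.

(** * Contractivity *)

Lemma series_tail_bound (u : nat -> quat) (v : nat -> R) (l : quat) (L : R) M :
  is_series u l -> is_series v L -> (forall n, norm (u n) <= v n) ->
  norm (sum_n u M - l)%quat <= L - sum_n v M.
Proof.
intros Hu Hv Huv.
assert (Hv0 : forall n, 0 <= v n) by (intros n; eapply Rle_trans; [apply qnorm_ge0 | apply Huv]).
assert (HvL : forall n, sum_n v n <= L).
{ intros n; apply (is_lim_seq_incr_compare (sum_n v)); [exact Hv|].
  intros m; rewrite sum_Sn; change (sum_n v m <= sum_n v m + v (S m)).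
  generalize (Hv0 (S m)); lra. }
assert (K : forall n, (M <= n)%nat -> norm (sum_n u M - sum_n u n)%quat <= sum_n v n - sum_n v M).
{ intros n Hn; induction Hn as [|n Hn IH].
  - replace (sum_n u M - sum_n u M)%quat with 0%quat by (generalize (sum_n u M); qring).
    rewrite norm_zeroq; lra.
  - rewrite !sum_Sn.
    change (norm (sum_n u M - (sum_n u n + u (S n)))%quat <= sum_n v n + v (S n) - sum_n v M).
    replace (sum_n u M - (sum_n u n + u (S n)))%quat
      with ((sum_n u M - sum_n u n) - u (S n))%quat by qring.
    eapply Rle_trans; [apply norm_minus|]; generalize (Huv (S n)); lra. }
apply Rnot_lt_le; intros Hlt.
unfold is_series in Hu; rewrite (filterlim_quat eventually) in Hu.
set (e := norm (sum_n u M - l)%quat - (L - sum_n v M)).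
destruct (Hu e) as [n Hn]; [unfold e; lra|].
set (m := Nat.max n M).
assert (H1 : norm (sum_n u m - l)%quat < e) by (apply Hn; unfold m; lia).
assert (H2 := K m ltac:(unfold m; lia)); assert (H3 := HvL m).
assert (H4 : norm (sum_n u M - l)%quat <= norm (sum_n u M - sum_n u m)%quat + norm (sum_n u m - l)%quat).
{ replace (sum_n u M - l)%quat with ((sum_n u M - sum_n u m) + (sum_n u m - l))%quat by qring.
  apply norm_plus. }
unfold e in *; lra.
Qed.

Definition truncate (N : nat) (x : nat -> quat) : nat -> quat :=
  fun n => if (n <=? N)%nat then x n else 0%quat.

Lemma truncate_le N x n : (n <= N)%nat -> truncate N x n = x n.
Proof. intros H; unfold truncate; now rewrite (proj2 (Nat.leb_le n N) H). Qed.

Lemma truncate_gt N x n : (N < n)%nat -> truncate N x n = 0%quat.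
Proof. intros H; unfold truncate; now rewrite (proj2 (Nat.leb_gt n N) H). Qed.

Lemma sqsum_truncate N x M : (N <= M)%nat -> sqsum (truncate N x) M = sqsum x N.
Proof.
intros H; induction H as [|M H IH].
- apply sqsum_ext_le; intros n Hn; now apply truncate_le.
- rewrite sqsum_S, IH, truncate_gt, normsq_zero by lia; ring.
Qed.

Lemma tame_truncate N x : tame (truncate N x).
Proof.
intros r Hr.
exists (sum_n (fun n => norm (x n)) N); intros m.
assert (S0 : forall k, 0 <= sum_n (fun n => norm (x n)) k).
{ intros k; induction k as [|k IH]; [rewrite sum_O; apply qnorm_ge0|].
  rewrite sum_Sn; apply Rplus_le_le_0_compat; [exact IH | apply qnorm_ge0]. }
destruct (le_lt_dec m N) as [Hm|Hm].
- rewrite truncate_le by exact Hm.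
  apply Rle_trans with (norm (x m)).
  + rewrite <- (Rmult_1_r (norm (x m))) at 2; apply Rmult_le_compat_l; [apply qnorm_ge0|].
    rewrite <- (pow1 m); apply pow_incr; lra.
  + clear -Hm S0; induction Hm as [|k Hm IH].
    * destruct m as [|m]; [rewrite sum_O; apply Rle_refl|].
      rewrite sum_Sn; generalize (S0 m); change (0 <= sum_n (fun n => norm (x n)) m ->
        norm (x (S m)) <= sum_n (fun n => norm (x n)) m + norm (x (S m))); lra.
    * rewrite sum_Sn; generalize (qnorm_ge0 (x (S k))).
      change (0 <= norm (x (S k)) -> norm (x m) <= sum_n (fun n => norm (x n)) k + norm (x (S k))); lra.
- rewrite truncate_gt by exact Hm; rewrite norm_zeroq, Rmult_0_l; apply S0.
Qed.

Lemma abs_harmonic a r (h : nat -> R) : tame a -> 0 < r < 1 -> (forall m, Rabs (h m) <= 1) ->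
  ex_series (fun m => norm (scal (h m) (scal (r ^ m) (a m)))).
Proof.
intros Ha Hr Hh.
apply (ex_series_le (V := R_CompleteNormedModule) _ (fun m => norm (a m) * r ^ m)).
- intros m.
  change (Rabs (norm (scal (h m) (scal (r ^ m) (a m)))) <= norm (a m) * r ^ m).
  rewrite Rabs_pos_eq by apply qnorm_ge0.
  rewrite !norm_scalq, (Rabs_pos_eq (r ^ m)) by (apply pow_le; lra).
  rewrite (Rmult_comm (norm (a m))); rewrite <- (Rmult_1_l (r ^ m * norm (a m))) at 2.
  apply Rmult_le_compat_r; [|apply Hh].
  apply Rmult_le_pos; [apply pow_le; lra | apply qnorm_ge0].
- apply tame_ex_series; [exact Ha | lra].
Qed.

(** The values at [r e^(I t)] for all imaginary units [I] share their
    cosine and sine parts, on which star multiplication is multiplication of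
    complexified quaternions. *)
Section Circle.
Variables (a x : nat -> quat) (r t : R).
Hypotheses (Ha : tame a) (Hx : tame x) (Hr : 0 < r < 1).

Definition cos_part (c : nat -> quat) : nat -> quat :=
  fun m => scal (cos (INR m * t)) (scal (r ^ m) (c m)).
Definition sin_part (c : nat -> quat) : nat -> quat :=
  fun m => scal (sin (INR m * t)) (scal (r ^ m) (c m)).

Lemma cos_part_abs c : tame c -> ex_series (fun m => norm (cos_part c m)).
Proof.
intros Hc; apply abs_harmonic; [exact Hc | exact Hr|].
intros m; apply Rabs_le, COS_bound.
Qed.

Lemma sin_part_abs c : tame c -> ex_series (fun m => norm (sin_part c m)).
Proof.
intros Hc; apply abs_harmonic; [exact Hc | exact Hr|].
intros m; apply Rabs_le, SIN_bound.
Qed.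

Lemma angle_split m k : (k <= m)%nat -> INR m * t = INR (m - k) * t + INR k * t.
Proof. intros H; rewrite minus_INR by exact H; ring. Qed.

Lemma cos_part_conv : is_series (cos_part (conv a x))
  (qSeries (cos_part a) * qSeries (cos_part x) - qSeries (sin_part a) * qSeries (sin_part x))%quat.
Proof.
eapply is_series_ext; [|exact (is_series_minus (V := quat_NormedModule) _ _ _ _
  (cauchy_product _ _ _ _ (qSeries_correct _ (cos_part_abs a Ha)) (qSeries_correct _ (cos_part_abs x Hx))
     (cos_part_abs a Ha) (cos_part_abs x Hx))
  (cauchy_product _ _ _ _ (qSeries_correct _ (sin_part_abs a Ha)) (qSeries_correct _ (sin_part_abs x Hx))
     (sin_part_abs a Ha) (sin_part_abs x Hx)))].
intros m; cbv beta.
change (sum_n (fun k => cos_part a (m - k) * cos_part x k)%quat m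
  - sum_n (fun k => sin_part a (m - k) * sin_part x k)%quat m = cos_part (conv a x) m)%quat.
transitivity (scal (cos (INR m * t))%R (scal (r ^ m)%R 1) * conv a x m)%quat;
  [|unfold cos_part; generalize (conv a x m); qring].
unfold conv; rewrite <- qsum_mult_l.
rewrite qsum_minus.
apply sum_n_ext_loc; intros k Hk; unfold cos_part, sin_part.
rewrite (angle_split m k Hk), cos_plus.
replace (r ^ m) with (r ^ (m - k) * r ^ k) by (rewrite <- pow_add; f_equal; lia).
qring.
Qed.

Lemma sin_part_conv : is_series (sin_part (conv a x))
  (qSeries (cos_part a) * qSeries (sin_part x) + qSeries (sin_part a) * qSeries (cos_part x))%quat.
Proof.
eapply is_series_ext; [|exact (is_series_qplus _ _ _ _
  (cauchy_product _ _ _ _ (qSeries_correct _ (cos_part_abs a Ha)) (qSeries_correct _ (sin_part_abs x Hx))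
     (cos_part_abs a Ha) (sin_part_abs x Hx))
  (cauchy_product _ _ _ _ (qSeries_correct _ (sin_part_abs a Ha)) (qSeries_correct _ (cos_part_abs x Hx))
     (sin_part_abs a Ha) (cos_part_abs x Hx)))].
intros m; cbv beta.
change (sum_n (fun k => cos_part a (m - k) * sin_part x k)%quat m
  + sum_n (fun k => sin_part a (m - k) * cos_part x k)%quat m = sin_part (conv a x) m)%quat.
transitivity (scal (sin (INR m * t))%R (scal (r ^ m)%R 1) * conv a x m)%quat;
  [|unfold sin_part; generalize (conv a x m); qring].
unfold conv; rewrite <- qsum_mult_l.
rewrite qsum_plus.
apply sum_n_ext_loc; intros k Hk; unfold cos_part, sin_part.
rewrite (angle_split m k Hk), sin_plus.
replace (r ^ m) with (r ^ (m - k) * r ^ k) by (rewrite <- pow_add; f_equal; lia).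
qring.
Qed.

Lemma value_on_circle f I : is_expansion f a -> imaginary_unit I ->
  f (slice_pt I (r * cos t) (r * sin t)) =
  (qSeries (cos_part a) + I * qSeries (sin_part a))%quat.
Proof.
intros Hf HI.
assert (Hq : unit_ball (slice_pt I (r * cos t) (r * sin t))).
{ apply slice_pt_ball; [exact HI|].
  rewrite circle_sq; nra. }
apply (is_series_uniq _ _ _ (Hf _ Hq)).
eapply is_series_ext; [|exact (is_series_qplus _ _ _ _
  (qSeries_correct _ (cos_part_abs a Ha))
  (is_series_qmult_l I _ _ (qSeries_correct _ (sin_part_abs a Ha))))].
intros m; cbv beta.
assert (E : (slice_pt I (r * cos t)%R (r * sin t)%R ^ m =
  scal (r ^ m)%R (slice_pt I (cos (INR m * t))%R (sin (INR m * t))%R))%quat).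
{ rewrite <- slice_pt_unit_pow by exact HI.
  induction m as [|m IH].
  - change (1 = scal 1%R 1)%quat; qring.
  - change (slice_pt I (r * cos t)%R (r * sin t)%R * slice_pt I (r * cos t)%R (r * sin t)%R ^ m =
      scal (r * r ^ m)%R (slice_pt I (cos t) (sin t) * slice_pt I (cos t) (sin t) ^ m))%quat.
    rewrite IH; generalize (r ^ m); qring. }
rewrite E; unfold cos_part, sin_part; generalize (r ^ m); qring.
Qed.

End Circle.

Lemma pow_bernoulli r n : 0 <= r <= 1 -> 1 - INR n * (1 - r) <= r ^ n.
Proof.
intros Hr; induction n as [|n IH]; [simpl; lra|].
rewrite S_INR; simpl pow.
assert (0 <= r ^ n <= 1).
{ split; [apply pow_le; lra|]; rewrite <- (pow1 n); apply pow_incr; lra. }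
assert (Hn := pos_INR n).
assert (r * (1 - INR n * (1 - r)) <= r * r ^ n) by (apply Rmult_le_compat_l; lra).
assert (0 <= INR n * (1 - r) * (1 - r)) by (apply Rmult_le_pos; [apply Rmult_le_pos|]; lra).
nra.
Qed.

Lemma radius_limit (L S : R) n : 0 <= L ->
  (forall r, 0 < r < 1 -> r ^ n * L <= S) -> L <= S.
Proof.
intros HL H; apply Rnot_lt_le; intros Hlt.
assert (Hn := pos_INR n).
set (d := Rmin (1 / 2) ((L - S) / 2 / (INR n * L + 1))).
assert (HnL : 0 <= INR n * L) by now apply Rmult_le_pos.
assert (Hd : 0 < d) by (apply Rmin_pos; [lra | apply Rdiv_lt_0_compat; lra]).
assert (Hd1 : d <= 1 / 2) by apply Rmin_l.
assert (Hd2 : d * (INR n * L + 1) <= (L - S) / 2).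
{ apply Rmult_le_reg_r with (/ (INR n * L + 1)); [apply Rinv_0_lt_compat; lra|].
  rewrite Rmult_assoc, Rinv_r, Rmult_1_r by lra; apply Rmin_r. }
assert (B := pow_bernoulli (1 - d) n ltac:(lra)).
assert (K := H (1 - d) ltac:(lra)).
assert ((1 - INR n * (1 - (1 - d))) * L <= (1 - d) ^ n * L) by (apply Rmult_le_compat_r; lra).
nra.
Qed.

(** It suffices to treat [x] of finite support and to weight the terms by
    [r ^ n] with [r < 1]. Partial sums of the product are then uniformly close
    on the circle to the full product, whose norm is at most that of [x] at each
    point. *)
Theorem bounded_contractive f a : is_expansion f a ->
  (forall q, unit_ball q -> norm (f q) <= 1) -> contractive a.
Proof.
intros Hf Hb N x0.
set (x := truncate N x0).
assert (Ta := expansion_tame f a Hf); assert (Tx : tame x) by apply tame_truncate.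
set (g := conv a x).
assert (Tg : tame g) by now apply tame_conv.
replace (sqsum (conv a x0) N) with (sqsum g N).
2: { apply sqsum_ext_le; intros n Hn; apply conv_ext_le; [easy|].
     intros k Hk; apply truncate_le; lia. }
rewrite <- (sqsum_truncate N x0 N) by lia; fold x.
apply (radius_limit _ _ (2 * N)); [apply sqsum_ge0|]; intros r Hr.
set (gr := fun m => scal (r ^ m) (g m)); set (xr := fun m => scal (r ^ m) (x m)).
assert (Hr1 : forall n, 0 <= r ^ n <= 1).
{ intros n; split; [apply pow_le; lra|]; rewrite <- (pow1 n); apply pow_incr; lra. }
apply Rle_trans with (sqsum gr N).
{ unfold sqsum; rewrite <- (sum_n_mult_l (K := R_Ring) (r ^ (2 * N))).
  apply sum_n_le; intros n Hn.
  change (r ^ (2 * N) * normsq (g n) <= normsq (gr n)); unfold gr; rewrite normsq_scal.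
  apply Rmult_le_compat_r; [apply normsq_ge0|].
  replace (r ^ (2 * N)) with ((r ^ n) ^ 2 * r ^ (2 * (N - n)))
    by (rewrite <- pow_mult, <- pow_add; f_equal; lia).
  rewrite <- (Rmult_1_r ((r ^ n) ^ 2)) at 2; apply Rmult_le_compat_l; [apply pow2_ge_0 | apply Hr1]. }
apply Rle_trans with (sqsum xr N).
2: { apply sum_n_le; intros n Hn; unfold xr; rewrite normsq_scal.
     rewrite <- (Rmult_1_l (normsq (x n))) at 2.
     apply Rmult_le_compat_r; [apply normsq_ge0|].
     generalize (Hr1 n); nra. }
destruct (tame_ex_series g r Tg ltac:(lra)) as [W HW].
assert (HWn : forall n, 0 <= norm (g n) * r ^ n)
  by (intros n; apply Rmult_le_pos; [apply qnorm_ge0 | apply Hr1]).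
assert (HW0 : 0 <= W).
{ assert (K := is_lim_seq_incr_compare (sum_n (fun m => norm (g m) * r ^ m)) W HW
    (fun n => ltac:(rewrite sum_Sn; change (sum_n (fun m => norm (g m) * r ^ m) n
      <= sum_n (fun m => norm (g m) * r ^ m) n + norm (g (S n)) * r ^ S n);
      generalize (HWn (S n)); lra)) O).
  rewrite sum_O in K; eapply Rle_trans; [apply (HWn O) | exact K]. }
(* [e] bounds the tail of the series of [g], uniformly on the circle. *)
assert (Main : forall M e, (N <= M)%nat -> 0 <= e -> W - sum_n (fun m => norm (g m) * r ^ m) M <= e ->
  sqsum gr M <= sqsum xr N + (4 * W * e + 2 * e ^ 2)).
{ intros M e HM He0 He.
  assert (HPI := PI_RGT_0).
  apply Rmult_le_reg_l with (2 * PI); [lra|].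
  assert (I1 := parseval gr M).
  assert (I2 : is_RInt (fun t => normsq (cos_sum xr N t) + normsq (sin_sum xr N t) + (4 * W * e + 2 * e ^ 2))
    0 (2 * PI) (2 * PI * (sqsum xr N + (4 * W * e + 2 * e ^ 2)))).
  { rewrite Rmult_plus_distr_l.
    apply (is_RInt_plus (V := R_NormedModule)); [apply parseval|].
    replace (2 * PI * (4 * W * e + 2 * e ^ 2)) with (scal (2 * PI - 0) (4 * W * e + 2 * e ^ 2))
      by (rewrite Rminus_0_r; reflexivity).
    apply (is_RInt_const (V := R_NormedModule)). }
  refine (is_RInt_le _ _ 0 (2 * PI) _ _ _ I1 I2 _); [lra|]; intros t _.
  assert (Cc := cos_part_conv a x r t Ta Tx Hr); assert (Cs := sin_part_conv a x r t Ta Tx Hr).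
  set (A := qSeries (cos_part r t a)) in *; set (B := qSeries (sin_part r t a)) in *.
  assert (EX : forall (h : nat -> R), qSeries (fun m => scal (h m) (xr m)) =
     sum_n (fun m => scal (h m) (xr m)) N).
  { intros h; apply qSeries_unique; unfold is_series.
    eapply filterlim_ext_loc; [|apply filterlim_const].
    exists N; intros n Hn; induction Hn as [|n Hn IH]; [reflexivity|].
    rewrite sum_Sn, <- IH; unfold xr, x; rewrite truncate_gt by lia.
    symmetry; etransitivity; [|apply qplus_zero_r]; apply f_equal; qring. }
  assert (EXc : qSeries (cos_part r t x) = cos_sum xr N t) by apply EX.
  assert (EXs : qSeries (sin_part r t x) = sin_sum xr N t) by apply EX.
  rewrite EXc, EXs in Cc, Cs.
  set (X := cos_sum xr N t) in *; set (Y := sin_sum xr N t) in *.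
  assert (Sup : forall I, imaginary_unit I -> norm (A + I * B)%quat <= 1).
  { intros I HI.
    assert (V : f (slice_pt I (r * cos t) (r * sin t)) = (A + I * B)%quat)
      by exact (value_on_circle a r t Ta Hr f I Hf HI).
    rewrite <- V; apply Hb, slice_pt_ball; [exact HI|].
    rewrite circle_sq; nra. }
  assert (P := complexified_bound A B X Y Sup).
  assert (Bound : forall (h : nat -> R) (l : quat), (forall m, Rabs (h m) <= 1) ->
    is_series (fun m => scal (h m) (scal (r ^ m) (g m))) l ->
    norm l <= W /\ norm (sum_n (fun m => scal (h m) (gr m)) M - l)%quat <= e).
  { intros h l Hh Hl.
    assert (Hm : forall m, norm (scal (h m) (scal (r ^ m) (g m))) <= norm (g m) * r ^ m).
    { intros m; rewrite !norm_scalq, (Rabs_pos_eq (r ^ m)) by apply Hr1.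
      rewrite (Rmult_comm (norm (g m))); rewrite <- (Rmult_1_l (r ^ m * norm (g m))) at 2.
      apply Rmult_le_compat_r; [|apply Hh].
      apply Rmult_le_pos; [apply Hr1 | apply qnorm_ge0]. }
    split.
    - apply (is_series_norm_le _ _ _ Hl); intros n.
      eapply Rle_trans; [apply norm_sum_nq|].
      eapply Rle_trans; [apply sum_n_le; intros k _; apply Hm|].
      apply (is_lim_seq_incr_compare (sum_n (fun m => norm (g m) * r ^ m))); [exact HW|].
      intros k; rewrite sum_Sn; change (sum_n (fun m => norm (g m) * r ^ m) k
        <= sum_n (fun m => norm (g m) * r ^ m) k + norm (g (S k)) * r ^ S k).
      generalize (HWn (S k)); lra.
    - eapply Rle_trans; [apply (series_tail_bound _ _ _ _ M Hl HW Hm) | exact He]. }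
  destruct (Bound (fun m => cos (INR m * t)) _ (fun m => Rabs_le _ _ (COS_bound _)) Cc) as [B1 B2].
  destruct (Bound (fun m => sin (INR m * t)) _ (fun m => Rabs_le _ _ (SIN_bound _)) Cs) as [B3 B4].
  assert (Sq : forall p l : quat, norm l <= W -> norm (p - l)%quat <= e ->
    normsq p <= normsq l + 2 * W * e + e ^ 2).
  { intros p l Hl Hp.
    assert (Hp' : norm p <= norm l + e).
    { replace p with (l + (p - l))%quat at 1 by qring.
      eapply Rle_trans; [apply norm_plus | lra]. }
    rewrite <- !norm_sq; generalize (qnorm_ge0 p) (qnorm_ge0 l); nra. }
  assert (Q1 := Sq _ _ B1 B2); assert (Q2 := Sq _ _ B3 B4).
  change (sum_n (fun m => scal (cos (INR m * t)) (gr m)) M) with (cos_sum gr M t) in Q1.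
  change (sum_n (fun m => scal (sin (INR m * t)) (gr m)) M) with (sin_sum gr M t) in Q2.
  lra. }
apply Rnot_lt_le; intros Hlt.
set (D := sqsum gr N - sqsum xr N).
assert (HD : 0 < D) by (unfold D; lra).
set (e := Rmin 1 (D / (4 * W + 4))).
assert (He : 0 < e) by (apply Rmin_pos; [lra | apply Rdiv_lt_0_compat; lra]).
assert (He1 : e <= 1) by apply Rmin_l.
assert (He2 : e * (4 * W + 4) <= D).
{ apply Rmult_le_reg_r with (/ (4 * W + 4)); [apply Rinv_0_lt_compat; lra|].
  rewrite Rmult_assoc, Rinv_r, Rmult_1_r by lra; apply Rmin_r. }
unfold is_series in HW; rewrite (filterlim_realq eventually) in HW.
destruct (HW e He) as [M0 HM0].
set (M := Nat.max N M0).
assert (K : Rabs (sum_n (fun m => norm (g m) * r ^ m) M - W) < e)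
  by (apply HM0; unfold M; lia).
apply Rabs_def2 in K.
assert (K2 := Main M e ltac:(unfold M; lia) ltac:(lra) ltac:(lra)).
assert (K3 := sqsum_mono gr N M ltac:(unfold M; lia)).
unfold D in *; nra.
Qed.

(** * Difference quotients *)

Lemma bounded_tame a B : (forall n, norm (a n) <= B) -> tame a.
Proof.
intros H r Hr; exists B; intros m.
rewrite <- (Rmult_1_r B); apply Rmult_le_compat; [apply qnorm_ge0 | apply pow_le; lra | apply H|].
rewrite <- (pow1 m); apply pow_incr; lra.
Qed.

Lemma contractive_coeff a n : contractive a -> norm (a n) <= 1.
Proof.
intros Ha; apply norm_le_normsq; [lra|].
assert (H := Ha n (single 1%quat)).
rewrite sqsum_single_one in H.
assert (K : normsq (a n) <= sqsum (conv a (single 1%quat)) n).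
{ destruct n as [|n].
  - rewrite sqsum_0, conv_single_r, qmult_one_r; lra.
  - rewrite sqsum_S, conv_single_r, qmult_one_r.
    generalize (sqsum_ge0 (conv a (single 1%quat)) n); lra. }
lra.
Qed.

Lemma qPSeries_head c p : tame c -> tame (tail c) -> unit_ball p ->
  qPSeries c p = (c 0%nat + p * qPSeries (tail c) p)%quat.
Proof.
intros Hc Ht Hp; apply qSeries_unique.
apply (is_series_decr_1 (V := quat_NormedModule)).
match goal with |- is_series _ ?lim => replace lim with (p * qPSeries (tail c) p)%quat end.
- eapply is_series_ext; [|exact (is_series_qmult_l p _ _ (tame_is_expansion _ Ht p Hp))].
  intros n; exact (qmult_assoc p (p ^ n)%quat (c (S n))).
- change (p * qPSeries (tail c) p = (c 0%nat + p * qPSeries (tail c) p) - 1 * c 0%nat)%quat.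
  generalize (qPSeries (tail c) p); qring.
Qed.

(** Coefficients of the quotient of [f - f(p)] by [q - p]. *)
Definition quotient_seq (a : nat -> quat) (p : quat) : nat -> quat :=
  fun n => qPSeries (fun j => a (j + S n)%nat) p.

Lemma quotient_seq_spec f a p : is_expansion f a -> contractive a -> unit_ball p ->
  tame (quotient_seq a p) /\
  forall m, conv (affine (- p)%quat 1%quat) (quotient_seq a p) m = (a m - single (f p) m)%quat.
Proof.
intros Hf Ha Hp.
assert (Tk : forall k, tame (fun j => a (j + k)%nat)).
{ intros k; apply (bounded_tame _ 1); intros n; now apply contractive_coeff. }
assert (Head : forall k, qPSeries (fun j => a (j + k)%nat) p = (a k + p * quotient_seq a p k)%quat).
{ intros k; rewrite qPSeries_head; [|apply Tk| |exact Hp].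
  - simpl Nat.add; do 2 f_equal; unfold quotient_seq; f_equal.
    apply functional_extensionality; intros j; unfold tail; f_equal; lia.
  - intros r Hr; destruct (Tk (S k) r Hr) as [M HM]; exists M; intros m.
    unfold tail; replace (S m + k)%nat with (m + S k)%nat by lia; apply HM. }
split.
- unfold unit_ball in Hp; assert (Hn := qnorm_ge0 p).
  apply (bounded_tame _ (/ (1 - norm p))); intros n.
  apply (is_series_norm_le _ _ _ (tame_is_expansion _ (Tk (S n)) p Hp)); intros N.
  eapply Rle_trans; [apply norm_sum_nq|].
  apply Rle_trans with (sum_n (fun k => norm p ^ k) N).
  + apply sum_n_le; intros k _; rewrite qnorm_pow_mult.
    rewrite <- (Rmult_1_l (norm p ^ k)) at 2.
    apply Rmult_le_compat_r; [now apply pow_le | now apply contractive_coeff].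
  + apply (is_lim_seq_incr_compare (sum_n (fun k => norm p ^ k))).
    * apply is_series_geom; rewrite Rabs_pos_eq; assumption.
    * intros k; rewrite sum_Sn.
      change (sum_n (fun k => norm p ^ k) k <= sum_n (fun k => norm p ^ k) k + norm p ^ S k).
      generalize (pow_le _ (S k) Hn); lra.
- intros [|m].
  + rewrite conv_0; simpl affine; simpl single.
    assert (E : f p = (a 0%nat + p * quotient_seq a p 0)%quat).
    { rewrite <- Head.
      apply (is_series_uniq (fun m => p ^ m * a m)%quat); [now apply Hf|].
      eapply is_series_ext; [|exact (tame_is_expansion _ (Tk 0%nat) p Hp)].
      intros n; cbv beta; now rewrite Nat.add_0_r. }
    rewrite E; generalize (quotient_seq a p 0); qring.
  + rewrite conv_affine_S; simpl single.
    change (quotient_seq a p m) with (qPSeries (fun j => a (j + S m)%nat) p).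
    rewrite Head; generalize (quotient_seq a p (S m)); qring.
Qed.

Lemma is_expansion_minus_point p :
  is_expansion (fun q => q - p)%quat (affine (- p)%quat 1%quat).
Proof.
eapply is_expansion_ext; [|apply is_expansion_affine]; intros q _; qring.
Qed.

(** The quotient is an arbitrary choice, but only its defining equation enters
    below; read on expansions, it becomes an identity of coefficients. *)
Lemma difference_quotient_expansion f a p :
  is_expansion f a -> contractive a -> unit_ball p ->
  exists b, is_expansion (difference_quotient f p) b /\
    forall m, conv (affine (- p)%quat 1%quat) b m = (a m - single (f p) m)%quat.
Proof.
intros Hf Ha Hp.
assert (D : is_difference_quotient f p (difference_quotient f p)).
{ unfold difference_quotient; apply epsilon_spec.
  destruct (quotient_seq_spec f a p Hf Ha Hp) as [T E].
  exists (qPSeries (quotient_seq a p)); split; [now apply qPSeries_slice_regular|].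
  intros q Hq.
  assert (S := star_is_expansion _ _ _ _ (is_expansion_minus_point p)
    (tame_is_expansion _ T)).
  assert (S' := is_expansion_minus _ _ _ _ Hf (is_expansion_const (f p))).
  assert (V : star (fun q => q - p)%quat (qPSeries (quotient_seq a p)) q = (f q - f p)%quat).
  { apply (is_series_uniq _ _ _ (S q Hq)).
    eapply is_series_ext; [|exact (S' q Hq)]; intros n; cbv beta; now rewrite E. }
  rewrite V; qring. }
destruct D as [Dreg Deq].
destruct (slice_regular_expansion _ Dreg) as [b Hb].
exists b; split; [exact Hb|].
assert (S := star_is_expansion _ _ _ _ (is_expansion_minus_point p) Hb).
assert (S' := is_expansion_minus _ _ _ _ Hf (is_expansion_const (f p))).
assert (E : conv (affine (- p)%quat 1%quat) b = (fun m => a m - single (f p) m)%quat).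
2: { intros m; now rewrite E. }
apply (expansion_unique (fun q => f q - f p)%quat); [|exact S'].
eapply is_expansion_ext; [|exact S]; intros q Hq.
rewrite (Deq q Hq); generalize (star (fun q => q - p)%quat (difference_quotient f p) q); qring.
Qed.

(** * Star inverses *)

Lemma qPSeries_single c q : unit_ball q -> qPSeries (single c) q = c.
Proof.
intros Hq; apply qSeries_unique; exact (is_expansion_const c q Hq).
Qed.

(** With [s = k * k^c], a central series, [s * kappa = k^c] and
    [s * (kappa * kappa^c) = 1]; both identities evaluate pointwise, so [s] has
    no zeros and [kappa = s^-1 k^c]. *)
Lemma star_inv_expansion K k kappa : is_expansion K k -> tame kappa ->
  (forall m, conv kappa k m = single 1%quat m) ->
  is_expansion (star_inv K) kappa.
Proof.
intros HK Tkappa Hinv q Hq.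
assert (HKc := regular_conj_is_expansion K k HK).
assert (HS := star_is_expansion _ _ _ _ HK HKc).
set (s := conv k (conj_seq k)) in *.
assert (Ts : tame s) by exact (expansion_tame _ _ HS).
assert (Tkc : tame (conj_seq k)) by exact (expansion_tame _ _ HKc).
assert (Tcc : tame (conj_seq kappa)) by (apply (expansion_tame _ _ (regular_conj_is_expansion _ _ (tame_is_expansion _ Tkappa)))).
assert (Cs : central s).
{ apply central_of_conj_fixed; intros m; unfold s; rewrite conv_conj; f_equal.
  apply functional_extensionality; intros n; apply qconj_invol. }
assert (Hinv' : conv kappa k = single 1%quat) by now apply functional_extensionality.
assert (E1 : conv s kappa = conj_seq k).
{ apply functional_extensionality; intros m.
  rewrite conv_central by exact Cs; unfold s; rewrite <- conv_assoc, Hinv'.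
  rewrite conv_single_l; apply qmult_one_l. }
assert (E2 : conv s (conv kappa (conj_seq kappa)) = single 1%quat).
{ apply functional_extensionality; intros m.
  rewrite <- conv_assoc, E1, <- conv_conj, Hinv.
  destruct m; simpl; qring. }
assert (V1 : (qPSeries s q * qPSeries kappa q)%quat = regular_conj K q).
{ rewrite <- qPSeries_conv_central, E1 by assumption.
  apply qSeries_unique; exact (HKc q Hq). }
assert (V2 : (qPSeries s q * qPSeries (conv kappa (conj_seq kappa)) q)%quat = 1%quat).
{ rewrite <- qPSeries_conv_central, E2 by (assumption || now apply tame_conv).
  now apply qPSeries_single. }
assert (V3 : symmetrization K q = qPSeries s q).
{ symmetry; apply qSeries_unique; exact (HS q Hq). }
assert (Nz : qPSeries s q <> 0%quat).
{ intros Z; rewrite Z, qmult_zero_l in V2.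
  apply (f_equal qre) in V2; qcomp_all; lra. }
replace (star_inv K q) with (qPSeries kappa q).
- exact (tame_is_expansion _ Tkappa q Hq).
- unfold star_inv; rewrite V3, <- V1, qmult_assoc, qinv_l by exact Nz.
  now rewrite qmult_one_l.
Qed.

(** * Contractivity of the hyperbolic difference quotient *)

(** Convexity of the squared norm, with weights [1 - t] and [t]. *)
Lemma normsq_plus_le (p q : quat) t : 0 < t < 1 ->
  normsq (p + q)%quat <= normsq p / (1 - t) + normsq q / t.
Proof.
intros Ht.
assert (K : forall x y, (x + y) ^ 2 <= x ^ 2 / (1 - t) + y ^ 2 / t).
{ intros x y.
  assert (E : x ^ 2 / (1 - t) + y ^ 2 / t - (x + y) ^ 2
    = (t * x - (1 - t) * y) ^ 2 / (t * (1 - t))) by (field; lra).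
  assert (0 <= (t * x - (1 - t) * y) ^ 2 / (t * (1 - t))).
  { apply Rmult_le_pos; [apply pow2_ge_0 | left; apply Rinv_0_lt_compat; nra]. }
  lra. }
unfold normsq; autorewrite with quatc.
assert (K0 := K (qre p) (qre q)); assert (K1 := K (qim_i p) (qim_i q));
  assert (K2 := K (qim_j p) (qim_j q)); assert (K3 := K (qim_k p) (qim_k q)).
unfold Rdiv in *; lra.
Qed.

Lemma sqsum_plus_le x y t N : 0 < t < 1 ->
  sqsum (fun n => x n + y n)%quat N <= sqsum x N / (1 - t) + sqsum y N / t.
Proof.
intros Ht; induction N as [|N IH].
- rewrite !sqsum_0; now apply normsq_plus_le.
- rewrite !sqsum_S.
  assert (K := normsq_plus_le (x (S N)) (y (S N)) t Ht).
  unfold Rdiv in *; lra.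
Qed.

(** [x = 1 + u * x] bounds the truncated norms of [x = geometric u]. *)
Lemma geometric_tame u s : u 0%nat = 0%quat -> 0 < s < 1 ->
  (forall N x, sqsum (conv u x) N <= s ^ 2 * sqsum x N) -> tame (geometric u).
Proof.
intros Hu Hs Hc.
apply (bounded_tame _ (/ (1 - s))); intros n.
apply norm_le_normsq; [left; apply Rinv_0_lt_compat; lra|].
assert (E : geometric u = (fun m => single 1 m + conv u (geometric u) m)%quat).
{ apply functional_extensionality; intros m; now apply geometric_eq. }
assert (K : sqsum (geometric u) n <= 1 / (1 - s) + s * sqsum (geometric u) n).
{ rewrite E at 1; eapply Rle_trans; [apply (sqsum_plus_le _ _ s); exact Hs|].
  rewrite sqsum_single_one; apply Rplus_le_compat_l.
  apply Rmult_le_reg_r with s; [lra|].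
  replace (sqsum (conv u (geometric u)) n / s * s) with (sqsum (conv u (geometric u)) n) by (field; lra).
  eapply Rle_trans; [apply Hc|]; right; ring. }
assert (K2 : sqsum (geometric u) n <= (/ (1 - s)) ^ 2).
{ apply Rmult_le_reg_l with (1 - s); [lra|].
  replace ((1 - s) * (/ (1 - s)) ^ 2) with (1 / (1 - s)) by (field; lra). lra. }
eapply Rle_trans; [|exact K2].
destruct n as [|n]; [rewrite sqsum_0; lra|].
rewrite sqsum_S; generalize (sqsum_ge0 (geometric u) n); lra.
Qed.

(** Solving [(q - p) * z = v] backwards shows that [z] inherits
    square-summability from [v]; tameness excludes the solutions growing like
    [p^(-n)]. *)
Lemma division_bounded p z V : unit_ball p -> tame z -> 0 <= V ->
  (forall N, sqsum (conv (affine (- p)%quat 1%quat) z) N <= V) ->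
  exists Z, forall N, sqsum z N <= Z.
Proof.
intros Hp Tz HV Hv.
unfold unit_ball in Hp; assert (Hn := qnorm_ge0 p).
set (t := (1 + norm p) / 2); assert (Ht : 0 < t < 1) by (unfold t; lra).
set (v := conv (affine (- p)%quat 1%quat) z) in *.
assert (Step : forall N, sqsum z N <= V / (1 - t) + t * sqsum z (S N)).
{ intros N.
  assert (K : sqsum z N + normsq (v 0%nat) / (1 - t) + t * normsq (z 0%nat)
    <= sqsum v (S N) / (1 - t) + t * sqsum z (S N)).
  { assert (One : forall n, normsq (z n) <= normsq (v (S n)) / (1 - t) + t * normsq (z (S n))).
    { intros n.
      replace (z n) with (v (S n) + p * z (S n))%quat at 1
        by (unfold v; rewrite conv_affine_S; qring).
      eapply Rle_trans; [apply (normsq_plus_le _ _ t Ht)|].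
      apply Rplus_le_compat_l; rewrite normsq_mult, <- (norm_sq p).
      apply Rmult_le_reg_r with t; [lra|].
      replace (norm p ^ 2 * normsq (z (S n)) / t * t) with (norm p ^ 2 * normsq (z (S n))) by (field; lra).
      replace (t * normsq (z (S n)) * t) with (t ^ 2 * normsq (z (S n))) by ring.
      apply Rmult_le_compat_r; [apply normsq_ge0|].
      apply pow_incr; unfold t; lra. }
    induction N as [|N IH].
    - rewrite !sqsum_S, !sqsum_0; generalize (One 0%nat); unfold Rdiv; lra.
    - rewrite (sqsum_S z N), (sqsum_S v (S N)), (sqsum_S z (S N)).
      generalize (One (S N)); unfold Rdiv in *; lra. }
  assert (0 <= normsq (v 0%nat) / (1 - t)).
  { apply Rmult_le_pos; [apply normsq_ge0 | left; apply Rinv_0_lt_compat; lra]. }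
  assert (0 <= t * normsq (z 0%nat)) by (apply Rmult_le_pos; [lra | apply normsq_ge0]).
  assert (sqsum v (S N) / (1 - t) <= V / (1 - t)).
  { apply Rmult_le_compat_r; [left; apply Rinv_0_lt_compat; lra | apply Hv]. }
  lra. }
set (r := (1 + t) / 2); assert (Hr : 0 < r < 1) by (unfold r; lra).
assert (Htr : 0 < t / r ^ 2 < 1).
{ assert (0 < r ^ 2) by nra.
  split; [apply Rdiv_lt_0_compat; lra|].
  apply Rmult_lt_reg_r with (r ^ 2); [lra|].
  replace (t / r ^ 2 * r ^ 2) with t by (field; lra).
  unfold r; nra. }
destruct (Tz r Hr) as [M HM].
destruct (sum_n_nonneg_bounded (fun m => norm (z m) * r ^ m)) as [B HB].
{ intros m; apply Rmult_le_pos; [apply qnorm_ge0 | apply pow_le; lra]. }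
{ apply tame_ex_series; [exact Tz | lra]. }
assert (HM0 : 0 <= M).
{ eapply Rle_trans; [|apply (HM O)]; simpl; rewrite Rmult_1_r; apply qnorm_ge0. }
assert (Growth : forall N, (r ^ 2) ^ N * sqsum z N <= M * B).
{ intros N; apply Rle_trans with (sum_n (fun m => M * (norm (z m) * r ^ m)) N).
  - unfold sqsum; rewrite <- (sum_n_mult_l (K := R_Ring) ((r ^ 2) ^ N)).
    apply sum_n_le; intros n Hn'.
    change ((r ^ 2) ^ N * normsq (z n) <= M * (norm (z n) * r ^ n)).
    rewrite <- norm_sq.
    apply Rle_trans with (norm (z n) * r ^ n * (norm (z n) * r ^ n)).
    + replace (norm (z n) * r ^ n * (norm (z n) * r ^ n)) with ((r ^ 2) ^ n * norm (z n) ^ 2)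
        by (rewrite <- pow_mult, (Nat.mul_comm 2), pow_mult; ring).
      apply Rmult_le_compat_r; [apply pow2_ge_0|].
      replace N with (n + (N - n))%nat by lia; rewrite pow_add.
      rewrite <- (Rmult_1_r ((r ^ 2) ^ n)) at 2.
      apply Rmult_le_compat_l; [apply pow_le; nra|].
      rewrite <- (pow1 (N - n)); apply pow_incr; nra.
    + apply Rmult_le_compat_r; [|apply HM].
      apply Rmult_le_pos; [apply qnorm_ge0 | apply pow_le; lra].
  - rewrite (sum_n_mult_l (K := R_Ring) M); apply Rmult_le_compat_l; [exact HM0 | apply HB]. }
set (Z := V / (1 - t) / (1 - t)).
assert (HZ : Z = V / (1 - t) + t * Z) by (unfold Z; field; lra).
assert (HZ0 : 0 <= Z).
{ unfold Z; apply Rmult_le_pos; [apply Rmult_le_pos; [exact HV|]|];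
    left; apply Rinv_0_lt_compat; lra. }
exists Z; intros N; apply Rnot_lt_le; intros Hlt.
assert (Iter : forall j, sqsum z N - Z <= t ^ j * (sqsum z (N + j) - Z)).
{ intros j; induction j as [|j IH].
  - rewrite Nat.add_0_r; simpl; lra.
  - eapply Rle_trans; [exact IH|].
    replace (t ^ S j) with (t ^ j * t) by (simpl; ring).
    rewrite Rmult_assoc; apply Rmult_le_compat_l; [apply pow_le; lra|].
    rewrite Nat.add_succ_r; generalize (Step (N + j)%nat); lra. }
assert (Hr2 : 0 < (r ^ 2) ^ N) by (apply pow_lt; nra).
assert (HMB : 0 <= M * B).
{ eapply Rle_trans; [|apply (Growth O)]; simpl; rewrite Rmult_1_l; apply sqsum_ge0. }
destruct (pow_lt_1_zero (t / r ^ 2) ltac:(rewrite Rabs_pos_eq; lra)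
  ((sqsum z N - Z) * (r ^ 2) ^ N / (M * B + 1))) as [j Hj].
{ apply Rdiv_lt_0_compat; [apply Rmult_lt_0_compat; lra | lra]. }
specialize (Hj j (Nat.le_refl j)); rewrite Rabs_pos_eq in Hj by (apply pow_le; lra).
assert (K1 : t ^ j * (sqsum z (N + j) - Z) <= t ^ j * sqsum z (N + j)).
{ apply Rmult_le_compat_l; [apply pow_le; lra | lra]. }
assert (K2 : t ^ j * sqsum z (N + j) * (r ^ 2) ^ N <= (t / r ^ 2) ^ j * (M * B)).
{ unfold Rdiv; rewrite Rpow_mult_distr, pow_inv.
  assert (Hrj : 0 < (r ^ 2) ^ j) by (apply pow_lt; nra).
  replace (t ^ j * sqsum z (N + j) * (r ^ 2) ^ N)
    with (t ^ j * / (r ^ 2) ^ j * ((r ^ 2) ^ (N + j) * sqsum z (N + j)))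
    by (rewrite pow_add; field; lra).
  apply Rmult_le_compat_l; [|apply Growth].
  apply Rmult_le_pos; [apply pow_le; lra | left; now apply Rinv_0_lt_compat]. }
assert (K3 : (sqsum z N - Z) * (r ^ 2) ^ N <= (t / r ^ 2) ^ j * (M * B)).
{ eapply Rle_trans; [|exact K2]; apply Rmult_le_compat_r; [lra|].
  eapply Rle_trans; [apply (Iter j) | exact K1]. }
assert (K4 : (t / r ^ 2) ^ j * (M * B + 1) < (sqsum z N - Z) * (r ^ 2) ^ N).
{ apply (Rmult_lt_compat_r (M * B + 1)) in Hj; [|lra].
  replace ((sqsum z N - Z) * (r ^ 2) ^ N / (M * B + 1) * (M * B + 1))
    with ((sqsum z N - Z) * (r ^ 2) ^ N) in Hj by (field; lra).
  exact Hj. }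
assert (0 < (t / r ^ 2) ^ j) by (apply pow_lt; lra).
lra.
Qed.

Lemma bounded_sqsum_small_term z Z N e : (forall M, sqsum z M <= Z) -> 0 < e ->
  exists M, (N <= M)%nat /\ normsq (z M) < e.
Proof.
intros Hz He.
destruct (classic (exists M, (N <= M)%nat /\ normsq (z M) < e)) as [H|H]; [exact H|].
exfalso.
assert (K : forall j, INR j * e <= sqsum z (N + j)).
{ intros j; induction j as [|j IH].
  - simpl; rewrite Rmult_0_l; apply sqsum_ge0.
  - rewrite Nat.add_succ_r, sqsum_S, S_INR.
    assert (e <= normsq (z (S (N + j)))).
    { apply Rnot_lt_le; intros Hlt; apply H; exists (S (N + j)); split; [lia | exact Hlt]. }
    lra. }
destruct (INR_unbounded (Z / e)) as [j Hj].
assert (Z < INR j * e).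
{ apply Rmult_lt_reg_r with (/ e); [now apply Rinv_0_lt_compat|].
  rewrite Rmult_assoc, Rinv_r by lra; unfold Rdiv in Hj; lra. }
generalize (K j) (Hz (N + j)%nat); lra.
Qed.

(** [1 - q conj(p)] and [q - p] have the same modulus on the unit circle, hence
    multiply truncated norms equally up to a boundary term. *)
Lemma blaschke_sqsum p z N :
  sqsum (conv (affine 1%quat (- qconj p)%quat) z) N =
  sqsum (conv (affine (- p)%quat 1%quat) z) N + (1 - normsq p) * normsq (z N).
Proof.
induction N as [|N IH].
- rewrite !sqsum_0, !conv_0; simpl affine; unfold normsq; qcomp; ring.
- rewrite !sqsum_S, IH, !conv_affine_S; unfold normsq; qcomp; ring.
Qed.

(** The same identity for the value variable: [f] contractive makes
    [f - w] dominated by [1 - conj(w) f]. *)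
Lemma moebius_sqsum a w x N : contractive a -> normsq w <= 1 ->
  sqsum (conv (fun n => a n - single w n)%quat x) N
  <= sqsum (conv (fun n => single 1 n - qconj w * a n)%quat x) N.
Proof.
intros Ha Hw.
assert (E : sqsum (conv (fun n => single 1 n - qconj w * a n)%quat x) N
  - sqsum (conv (fun n => a n - single w n)%quat x) N
  = (1 - normsq w) * (sqsum x N - sqsum (conv a x) N)).
{ assert (One : forall n, normsq (conv (fun n => single 1 n - qconj w * a n)%quat x n)
    - normsq (conv (fun n => a n - single w n)%quat x n)
    = (1 - normsq w) * (normsq (x n) - normsq (conv a x n))).
  { intros n; rewrite !conv_minus_l, conv_mult_l, !conv_single_l.
    generalize (conv a x n) (x n); intros A X; unfold normsq; qcomp; ring. }
  induction N as [|N IH].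
  - rewrite !sqsum_0; apply One.
  - rewrite !sqsum_S; generalize (One (S N)); lra. }
assert (H := Ha N x); nra.
Qed.

(** With [x = kappa * y] and [z = b * x], [phi * y] is [(1 - q conj(p)) * z], of
    the norm of [(q - p) * z = (a - w) * x] up to a boundary term, hence bounded
    by [(1 - conj(w) a) * x = y]. The boundary term [z M] is small for suitable
    large [M]. *)
Theorem hyperbolic_quotient_contractive a b kappa p w :
  contractive a -> unit_ball p -> normsq w <= 1 -> tame b -> tame kappa ->
  (forall m, conv (affine (- p)%quat 1%quat) b m = (a m - single w m)%quat) ->
  (forall m, conv (fun n => single 1 n - qconj w * a n)%quat kappa m = single 1 m)%quat ->
  contractive (conv (conv (affine 1 (- qconj p)) b) kappa)%quat.
Proof.
intros Ha Hp Hw Tb Tk Hb Hk N y0.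
set (y := truncate N y0); set (x := conv kappa y); set (z := conv b x).
assert (Ty : tame y) by apply tame_truncate.
assert (Tz : tame z) by (apply tame_conv; [exact Tb | now apply tame_conv]).
assert (Hb' : conv (affine (- p)%quat 1%quat) b = (fun m => a m - single w m)%quat)
  by now apply functional_extensionality.
assert (Hk' : conv (fun n => single 1 n - qconj w * a n)%quat kappa = single 1%quat)
  by now apply functional_extensionality.
assert (Ez : conv (affine (- p)%quat 1%quat) z = conv (fun m => a m - single w m)%quat x).
{ apply functional_extensionality; intros m; unfold z; now rewrite <- conv_assoc, Hb'. }
assert (Ex : conv (fun n => single 1 n - qconj w * a n)%quat x = y).
{ apply functional_extensionality; intros m; unfold x; rewrite <- conv_assoc, Hk'.
  rewrite conv_single_l; apply qmult_one_l. }
assert (Ephi : conv (conv (conv (affine 1 (- qconj p)) b) kappa)%quat y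
  = conv (affine 1 (- qconj p))%quat z).
{ apply functional_extensionality; intros m; now rewrite !conv_assoc. }
assert (Hv : forall M, sqsum (conv (affine (- p)%quat 1%quat) z) M <= sqsum y M).
{ intros M; rewrite Ez; eapply Rle_trans; [now apply moebius_sqsum|]; rewrite Ex; lra. }
assert (Hy : forall M, sqsum y M <= sqsum y0 N).
{ intros M; destruct (le_lt_dec N M) as [H|H].
  - right; now apply sqsum_truncate.
  - eapply Rle_trans; [apply (sqsum_mono y M N); lia|]; right; apply sqsum_truncate; lia. }
destruct (division_bounded p z (sqsum y0 N) Hp Tz (sqsum_ge0 _ _)
  (fun M => Rle_trans _ _ _ (Hv M) (Hy M))) as [Z HZ].
replace (sqsum (conv (conv (conv (affine 1 (- qconj p)) b) kappa)%quat y0) N)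
  with (sqsum (conv (conv (conv (affine 1 (- qconj p)) b) kappa)%quat y) N).
2: { apply sqsum_ext_le; intros n Hn; apply conv_ext_le; [easy|].
     intros k Hk0; apply truncate_le; lia. }
rewrite Ephi.
apply Rnot_lt_le; intros Hlt.
assert (Hp2 : 0 <= normsq p < 1) by (split; [apply normsq_ge0 | now apply normsq_lt1]).
destruct (bounded_sqsum_small_term z Z N
  (sqsum (conv (affine 1 (- qconj p))%quat z) N - sqsum y0 N) HZ ltac:(lra)) as (M & HM & HzM).
assert (K1 := sqsum_mono (conv (affine 1 (- qconj p))%quat z) N M HM).
assert (K2 := blaschke_sqsum p z M).
assert (K3 := Hv M); assert (K4 := Hy M); assert (K5 := normsq_ge0 (z M)).
nra.
Qed.

(** * Two-point Pick inequality *)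

(** Powers of [q] to the right of [phi] move to its left; finite support reduces
    the claim to constants. *)
Lemma evaluation_of_product phi p N x : tame phi -> unit_ball p ->
  (forall n, (N < n)%nat -> x n = 0%quat) ->
  is_series (fun m => p ^ m * conv phi x m)%quat
    (sum_n (fun l => p ^ l * (qPSeries phi p * x l))%quat N).
Proof.
intros Hphi Hp; revert x; induction N as [|N IH]; intros x Hx.
- assert (E : x = single (x 0%nat)).
  { apply functional_extensionality; intros [|n]; [easy|]; simpl; apply Hx; lia. }
  rewrite sum_O.
  match goal with |- is_series _ ?lim => replace lim with (qPSeries phi p * x 0%nat)%quat end.
  + eapply is_series_ext; [|exact (is_series_qmult_r (x 0%nat) _ _ (tame_is_expansion _ Hphi p Hp))].
    intros n; cbv beta; rewrite E at 2; rewrite conv_single_r; symmetry; apply qmult_assoc.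
  + symmetry; apply qmult_one_l.
- assert (HT : forall n, (N < n)%nat -> tail x n = 0%quat) by (intros n Hn; apply Hx; lia).
  assert (S1 := is_series_qmult_r (x 0%nat) _ _ (tame_is_expansion _ Hphi p Hp)).
  assert (S2 := is_series_qmult_l p _ _ (IH _ HT)).
  set (v := fun m => match m with O => 0%quat | S k => (p * (p ^ k * conv phi (tail x) k))%quat end).
  assert (S3 : is_series v (p * sum_n (fun l => p ^ l * (qPSeries phi p * tail x l)) N)%quat).
  { apply (is_series_decr_1 (V := quat_NormedModule)).
    match goal with |- is_series _ ?lim =>
      replace lim with (p * sum_n (fun l => p ^ l * (qPSeries phi p * tail x l)) N)%quat end.
    - exact S2.
    - match goal with |- ?s = _ => change (s = s - 0)%quat end.
      match goal with |- ?s = _ => generalize s end; qring. }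
  match goal with |- is_series _ ?lim => replace lim with (qPSeries phi p * x 0%nat
     + p * sum_n (fun l => p ^ l * (qPSeries phi p * tail x l)) N)%quat end.
  + eapply is_series_ext; [|exact (is_series_qplus _ _ _ _ S1 S3)].
    intros [|m]; cbv beta.
    * rewrite conv_0; simpl v; rewrite <- qmult_assoc; apply qplus_zero_r.
    * rewrite conv_S_r; simpl v.
      change (p ^ S m * phi (S m) * x 0%nat + p * (p ^ m * conv phi (tail x) m)
        = p * p ^ m * (phi (S m) * x 0%nat + conv phi (tail x) m))%quat.
      change (p ^ S m)%quat with (p * p ^ m)%quat.
      generalize (conv phi (tail x) m); qring.
  + rewrite (sum_n_split_first (fun l => p ^ l * (qPSeries phi p * x l))%quat N), <- qsum_mult_l.
    apply (f_equal2 (plus (G := quat_AbelianMonoid))).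
    * symmetry; apply qmult_one_l.
    * apply sum_n_ext; intros l; exact (qmult_assoc p (p ^ l)%quat _).
Qed.

Lemma sqsum_geometric (c : quat) q x0 N (x : nat -> quat) :
  x 0%nat = x0 -> (forall n, normsq (x (S n)) = normsq c * normsq q ^ S n) ->
  normsq q < 1 ->
  sqsum x N = normsq x0 + normsq c * ((normsq q - normsq q ^ S N) / (1 - normsq q)).
Proof.
intros H0 HS Hq; induction N as [|N IH].
- rewrite sqsum_0, H0; simpl; field; lra.
- rewrite sqsum_S, IH, HS.
  replace (normsq q ^ S (S N)) with (normsq q * normsq q ^ S N) by reflexivity.
  field; lra.
Qed.

Lemma normsq_pow q n : normsq (q ^ n)%quat = normsq q ^ n.
Proof. rewrite <- !norm_sq, norm_pow, <- !pow_mult; f_equal; lia. Qed.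

(** The adjoint of a contractive multiplier contracts the combination
    [y = 1 la + k_p mu] of the evaluation vectors at 0 and [p]; [x] below is the
    image of [y] under the adjoint. *)
Lemma pick_form phi p la mu : contractive phi -> unit_ball p ->
  let b := qPSeries phi p in let c := phi 0%nat in
  let g := normsq p / (1 - normsq p) in
  normsq (qconj b * mu + qconj c * la)%quat + normsq b * normsq mu * g
  <= normsq (mu + la)%quat + normsq mu * g.
Proof.
intros Hc Hp b c g.
assert (Tphi : tame phi) by (apply (bounded_tame _ 1); intros n; now apply contractive_coeff).
assert (Hp2 : 0 <= normsq p < 1) by (split; [apply normsq_ge0 | now apply normsq_lt1]).
set (x := fun n => (qconj (p ^ n * b) * mu + single (qconj c * la) n)%quat).
set (y := fun n => (qconj (p ^ n) * mu + single la n)%quat).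
assert (Hy : forall M, sqsum y M <= normsq (mu + la)%quat + normsq mu * g).
{ intros M; rewrite (sqsum_geometric mu p (mu + la)%quat M y).
  - apply Rplus_le_compat_l, Rmult_le_compat_l; [apply normsq_ge0|].
    unfold g; apply Rmult_le_compat_r; [left; apply Rinv_0_lt_compat; lra|].
    generalize (pow_le _ (S M) (proj1 Hp2)); lra.
  - unfold y; change (p ^ 0)%quat with 1%quat; simpl single; qring.
  - intros n; unfold y; simpl single.
    replace (qconj (p ^ S n) * mu + 0)%quat with (qconj (p ^ S n) * mu)%quat by qring.
    rewrite normsq_mult, normsq_conj, normsq_pow; ring.
  - lra. }
assert (Hx : forall N, sqsum x N = normsq (qconj b * mu + qconj c * la)%quat
  + normsq b * normsq mu * ((normsq p - normsq p ^ S N) / (1 - normsq p))).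
{ intros N; rewrite <- normsq_mult.
  apply (sqsum_geometric (b * mu)%quat p).
  - unfold x; change (p ^ 0)%quat with 1%quat; simpl single; now rewrite qmult_one_l.
  - intros n; unfold x; simpl single.
    replace (qconj (p ^ S n * b) * mu + 0)%quat with (qconj (p ^ S n * b) * mu)%quat by qring.
    rewrite !normsq_mult, normsq_conj, normsq_mult, normsq_pow; ring.
  - lra. }
assert (Key : forall N, sqsum x N <= normsq (mu + la)%quat + normsq mu * g).
{ intros N; set (xN := truncate N x).
  assert (Hser := evaluation_of_product phi p N xN Tphi Hp (fun n Hn => truncate_gt N x n Hn)).
  fold b in Hser.
  set (L := sum_n (fun l => p ^ l * (b * xN l))%quat N) in Hser.
  (* The pairing of [y] with [phi * xN] is the square norm of [xN]. *)
  assert (EL : qre (qconj la * (c * xN 0%nat) + qconj mu * L)%quat = sqsum x N).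
  { assert (Gen : forall K, (K <= N)%nat ->
      qre (qconj la * (c * xN 0%nat)
        + qconj mu * sum_n (fun l => p ^ l * (b * xN l))%quat K)%quat = sqsum x K).
    { induction K as [|K IH]; intros HK.
      - rewrite sum_O, sqsum_0; unfold xN; rewrite truncate_le by lia.
        unfold x at 3; change (p ^ 0)%quat with 1%quat.
        assert (Ex0 : x 0%nat = (qconj b * mu + qconj c * la)%quat).
        { unfold x; change (p ^ 0)%quat with 1%quat; simpl single; now rewrite qmult_one_l. }
        rewrite Ex0; simpl single; rewrite qmult_one_l, !qmult_one_l.
        generalize b c; intros b' c'; unfold normsq; qcomp; ring.
      - rewrite sum_Sn, sqsum_S, <- IH by lia.
        assert (ExK : xN (S K) = (qconj (p ^ S K * b) * mu)%quat).
        { unfold xN; rewrite truncate_le by lia; unfold x; simpl single; qring. }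
        assert (ExK' : normsq (x (S K)) = qre (qconj mu * (p ^ S K * (b * xN (S K))))%quat).
        { rewrite ExK.
          replace (x (S K)) with (qconj (p ^ S K * b) * mu)%quat by (unfold x; simpl single; qring).
          transitivity (qre (qconj (qconj (p ^ S K * b) * mu) * (qconj (p ^ S K * b) * mu))%quat);
            [now rewrite qmult_conj_l|].
          f_equal; rewrite qconj_mult, qconj_invol; now rewrite !qmult_assoc. }
        rewrite ExK', <- qre_plus; f_equal.
        change (plus (sum_n (fun l => p ^ l * (b * xN l))%quat K) (p ^ S K * (b * xN (S K)))%quat)
          with (sum_n (fun l => p ^ l * (b * xN l)) K + p ^ S K * (b * xN (S K)))%quat.
        generalize (p ^ S K * (b * xN (S K)))%quat (c * xN 0%nat)%quat; qring. }
    now apply Gen. }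
  assert (Bound : qre (qconj la * (c * xN 0%nat) + qconj mu * L)%quat
    <= (normsq (mu + la)%quat + normsq mu * g + sqsum x N) / 2).
  { apply Rnot_lt_le; intros Hlt.
    assert (S' := is_series_qmult_l (qconj mu) _ _ Hser).
    unfold is_series in S'; rewrite (filterlim_quat eventually) in S'.
    set (e := qre (qconj la * (c * xN 0%nat) + qconj mu * L)%quat
      - (normsq (mu + la)%quat + normsq mu * g + sqsum x N) / 2).
    destruct (S' e) as [M HM]; [unfold e; lra|].
    specialize (HM M (Nat.le_refl M)).
    set (PM := sum_n (fun m => qconj mu * (p ^ m * conv phi xN m))%quat M).
    assert (HM' : norm (PM - qconj mu * L)%quat < e) by exact HM.
    assert (Young : forall K, qre (qconj la * (c * xN 0%nat)
        + sum_n (fun m => qconj mu * (p ^ m * conv phi xN m))%quat K)%quat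
      <= (sqsum y K + sqsum (conv phi xN) K) / 2).
    { assert (One : forall u v : quat, qre (qconj u * v)%quat <= (normsq u + normsq v) / 2).
      { intros u v; unfold normsq; qcomp.
        generalize (pow2_ge_0 (qre u - qre v)) (pow2_ge_0 (qim_i u - qim_i v))
          (pow2_ge_0 (qim_j u - qim_j v)) (pow2_ge_0 (qim_k u - qim_k v)); lra. }
      induction K as [|K IH].
      - rewrite sum_O, !sqsum_0, conv_0; fold c.
        eapply Rle_trans; [|apply One]; right; f_equal.
        unfold y; change (p ^ 0)%quat with 1%quat; simpl single.
        generalize (c * xN 0%nat)%quat; qring.
      - rewrite sum_Sn, !sqsum_S.
        assert (O1 := One (y (S K)) (conv phi xN (S K))).
        replace (qconj (y (S K)) * conv phi xN (S K))%quat
          with (qconj mu * (p ^ S K * conv phi xN (S K)))%quat in O1.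
        + match goal with |- qre ?q <= _ => replace q with
            ((qconj la * (c * xN 0%nat) + sum_n (fun m => qconj mu * (p ^ m * conv phi xN m)) K)
             + qconj mu * (p ^ S K * conv phi xN (S K)))%quat end.
          * rewrite qre_plus; lra.
          * match goal with |- _ = (_ + ?q)%quat => change q with
              (sum_n (fun m => qconj mu * (p ^ m * conv phi xN m)) K
               + qconj mu * (p ^ S K * conv phi xN (S K)))%quat end.
            generalize (qconj mu * (p ^ S K * conv phi xN (S K)))%quat (c * xN 0%nat)%quat; qring.
        + unfold y; simpl single.
          replace (qconj (p ^ S K) * mu + 0)%quat with (qconj (p ^ S K) * mu)%quat by qring.
          now rewrite qconj_mult, qconj_invol, <- qmult_assoc. }
    assert (Y1 := Young M); fold PM in Y1.
    assert (Y2 := Hc M xN); assert (Y3 := Hy M).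
    assert (Y4 : sqsum xN M <= sqsum x N).
    { destruct (le_lt_dec N M) as [H|H].
      - right; now apply sqsum_truncate.
      - eapply Rle_trans; [apply (sqsum_mono xN M N); lia|]; right; apply sqsum_truncate; lia. }
    assert (Y5 := Rabs_qre (PM - qconj mu * L)%quat).
    rewrite qre_minus in Y5; rewrite qre_plus in Y1.
    unfold e in HM'; rewrite qre_plus in HM'.
    revert Y5; unfold Rabs; destruct Rcase_abs; lra. }
  rewrite EL in Bound; lra. }
assert (Lim : forall N, normsq (qconj b * mu + qconj c * la)%quat
  + normsq b * normsq mu * g - normsq b * normsq mu / (1 - normsq p) * normsq p ^ S N
  <= normsq (mu + la)%quat + normsq mu * g).
{ intros N; eapply Rle_trans; [|apply (Key N)]; rewrite Hx; right; unfold g; field; lra. }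
apply Rnot_lt_le; intros Hlt.
set (C := normsq b * normsq mu / (1 - normsq p)).
assert (HC : 0 <= C).
{ unfold C; apply Rmult_le_pos; [apply Rmult_le_pos; apply normsq_ge0|].
  left; apply Rinv_0_lt_compat; lra. }
set (e := normsq (qconj b * mu + qconj c * la)%quat + normsq b * normsq mu * g
  - (normsq (mu + la)%quat + normsq mu * g)).
destruct (pow_lt_1_zero (normsq p) ltac:(rewrite Rabs_pos_eq; lra) (e / (C + 1))) as [N HN].
{ apply Rdiv_lt_0_compat; unfold e; lra. }
specialize (HN (S N) ltac:(lia)); rewrite Rabs_pos_eq in HN by (apply pow_le; lra).
apply (Rmult_lt_compat_l (C + 1)) in HN; [|lra].
replace ((C + 1) * (e / (C + 1))) with e in HN by (field; lra).
assert (K := Lim N); fold C in K; unfold e in HN.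
generalize (pow_le _ (S N) (proj1 Hp2)); lra.
Qed.

(** The form of [pick_form], restricted to [mu = 1] and [la] a real multiple of
    [1 - c conj(b)], is a nonnegative quadratic polynomial in one real variable;
    the claim is that its discriminant is not positive. *)
Lemma pick_inequality phi p : contractive phi -> unit_ball p ->
  let b := qPSeries phi p in let c := phi 0%nat in
  normsq (1 - c * qconj b)%quat * (1 - normsq p) <= (1 - normsq c) * (1 - normsq b).
Proof.
intros Hc Hp b c.
assert (Hp2 : 0 <= normsq p < 1) by (split; [apply normsq_ge0 | now apply normsq_lt1]).
set (E := (1 - c * qconj b)%quat); set (D := normsq E).
set (P := 1 - normsq c); set (Q := (1 - normsq b) / (1 - normsq p)).
assert (Form : forall tau, 0 <= P * D * tau ^ 2 - 2 * tau * D + Q).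
{ intros tau.
  assert (K := pick_form phi p (scal (- tau) E) 1%quat Hc Hp).
  cbv zeta in K; fold b c in K.
  assert (N1 : normsq (qconj b * 1 + qconj c * scal (- tau)%R E)%quat
    = normsq b - 2 * tau * qre (E * (b * qconj c))%quat + tau ^ 2 * (normsq c * D)).
  { unfold D, normsq; generalize E b c; intros; qcomp; ring. }
  assert (N2 : normsq (1 + scal (- tau)%R E)%quat = 1 - 2 * tau * qre E + tau ^ 2 * D).
  { unfold D, normsq; generalize E; intros; qcomp; ring. }
  assert (N3 : qre E - qre (E * (b * qconj c))%quat = D).
  { unfold D; transitivity (qre (E * qconj E)%quat).
    - rewrite <- qre_minus; f_equal; unfold E; qring.
    - now rewrite qmult_conj_r. }
  assert (N4 : normsq 1%quat = 1) by (unfold normsq; qcomp; ring).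
  rewrite N1, N2, N4 in K.
  assert (N5 : Q = 1 - normsq b + (1 - normsq b) * (normsq p / (1 - normsq p)))
    by (unfold Q; field; lra).
  unfold P; rewrite N5.
  replace (2 * tau * D) with (2 * tau * qre E - 2 * tau * qre (E * (b * qconj c))%quat)
    by (rewrite <- N3; ring).
  set (g := normsq p / (1 - normsq p)) in *.
  lra. }
assert (HP : 0 <= P).
{ unfold P; assert (K := contractive_coeff phi 0 Hc); fold c in K.
  apply normsq_le_norm in K; lra. }
assert (HQ : 0 <= Q) by (assert (K := Form 0); lra).
assert (HD : 0 <= D) by apply normsq_ge0.
assert (Main : D <= P * Q).
{ destruct (Req_dec D 0) as [Z|Z]; [rewrite Z; now apply Rmult_le_pos|].
  destruct (Req_dec P 0) as [ZP|ZP].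
  - exfalso; assert (K := Form ((Q + 1) / (2 * D))).
    rewrite ZP in K; replace (2 * ((Q + 1) / (2 * D)) * D) with (Q + 1) in K by (field; exact Z).
    lra.
  - assert (K := Form (/ P)).
    replace (P * D * (/ P) ^ 2 - 2 * / P * D + Q) with ((P * Q - D) / P) in K by (field; exact ZP).
    apply (Rmult_le_compat_r P) in K; [|exact HP].
    replace ((P * Q - D) / P * P) with (P * Q - D) in K by (field; exact ZP).
    lra. }
apply (Rmult_le_compat_r (1 - normsq p)) in Main; [|lra].
replace (P * Q * (1 - normsq p)) with (P * (1 - normsq b)) in Main by (unfold Q; field; lra).
exact Main.
Qed.

(** The pseudohyperbolic disc of radius [rho] about [c] is a Euclidean disc,
    whose scaling by [(1 - rho^2 |c|^2) / (1 - rho^2)] is centred at [c]. *)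
Lemma scaled_disc (b c : quat) rho : 0 < rho < 1 -> normsq c <= 1 ->
  normsq (1 - c * qconj b)%quat * (1 - rho ^ 2) <= (1 - normsq c) * (1 - normsq b) ->
  norm (scal ((1 - rho ^ 2 * normsq c) / (1 - rho ^ 2)) b - c)%quat
  <= rho * (1 - normsq c) / (1 - rho ^ 2).
Proof.
intros Hrho Hc H.
set (s := rho ^ 2) in *.
assert (Hs : 0 < s < 1) by (unfold s; nra).
assert (Hc0 := normsq_ge0 c).
set (al := (1 - s * normsq c) / (1 - s)).
assert (Hal : 0 <= al).
{ unfold al; apply Rmult_le_pos; [nra | left; apply Rinv_0_lt_compat; lra]. }
set (X := qre (b * qconj c)%quat).
assert (ED : normsq (1 - c * qconj b)%quat = 1 - 2 * X + normsq c * normsq b)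
  by (unfold X, normsq; qcomp; ring).
assert (EN : normsq (scal al b - c)%quat = al ^ 2 * normsq b - 2 * al * X + normsq c)
  by (unfold X, normsq; qcomp; ring).
rewrite ED in H.
apply norm_le_normsq.
- apply Rmult_le_pos; [apply Rmult_le_pos; lra | left; apply Rinv_0_lt_compat; lra].
- rewrite EN.
  assert (K : - 2 * al * X <= al * (s - normsq c - normsq b * (1 - s * normsq c)) / (1 - s)).
  { apply Rmult_le_reg_r with (1 - s); [lra|].
    replace (al * (s - normsq c - normsq b * (1 - s * normsq c)) / (1 - s) * (1 - s))
      with (al * (s - normsq c - normsq b * (1 - s * normsq c))) by (field; lra).
    replace (- 2 * al * X * (1 - s)) with (al * (- 2 * X * (1 - s))) by ring.
    apply Rmult_le_compat_l; [exact Hal | lra]. }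
  replace ((rho * (1 - normsq c) / (1 - s)) ^ 2)
    with (al ^ 2 * normsq b + al * (s - normsq c - normsq b * (1 - s * normsq c)) / (1 - s) + normsq c).
  + lra.
  + replace ((rho * (1 - normsq c) / (1 - s)) ^ 2) with (s * (1 - normsq c) ^ 2 / (1 - s) ^ 2)
      by (unfold s; field; fold s; lra).
    unfold al; field; lra.
Qed.

Theorem proposition3p5 (f : quat -> quat) (q0 : quat)
    (f_regular : slice_regular f)
    (f_ball : forall q : quat, unit_ball q -> unit_ball (f q))
    (f_0 : f 0%quat = 0%quat)
    (q0_ball : unit_ball q0) (q0_neq0 : q0 <> 0%quat) :
  norm (scal (alpha f q0) (hyp_derivative f q0) - qinv q0 * f q0)%quat
  <= (norm q0 ^ 2 - norm (f q0) ^ 2) / (norm q0 * (1 - norm q0 ^ 2)).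
Proof.
destruct (slice_regular_expansion f f_regular) as [a Ha].
assert (Ca : contractive a).
{ apply (bounded_contractive f a Ha); intros q Hq; left; now apply f_ball. }
set (w := f q0).
assert (Hw : norm w < 1) by now apply f_ball.
assert (Hw0 := qnorm_ge0 w).
assert (Hw2 : normsq w <= 1) by (rewrite <- norm_sq; nra).
destruct (difference_quotient_expansion f a q0 Ha Ca q0_ball) as (b & Hb & Eb); fold w in Eb.
set (u := fun n => (qconj w * a n)%quat).
assert (a0 : a 0%nat = 0%quat) by now rewrite <- (expansion_at_zero f a Ha).
assert (u0 : u 0%nat = 0%quat) by (unfold u; rewrite a0; apply qmult_zero_r).
set (kappa := geometric u).
assert (Tkappa : tame kappa).
{ apply (geometric_tame u ((1 + norm w) / 2) u0); [lra|]; intros N x.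
  apply Rle_trans with (normsq w * sqsum (conv a x) N).
  - unfold sqsum; rewrite <- (sum_n_mult_l (K := R_Ring) (normsq w)).
    apply sum_n_le; intros n _; unfold u; rewrite conv_mult_l, normsq_mult, normsq_conj.
    apply Rle_refl.
  - assert (K := Ca N x); assert (K0 := sqsum_ge0 (conv a x) N).
    apply Rmult_le_compat; [apply normsq_ge0 | exact K0 | | exact K].
    rewrite <- norm_sq; apply pow_incr; lra. }
assert (Hk : is_expansion (fun q => 1 - star (fun _ => qconj w) f q)%quat
  (fun n => single 1 n - u n)%quat).
{ apply is_expansion_minus; [apply is_expansion_const|].
  replace u with (conv (single (qconj w)) a)
    by (apply functional_extensionality; intros n; apply conv_single_l).
  apply star_is_expansion; [apply is_expansion_const | exact Ha]. }
assert (Hkinv := star_inv_expansion _ _ kappa Hk Tkappa (fun m => geometric_left_inverse u m u0)).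
assert (Hl : is_expansion (fun q => 1 - q * qconj q0)%quat (affine 1 (- qconj q0))%quat).
{ eapply is_expansion_ext; [|apply is_expansion_affine]; intros q _; qring. }
assert (Hphi := star_is_expansion _ _ _ _ (star_is_expansion _ _ _ _ Hl Hb) Hkinv).
set (phi := (conv (conv (affine 1 (- qconj q0)) b) kappa)%quat) in *.
assert (Cphi : contractive phi).
{ apply (hyperbolic_quotient_contractive a b kappa q0 w); try assumption.
  - exact (expansion_tame _ _ Hb).
  - intros m; now apply (geometric_right_inverse u). }
assert (Ehyp : hyp_derivative f q0 = qPSeries phi q0).
{ symmetry; apply qSeries_unique; exact (Hphi q0 q0_ball). }
assert (Ec : phi 0%nat = (qinv q0 * w)%quat).
{ assert (Eb0 := Eb 0%nat); rewrite conv_0, a0 in Eb0; simpl affine in Eb0; simpl single in Eb0.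
  assert (Ew : w = (q0 * b 0%nat)%quat).
  { transitivity (- (- q0 * b 0%nat))%quat; [rewrite Eb0; qring | qring]. }
  unfold phi; rewrite !conv_0; simpl affine.
  unfold kappa; rewrite (geometric_eq u 0 u0), conv_0, u0; simpl single.
  rewrite Ew, qmult_assoc, qinv_l by exact q0_neq0; qring. }
assert (Hq0 : 0 < norm q0).
{ destruct (Rle_lt_or_eq_dec 0 (norm q0) (qnorm_ge0 q0)) as [H|H]; [exact H|].
  exfalso; now apply q0_neq0, norm_eq0q. }
assert (Hq1 : norm q0 < 1) by exact q0_ball.
assert (Nc : normsq w = norm q0 ^ 2 * normsq (phi 0%nat)).
{ rewrite norm_sq, <- normsq_mult, Ec, qmult_assoc.
  replace (q0 * qinv q0)%quat with (qinv q0 * q0)%quat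
    by (unfold qinv; generalize (/ norm q0 ^ 2); qring).
  now rewrite qinv_l, qmult_one_l. }
assert (Hc1 : normsq (phi 0%nat) <= 1).
{ assert (K := contractive_coeff phi 0 Cphi); apply normsq_le_norm in K; lra. }
assert (Pick := pick_inequality phi q0 Cphi q0_ball); cbv zeta in Pick.
rewrite <- (norm_sq q0) in Pick.
assert (Disc := scaled_disc (qPSeries phi q0) (phi 0%nat) (norm q0) (conj Hq0 Hq1) Hc1 Pick).
fold w; rewrite <- Ec, Ehyp; unfold alpha; fold w.
rewrite (norm_sq w), Nc.
eapply Rle_trans; [exact Disc|].
right; field; nra.
Qed.
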